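(* Let $r\ge\beta_1(1)+1$, let $c\in[c_0,c_1]$, and let the meshes $\Delta$ be as described in the context. There exists a sequence $\Delta=(\Delta x,\Delta t)\to0$ for which the space-time periodic difference solutions $\{\bar v^{(c)}_\Delta\}$ (each with a suitable choice of its free additive constant) and $\{\bar u^{(c)}_\Delta\}$ converge to a $\mathbb Z^2$-periodic viscosity solution $\bar v$ of $v_t+H(x,t,c+v_x)=\bar h(c)$ and to a $\mathbb Z^2$-periodic entropy solution $\bar u=\bar v_x$ of $u_t+H(x,t,c+u)_x=0$, respectively: $$\sup_{t\in\mathbb T}\|\bar v^{(c)}_\Delta(\cdot,t)-\bar v(\cdot,t)\|_{C^0}\to0,\qquad\sup_{t\in\mathbb T}\|\bar u^{(c)}_\Delta(\cdot,t)-\bar u(\cdot,t)\|_{L^1(\mathbb T)}\to0.$$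
   Context: $\mathbb T=\mathbb R/\mathbb Z$. The function $H=H(x,t,p):\mathbb T^2\times\mathbb R\to\mathbb R$ satisfies: (A1) $H$ is $C^2$; (A2) $H_{pp}>0$; (A3) $\lim_{|p|\to\infty}H(x,t,p)/|p|=+\infty$; (A4) the Legendre transform $L(x,t,\xi)=\sup_{p}\{\xi p-H(x,t,p)\}$ satisfies $|L_x|\le\alpha(|L|+1)$ for some $\alpha>0$. Real numbers $r>0$, $c_0\le c_1$ are fixed. $L^\infty_{r,0}(\mathbb T)$: all $u^0\in L^\infty(\mathbb T)$ with $\|u^0\|_{L^\infty}\le r$, $\int_{\mathbb T}u^0dx=0$. $Lip_r(\mathbb T)$: Lipschitz functions on $\mathbb T$ with Lipschitz constant at most $r$. $\phi^t(u^0;c)=u(\cdot,t)$, where $u$ is the entropy solution of $u_t+H(x,t,c+u)_x=0$, $u(\cdot,0)=u^0$. The effective Hamiltonian $\bar h(c)$ is the unique real number such that $v_t+H(x,t,c+v_x)=\bar h(c)$ admits a $\mathbb Z^2$-periodic viscosity solution. The representative of an entropy solution is always $u=v_x$ for the corresponding viscosity solution $v$. Mesh: $N\le K$ are natural numbers, $\Delta x=(2N)^{-1}$, $\Delta t=(2K)^{-1}$, $\lambda=\Delta t/\Delta x$, $x_m=m\Delta x$, $t_k=k\Delta t$. Lax-Friedrichs scheme: $u^k_m$ ($m+k$ even) satisfies $$\frac{u^{k+1}_{m+1}-\frac{u^k_m+u^k_{m+2}}2}{\Delta t}+\frac{H(x_{m+2},t_k,c+u^k_{m+2})-H(x_m,t_k,c+u^k_m)}{2\Delta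 x}=0,\quad u^k_{m\pm2N}=u^k_m,$$ with $u^0_m=\frac1{2\Delta x}\int_{x_m-\Delta x}^{x_m+\Delta x}u^0dy$ ($m$ even); $u_\Delta(x,t)=u^k_m$ on $[x_{m-1},x_{m+1})\times[t_k,t_{k+1})$, $\phi^t_\Delta(u^0;c)=u_\Delta(\cdot,t)$. Difference Hamilton-Jacobi equation: $v^k_m$ ($m+k$ odd) satisfies $$\frac{v^{k+1}_m-\frac{v^k_{m-1}+v^k_{m+1}}2}{\Delta t}+H\Big(x_m,t_k,c+\frac{v^k_{m+1}-v^k_{m-1}}{2\Delta x}\Big)=h(c),\quad v^k_{m+1\pm2N}=v^k_{m+1},$$ with $v^0_{m+1}=v^0(x_{m+1})$ ($m$ even); $v_\Delta(x,t)=v^k_{m-1}+\frac{v^k_{m+1}-v^k_{m-1}}{2\Delta x}(x-x_{m-1})$ on $[x_{m-1},x_{m+1})\times[t_k,t_{k+1})$ ($m+k$ even), $\psi^t_\Delta(v^0;c)=v_\Delta(\cdot,t)$. Choice of $r$ and mesh: $\beta_1(1)>0$ is a constant, independent of $r$, $c\in[c_0,c_1]$ and the initial data, such that $\|\phi^1(u^0;c)\|_{L^\infty}\le\beta_1(1)$ for all $c\in[c_0,c_1]$ and all bounded zero-mean $u^0$. Constants $0<\lambda_0<\lambda_1$ and $\delta>0$ are fixed such that, for every mesh with $\lambda_0\le\lambda<\lambda_1$, $\Delta x\le\delta$, every $c\in[c_0,c_1]$ and every $u^0\in L^\infty_{r,0}(\mathbb T)$: (i) $|H_p(x_m,t_k,c+u^k_m)|\le\lambda_1^{-1}<\lambda^{-1}$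 for all $k\ge0$ and all $m$ with $m+k$ even; (ii) $\|\phi^1_\Delta(u^0;c)\|_{L^\infty}\le\beta_1(1)+1$, so $\phi^1_\Delta(\cdot;c)$ maps $L^\infty_{r,0}(\mathbb T)$ into itself. (Such constants exist.) All meshes satisfy $\lambda_0\le\lambda<\lambda_1$, $\Delta x\le\delta$, and $\Delta\to0$ is taken within this class. Periodic difference solutions: for such $\Delta$ and each $c\in[c_0,c_1]$, $\phi^1_\Delta(\cdot;c)$ has a unique fixed point $\bar u^0_\Delta\in L^\infty_{r,0}(\mathbb T)$, and $\bar u^{(c)}_\Delta(\cdot,t)=\phi^t_\Delta(\bar u^0_\Delta;c)$. There is a unique constant $\bar h_\Delta(c)$ such that for $h(c)=\bar h_\Delta(c)$ the map $\psi^1_\Delta(\cdot;c)$ has a fixed point $\bar v^0_\Delta\in Lip_r(\mathbb T)$, unique up to additive constants, and $\bar v^{(c)}_\Delta(\cdot,t)=\psi^t_\Delta(\bar v^0_\Delta;c)$; moreover $(\bar v^{(c)}_\Delta)_x=\bar u^{(c)}_\Delta$. Both are $1$-periodic in $t$. *)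

(* Defs.v *)
From HB Require Import structures.
From mathcomp Require Export all_boot all_order all_algebra.
From mathcomp Require Export all_classical all_reals all_analysis.
From mathcomp Require Import ring lra zify.

Set Implicit Arguments.
Unset Strict Implicit.
Unset Printing Implicit Defensive.

Export Order.TTheory GRing.Theory Num.Theory.
Export numFieldNormedType.Exports.

Local Open Scope classical_set_scope.
Local Open Scope ring_scope.

(* Functions on the torus T = R/Z are 1-periodic functions on R; functions of
   space and time take their arguments in the order (x, t). *)

Section Regularity.
Context {R : realType}.
Implicit Types (f : R -> R -> R) (g : R -> R -> R -> R).

Definition dx2 f : R -> R -> R := fun x t => derive1 (f ^~ t) x.
Definition dt2 f : R -> R -> R := fun x t => derive1 (f x) t.

Definition C0_2 f := continuous (fun z : R * R => f z.1 z.2).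

Definition C1_2 f :=
  [/\ forall x t, derivable (f ^~ t) x 1 /\ derivable (f x) t 1,
      C0_2 f, C0_2 (dx2 f) & C0_2 (dt2 f)].

Definition dx3 g : R -> R -> R -> R :=
  fun x t p => derive1 (fun y => g y t p) x.
Definition dt3 g : R -> R -> R -> R :=
  fun x t p => derive1 (fun s => g x s p) t.
Definition dp3 g : R -> R -> R -> R :=
  fun x t p => derive1 (g x t) p.

Definition C0_3 g := continuous (fun z : R * R * R => g z.1.1 z.1.2 z.2).

Definition C1_3 g :=
  [/\ forall x t p, [/\ derivable (fun y => g y t p) x 1,
                        derivable (fun s => g x s p) t 1
                      & derivable (g x t) p 1],
      C0_3 g, C0_3 (dx3 g), C0_3 (dt3 g) & C0_3 (dp3 g)].

Definition C2_3 g :=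
  [/\ C1_3 g, C1_3 (dx3 g), C1_3 (dt3 g) & C1_3 (dp3 g)].

Definition Z2_periodic f :=
  forall x t, f (x + 1) t = f x t /\ f x (t + 1) = f x t.

End Regularity.

Section Solutions.
Context {R : realType}.
Variable H : R -> R -> R -> R.

Definition legendre (x t xi : R) : R :=
  sup [set xi * p - H x t p | p in [set: R]].

Definition mu1 : {measure set (measurableTypeR R) -> \bar R} :=
  @lebesgue_measure R.

(* For a 1-periodic function the essential supremum over R is the one over
   the torus. *)
Definition normLinf (u : R -> R) : \bar R := 'N[mu1]_+oo%E[EFin \o u].

Definition zero_mean_Linf (u : R -> R) :=
  [/\ periodic u 1, measurable_fun [set: R] u, (normLinf u < +oo)%E
    & \int[mu1]_(x in `[0, 1]) u x = 0].

Definition Linf_r0 (r : R) (u : R -> R) :=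
  zero_mean_Linf u /\ (normLinf u <= r%:E)%E.

Definition Lip_r (r : R) (v : R -> R) := periodic v 1 /\ r.-lipschitz v.

(* Viscosity solutions of v_t + H(x,t,c+v_x) = h on the whole plane. *)
Definition viscosity_solution (c h : R) (v : R -> R -> R) :=
  C0_2 v /\
  forall (f : R -> R -> R) (x t : R), C1_2 f ->
    ((\forall z \near ((x, t) : R * R),
         v z.1 z.2 - f z.1 z.2 <= v x t - f x t) ->
       dt2 f x t + H x t (c + dx2 f x t) <= h) /\
    ((\forall z \near ((x, t) : R * R),
         v x t - f x t <= v z.1 z.2 - f z.1 z.2) ->
       h <= dt2 f x t + H x t (c + dx2 f x t)).

Definition effective_hamiltonian (c : R) : R :=
  get [set h | exists v, Z2_periodic v /\ viscosity_solution c h v].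

(* Kruzhkov entropy inequality for u_t + H(x,t,c+u)_x = 0, tested with
   functions compactly supported in R x interior(I). *)
Definition entropy_inequality (c : R) (I : set R) (u : R -> R -> R) :=
  forall (k : R) (f : R -> R -> R), C1_2 f -> (forall x t, 0 <= f x t) ->
    (exists K : set (R * R), [/\ compact K, (forall z, K z -> I° z.2)
       & forall z, ~ K z -> f z.1 z.2 = 0]) ->
    0 <= \int[(mu1 \x mu1)%E]_(z in [set: R] `*` I)
           (`|u z.1 z.2 - k| * dt2 f z.1 z.2
            + Num.sg (u z.1 z.2 - k)
                * (H z.1 z.2 (c + u z.1 z.2) - H z.1 z.2 (c + k))
                * dx2 f z.1 z.2
            - Num.sg (u z.1 z.2 - k) * dx3 H z.1 z.2 (c + k) * f z.1 z.2).

(* The continuity in time with values in L^1(T) singles out u(.,t), as an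
   element of L^1(T), for every t; it agrees with v_x(.,t) for the
   corresponding viscosity solution v. *)
Definition entropy_solution (c : R) (I : set R) (u : R -> R -> R) :=
  [/\ forall t, I t -> periodic (u ^~ t) 1,
      measurable_fun
        ([set: measurableTypeR R] `*` (I : set (measurableTypeR R)))
        (fun z : measurableTypeR R * measurableTypeR R => u z.1 z.2),
      forall J, compact J -> J `<=` I ->
        exists B : R, forall t, J t -> (normLinf (u ^~ t) <= B%:E)%E,
      forall t, I t ->
        (\int[mu1]_(x in `[0%R, 1%R]) `|u x s - u x t|%:E)%E
          @[s --> within I (nbhs t)] --> 0%E
    & entropy_inequality c I u].

(* u(.,t) = phi^t(u0; c) for t >= 0. *)
Definition entropy_solution_from (c : R) (u0 : R -> R) (u : R -> R -> R) :=
  entropy_solution c `[0, +oo[ u /\ {ae mu1, forall x, u x 0 = u0 x}.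

End Solutions.

Record mesh := Mesh {
  mesh_N : nat;
  mesh_K : nat;
  mesh_N_gt0 : (0 < mesh_N)%N;
  mesh_NK : (mesh_N <= mesh_K)%N }.

Section Scheme.
Context {R : realType}.
Variable H : R -> R -> R -> R.
Implicit Types (M : mesh) (c : R) (k : nat) (m : int).

Definition space_step M : R := (2 * (mesh_N M)%:R)^-1.
Definition time_step M : R := (2 * (mesh_K M)%:R)^-1.
Definition mesh_ratio M : R := time_step M / space_step M.

Definition xgrid M m : R := m%:~R * space_step M.
Definition tgrid M k : R := k%:R * time_step M.

Definition grid_even k m : bool := (2 %| m + k%:Z)%Z.
Definition grid_odd k m : bool := ~~ grid_even k m.

(* The recursions below are run at every (k, m). The scheme only couples
   grid points of one parity of m + k, and only the values with m + k even
   (for [LF]), resp. odd (for [HJ]), are ever used. *)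
Fixpoint LF M c (u0 : R -> R) k : int -> R :=
  match k with
  | 0 => fun m => (2 * space_step M)^-1 *
      \int[mu1]_(y in `[xgrid M m - space_step M, xgrid M m + space_step M])
        u0 y
  | k'.+1 => fun m => let u := LF M c u0 k' in
      (u (m - 1) + u (m + 1)) / 2
      - time_step M / (2 * space_step M) *
          (H (xgrid M (m + 1)) (tgrid M k') (c + u (m + 1))
           - H (xgrid M (m - 1)) (tgrid M k') (c + u (m - 1)))
  end.

Fixpoint HJ M c (h : R) (v0 : R -> R) k : int -> R :=
  match k with
  | 0 => fun m => v0 (xgrid M m)
  | k'.+1 => fun m => let v := HJ M c h v0 k' in
      (v (m - 1) + v (m + 1)) / 2
      - time_step M *
          (H (xgrid M m) (tgrid M k')
             (c + (v (m + 1) - v (m - 1)) / (2 * space_step M)) - h)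
  end.

Definition time_index M (t : R) : nat := Num.truncn (t / time_step M).

(* The integer m with m + k even and x in [x_{m-1}, x_{m+1}[. *)
Definition cell M k (x : R) : int :=
  2 * Num.floor ((x / space_step M - k%:R + 1) / 2) + k%:Z.

Definition phi_Delta M c (t : R) (u0 : R -> R) (x : R) : R :=
  let k := time_index M t in LF M c u0 k (cell M k x).

Definition psi_Delta M c (h t : R) (v0 : R -> R) (x : R) : R :=
  let k := time_index M t in
  let m := cell M k x in
  let v := HJ M c h v0 k in
  v (m - 1) + (v (m + 1) - v (m - 1)) / (2 * space_step M)
                * (x - xgrid M (m - 1)).

Definition admissible_mesh (l0 l1 delta : R) M :=
  l0 <= mesh_ratio M < l1 /\ space_step M <= delta.

Definition ubar0_Delta (r c : R) M : R -> R :=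
  get [set u0 : R -> R | Linf_r0 r u0 /\
         {ae @mu1 R, forall x, phi_Delta M c 1 u0 x = u0 x}].

Definition ubar_Delta (r c : R) M (x t : R) : R :=
  phi_Delta M c t (ubar0_Delta r c M) x.

Definition hbar_Delta (r c : R) M : R :=
  get [set h | exists v0, Lip_r r v0 /\ psi_Delta M c h 1 v0 =1 v0].

(* The fixed point is only unique up to additive constants; [get] selects one
   of them. *)
Definition vbar0_Delta (r c : R) M : R -> R :=
  get [set v0 : R -> R | Lip_r r v0 /\
         psi_Delta M c (hbar_Delta r c M) 1 v0 =1 v0].

Definition vbar_Delta (r c : R) M (x t : R) : R :=
  psi_Delta M c (hbar_Delta r c M) t (vbar0_Delta r c M) x.

(* The recursions solve the difference equations in their original form. *)
Lemma space_step_gt0 M : 0 < space_step M.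
Proof. by rewrite invr_gt0 mulr_gt0 // ltr0n mesh_N_gt0. Qed.

Lemma time_step_gt0 M : 0 < time_step M.
Proof.
by rewrite invr_gt0 mulr_gt0 // ltr0n (leq_trans (mesh_N_gt0 M)) ?mesh_NK.
Qed.

Lemma LF_scheme M c u0 k m : let u := LF M c u0 in
  (u k.+1 (m + 1) - (u k m + u k (m + 2)) / 2) / time_step M
  + (H (xgrid M (m + 2)) (tgrid M k) (c + u k (m + 2))
     - H (xgrid M m) (tgrid M k) (c + u k m)) / (2 * space_step M) = 0.
Proof.
move=> u; rewrite /u /= addrK.
rewrite (_ : m + 2 = m + 1 + 1); last by rewrite -addrA.
have /lt0r_neq0 tn := time_step_gt0 M; have /lt0r_neq0 sn := space_step_gt0 M.
by field; rewrite sn tn.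
Qed.

Lemma HJ_scheme M c h v0 k m : let v := HJ M c h v0 in
  (v k.+1 m - (v k (m - 1) + v k (m + 1)) / 2) / time_step M
  + H (xgrid M m) (tgrid M k)
      (c + (v k (m + 1) - v k (m - 1)) / (2 * space_step M)) = h.
Proof.
move=> v; rewrite /v /=; have /lt0r_neq0 tn := time_step_gt0 M.
by field.
Qed.

Lemma cellP M k (x : R) :
  grid_even k (cell M k x) /\
  xgrid M (cell M k x - 1) <= x < xgrid M (cell M k x + 1).
Proof.
split.
  rewrite /grid_even /cell; set f := Num.floor _.
  by apply/dvdzP; exists (f + k%:Z); ring.
have sp := space_step_gt0 M.
rewrite /xgrid -ler_pdivlMr// -ltr_pdivrMr// /cell.
set y := x / space_step M.
have /andP[] := floor_itv ((y - k%:R + 1) / 2).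
set f := Num.floor _ => h1 h2.
rewrite !(rmorphD, rmorphM, rmorphN) /= -[k%:~R]/(k%:R).
by apply/andP; split; lra.
Qed.

End Scheme.

(* Main.v *)
Require Import Defs.
From mathcomp Require Import ring lra zify measurable_realfun ess_sup_inf.

(** Why the theorem holds.

    Both schemes are one scheme: the difference quotients of a solution of the
    Hamilton-Jacobi scheme solve the Lax-Friedrichs scheme ([GHJ_slope]), and
    the constant h only adds a linear drift in time.  Under the CFL condition
    the difference of two solutions evolves by averages of neighbouring values
    with weights bounded away from 0 ([GHJ_diff_rec]).  Over one period of time
    the averages reach all nodes of the torus, so the oscillation of the
    difference contracts by a fixed factor ([orbit_diff_geometric]).  This gives
    existence and uniqueness of the periodic difference solutions, hence
    identifies the functions picked by [get] in their definition with the
    interpolants [vinterp] and [uinterp] of a single periodic solution of the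
    scheme ([periodic_scheme]).

    Bounds that do not depend on the mesh come from three sources.  The CFL
    condition bounds the derivative of H in p, and superlinearity with convexity
    turns this into a bound of the slopes ([Hp_coercive]).  Periodicity in time
    bounds the drift, and thus the variation in time.  Strong convexity gives a
    one-sided bound of second difference quotients: their supremum E over all
    nodes and times satisfies a discrete Riccati inequality ([one_sided]).  By
    Arzela-Ascoli a subsequence of the interpolants converges uniformly to a
    Lipschitz periodic function v ([uniform_subsequence]).

    The function v is a viscosity solution: a test function touching v at a
    point touches the grid functions at nearby nodes up to errors smaller than
    the time step, and convexity replaces the monotonicity of the scheme, which
    is available only within the CFL range ([viscosity_limit]).  Comparison by
    doubling of variables shows that the limit of the constants is the effective
    Hamiltonian ([effective_hamiltonian_unique]).

    The limit is semiconcave in x, since the one-sided bound survives.  The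
    discrete slopes, as well as v_x, lie between the backward and the forward
    difference quotients of v of a given step k, up to an error E k plus a
    quantity that vanishes with the mesh ([slope_sandwich]).  The two quotients
    have the same integral over a period, so the L1 distance of two functions
    in that gap is at most a multiple of the error, uniformly in t
    ([L1_sandwich]).  This proves the L1 convergence, the continuity of v_x in
    time with values in L1, and differentiability almost everywhere.

    It remains to see that v_x satisfies Kruzhkov's inequality.  In each cell
    the scheme satisfies it up to an error of the order of the square of the
    time step, for every level, including the levels outside the CFL range
    ([cell_entropy]).  Tested against f, the difference operators move to f by
    translation invariance of the Lebesgue measure ([discrete_weak]), and
    dominated convergence applies, except that the discrete signs are not
    controlled where v_x equals the level.  Averaging the inequalities of the
    levels slightly above and slightly below removes this defect
    ([entropy_limit]). *)

Set Implicit Arguments.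
Unset Strict Implicit.
Unset Printing Implicit Defensive.

Local Open Scope classical_set_scope.
Local Open Scope ring_scope.

(** * Calculus of the Hamiltonian *)

Section Calculus.
Context {R : realType}.

Lemma mvt_between (f : R -> R) (a b : R) : (forall x, derivable f x 1) ->
  exists2 xi : R, Num.min a b <= xi <= Num.max a b
    & f b - f a = derive1 f xi * (b - a).
Proof.
move=> df.
have isd x : is_derive x (1 : R) f (derive1 f x).
  by rewrite derive1E; exact: derivableP.
have cf : continuous f.
  by move=> x; apply: differentiable_continuous; exact/derivable1_diffP.
have cw A : {within A, continuous f} by apply: continuous_subspaceT.
have [ab|ba] := leP a b.
  have [xi + ->] := MVT_segment ab (fun x _ => isd x) (cw _).
  by rewrite in_itv /=; exists xi.
have [xi + e] := MVT_segment (ltW ba) (fun x _ => isd x) (cw _).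
by rewrite in_itv /=; exists xi => //; lra.
Qed.

Lemma derive1_shift (f : R -> R) (a x : R) :
  derive1 (fun y => f (y + a)) x = derive1 f (x + a).
Proof.
rewrite /derive1 /=.
have -> : (fun h : R => h^-1 *: (f (h + x + a) - f (x + a))) =
    (fun h => h^-1 *: (f (h + (x + a)) - f (x + a))) by apply/funext => h; rewrite addrA.
by [].
Qed.

Definition frac (x : R) := x - (Num.floor x)%:~R.

Lemma frac_itv x : 0 <= frac x < 1.
Proof.
rewrite /frac; have /andP[] := floor_itv x.
by rewrite intrD => *; apply/andP; split; lra.
Qed.

Lemma periodic_int (T : Type) (f : R -> T) (k : int) x :
  (forall x, f (x + 1) = f x) -> f (x + k%:~R) = f x.
Proof.
move=> fP.
have P1 (n : nat) y : f (y + n%:R) = f y.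
  elim: n y => [|n IH] y; first by rewrite addr0.
  by rewrite -natr1 addrA fP IH.
case: k => n; first exact: P1.
rewrite NegzE mulrNz -[LHS](P1 n.+1); congr f.
by rewrite subrK.
Qed.

Lemma frac_periodic (T : Type) (f : R -> T) x :
  (forall x, f (x + 1) = f x) -> f (frac x) = f x.
Proof. by move=> fP; rewrite /frac -mulrNz periodic_int. Qed.

Definition per3 (g : R -> R -> R -> R) :=
  forall x t p, g (x + 1) t p = g x t p /\ g x (t + 1) p = g x t p.

Lemma per3_frac g x t p : per3 g -> g (frac x) (frac t) p = g x t p.
Proof.
move=> gP.
rewrite (@frac_periodic _ (fun y => g y (frac t) p)); last by move=> y; case: (gP y (frac t) p).
by rewrite (@frac_periodic _ (fun s => g x s p))// => s; case: (gP x s p).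
Qed.

Lemma per3_dx g : per3 g -> per3 (dx3 g).
Proof.
move=> gP x t p; split; rewrite /dx3.
  rewrite -derive1_shift (_ : (fun y => g (y + 1) t p) = (fun y => g y t p))//.
  by apply/funext => y; case: (gP y t p).
by congr (derive1 _ _); apply/funext => y; case: (gP y t p).
Qed.

Lemma per3_dt g : per3 g -> per3 (dt3 g).
Proof.
move=> gP x t p; split; rewrite /dt3.
  by congr (derive1 _ _); apply/funext => y; case: (gP x y p).
rewrite -derive1_shift (_ : (fun y => g x (y + 1) p) = (fun y => g x y p))//.
by apply/funext => y; case: (gP x y p).
Qed.

Lemma per3_dp g : per3 g -> per3 (dp3 g).
Proof.
move=> gP x t p; split; rewrite /dp3.
  by congr (derive1 _ _); apply/funext => y; case: (gP x t y).
by congr (derive1 _ _); apply/funext => y; case: (gP x t y).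
Qed.

Lemma compact_box3 (P : R) :
  compact ((`[0, 1] `*` `[0, 1]) `*` `[-P, P] : set (R * R * R)).
Proof. by do ! apply: compact_setX; exact: segment_compact. Qed.

(** By periodicity it is enough to bound g on a compact box. *)
Lemma C0_3_bounded g (P : R) : per3 g -> C0_3 g ->
  exists C : R, forall x t p, `|p| <= P -> `|g x t p| <= C.
Proof.
move=> gP gC.
have [P0|P0] := ltP P 0.
  by exists 0 => x t p /(le_trans (normr_ge0 p)); rewrite leNgt P0.
have ne : ((`[0, 1] `*` `[0, 1]) `*` `[-P, P] : set (R * R * R)) !=set0.
  by exists (0, 0, 0); split => /=; [split|]; rewrite /= in_itv/=; apply/andP; split; lra.
have nC : {within ((`[0, 1] `*` `[0, 1]) `*` `[-P, P] : set (R * R * R)),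
   continuous (fun z : R * R * R => `|g z.1.1 z.1.2 z.2|)}.
  apply: continuous_subspaceT => z.
  by apply: continuous_comp; [exact: gC|exact: norm_continuous].
have [z _ zmax] := compact_EVT_max ne (@compact_box3 P) nC.
exists (`|g z.1.1 z.1.2 z.2|) => x t p pP.
rewrite -(per3_frac x t p gP); apply: (zmax (frac x, frac t, p)).
have := frac_itv x; have := frac_itv t; rewrite inE /=.
by move=> /andP[? ?] /andP[? ?]; split => /=; [split|] => /=;
  rewrite in_itv/= -?ler_norml//; apply/andP; split; lra.
Qed.

Lemma C0_3_pos_bounded g (P : R) : per3 g -> C0_3 g ->
  (forall x t p, 0 < g x t p) ->
  exists2 a : R, 0 < a & forall x t p, `|p| <= P -> a <= g x t p.
Proof.
move=> gP gC g0.
have [P0|P0] := ltP P 0.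
  by exists 1 => // x t p /(le_trans (normr_ge0 p)); rewrite leNgt P0.
have ne : ((`[0, 1] `*` `[0, 1]) `*` `[-P, P] : set (R * R * R)) !=set0.
  by exists (0, 0, 0); split => /=; [split|]; rewrite /= in_itv/=; apply/andP; split; lra.
have nC : {within ((`[0, 1] `*` `[0, 1]) `*` `[-P, P] : set (R * R * R)),
   continuous (fun z : R * R * R => g z.1.1 z.1.2 z.2)}.
  by apply: continuous_subspaceT => z; exact: gC.
have [z _ zmin] := compact_EVT_min ne (@compact_box3 P) nC.
exists (g z.1.1 z.1.2 z.2) => // x t p pP.
rewrite -(per3_frac x t p gP); apply: (zmin (frac x, frac t, p)).
have := frac_itv x; have := frac_itv t; rewrite inE /=.
by move=> /andP[? ?] /andP[? ?]; split => /=; [split|] => /=;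
  rewrite in_itv/= -?ler_norml//; apply/andP; split; lra.
Qed.

(** Periodicity gives bounds that are uniform in (x, t) only while p remains
    bounded, hence the restriction to a strip. *)
Definition strip_lip (g : R -> R -> R -> R) (P C : R) :=
  forall x t p y s q, `|p| <= P -> `|q| <= P ->
  `|g x t p - g y s q| <= C * (`|x - y| + `|t - s| + `|p - q|).

Lemma C1_3_strip_lip g (P : R) : per3 g -> C1_3 g -> exists C, strip_lip g P C.
Proof.
move=> gP [gd _ gx gt gp].
have [Cx hx] := C0_3_bounded P (per3_dx gP) gx.
have [Ct ht] := C0_3_bounded P (per3_dt gP) gt.
have [Cp hp] := C0_3_bounded P (per3_dp gP) gp.
pose C : R := Num.max Cx (Num.max Ct Cp); exists C.
have Cx' : Cx <= C by rewrite le_max lexx.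
have Ct' : Ct <= C by rewrite !le_max lexx orbT.
have Cp' : Cp <= C by rewrite !le_max lexx !orbT.
move=> x t p y s q pP qP.
have [x1 _ e1] := @mvt_between (fun y => g y t p) y x (fun z => let: And3 a _ _ := gd z t p in a).
have [x2 _ e2] := @mvt_between (fun s => g y s p) s t (fun z => let: And3 _ a _ := gd y z p in a).
have [x3 m3 e3] := @mvt_between (g y s) q p (fun z => let: And3 _ _ a := gd y s z in a).
have -> : g x t p - g y s q = (g x t p - g y t p) + (g y t p - g y s p) + (g y s p - g y s q) by ring.
rewrite e1 e2 e3 (mulrDr C) (mulrDr C).
rewrite (le_trans (ler_normD _ _))//; apply: lerD.
  rewrite (le_trans (ler_normD _ _))//; apply: lerD.
  all: rewrite normrM ler_wpM2r//.
- by apply: le_trans Cx'; exact: hx.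
- by apply: le_trans Ct'; exact: ht.
- apply: le_trans Cp'; apply: hp.
  move: m3 pP qP; rewrite !ler_norml ge_min le_max => /andP[/orP h1 /orP h2].
  by move=> /andP[u1 u2] /andP[u3 u4]; apply/andP; split; [case: h1|case: h2]; clear -u1 u2 u3 u4; lra.
Qed.


(** Taylor's formula of order two: the mean value theorem is applied to f minus
    its quadratic minorant, and once more to the derivative. *)
Lemma derive1_le_convex (f : R -> R) (a x y : R) :
  (forall x, derivable f x 1) -> (forall x, derivable (derive1 f) x 1) ->
  (forall z, Num.min x y <= z <= Num.max x y -> a <= derive1 (derive1 f) z) ->
  derive1 f x * (y - x) + a / 2 * (y - x) ^+ 2 <= f y - f x.
Proof.
move=> df ddf fa.
pose g z := f z - (derive1 f x * (z - x) + a / 2 * (z - x) ^+ 2).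
have g' z : is_derive z (1 : R) g (derive1 f z - (derive1 f x + a * (z - x))).
  have := df z; rewrite /g => dfz.
  have isd : is_derive z (1 : R) f (derive1 f z).
    by rewrite derive1E; exact: derivableP.
  by apply: is_derive_eq; rewrite /GRing.scale /=; field.
have dg z : derivable g z 1 by have := g' z => -[].
have g1 z : derive1 g z = derive1 f z - (derive1 f x + a * (z - x)).
  by rewrite derive1E; have := g' z => -[].
have [xi mxi e] := @mvt_between g x y dg.
have [z mz e'] := @mvt_between (derive1 f) x xi ddf.
suff : 0 <= g y - g x by rewrite /g subrr; lra.
rewrite e g1 opprD addrA e'.
have az : a <= derive1 (derive1 f) z.
  apply: fa; move: mxi mz => /andP[h1 h2] /andP[h3 h4].
  rewrite (le_trans _ h3) ?(le_trans h4)//.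
    by rewrite ge_max le_max lexx.
  by rewrite le_min ge_min lexx.
rewrite -mulrBl mulrAC -mulrA.
apply: mulr_ge0; first lra.
move: mxi; rewrite ge_min le_max => /andP[/orP h1 /orP h2].
set D := derive1 _ z in az *.
have [xy|yx] := leP x y.
  have h : x <= xi by case: h1 => ?; lra.
  by apply: mulr_ge0; lra.
have h : xi <= x by case: h2 => ?; lra.
by rewrite -mulrNN; apply: mulr_ge0; lra.
Qed.

Section Flux.
Variable H : R -> R -> R -> R.
Hypothesis H_per : per3 H.
Hypothesis H_C2 : C2_3 H.
Hypothesis H_pp : forall x t p, 0 < dp3 (dp3 H) x t p.

Lemma H_dx x t p : derivable (fun y => H y t p) x 1.
Proof. by case: H_C2 => [[h _ _ _ _] _ _ _]; case: (h x t p). Qed.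
Lemma H_dp x t p : derivable (H x t) p 1.
Proof. by case: H_C2 => [[h _ _ _ _] _ _ _]; case: (h x t p). Qed.
Lemma Hp_dp x t p : derivable (dp3 H x t) p 1.
Proof. by case: H_C2 => [_ _ _ [h _ _ _ _]]; case: (h x t p). Qed.

Lemma Hp_incr x t p q : p < q -> dp3 H x t p < dp3 H x t q.
Proof.
move=> pq; rewrite -subr_gt0.
have [xi _ ->] := @mvt_between (dp3 H x t) p q (@Hp_dp x t).
by rewrite mulr_gt0 ?subr_gt0//; exact: H_pp.
Qed.

Lemma Hp_le x t p q : p <= q -> dp3 H x t p <= dp3 H x t q.
Proof. by rewrite le_eqVlt => /orP[/eqP->//|/Hp_incr/ltW]. Qed.

Lemma H_convex x t p q : dp3 H x t p * (q - p) <= H x t q - H x t p.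
Proof.
have := @derive1_le_convex (H x t) 0 p q (@H_dp x t) (@Hp_dp x t).
by rewrite !mul0r addr0; apply => z _; exact/ltW/H_pp.
Qed.

Lemma H_strongly_convex (P : R) : exists2 a : R, 0 < a & forall x t p q,
  `|p| <= P -> `|q| <= P ->
  dp3 H x t p * (q - p) + a / 2 * (q - p) ^+ 2 <= H x t q - H x t p.
Proof.
have [a a0 ha] : exists2 a : R, 0 < a & forall x t p, `|p| <= P -> a <= dp3 (dp3 H) x t p.
  have hC : C0_3 (dp3 (dp3 H)) by case: H_C2 => [_ _ _ []].
  exact: (C0_3_pos_bounded P (per3_dp (per3_dp H_per)) hC H_pp).
exists a => // x t p q pP qP.
apply: (@derive1_le_convex (H x t) a p q (@H_dp x t) (@Hp_dp x t)) => z.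
rewrite ge_min le_max => /andP[/orP h1 /orP h2]; apply: ha.
move: pP qP; rewrite !ler_norml => /andP[? ?] /andP[? ?].
by case: h1; case: h2 => *; apply/andP; split; lra.
Qed.

Lemma H_bounded P : exists C : R, forall x t p, `|p| <= P -> `|H x t p| <= C.
Proof. by case: H_C2 => [[_ hC _ _ _] _ _ _]; exact: C0_3_bounded H_per hC. Qed.

Lemma H_lip P : exists C, strip_lip H P C.
Proof. by case: H_C2 => [h _ _ _]; exact: C1_3_strip_lip H_per h. Qed.

Lemma Hx_lip P : exists C, strip_lip (dx3 H) P C.
Proof. by case: H_C2 => [_ h _ _]; exact: C1_3_strip_lip (per3_dx H_per) h. Qed.

Lemma Hp_lip P : exists C, strip_lip (dp3 H) P C.
Proof. by case: H_C2 => [_ _ _ h]; exact: C1_3_strip_lip (per3_dp H_per) h. Qed.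

Lemma Hx_bounded P : exists C : R, forall x t p, `|p| <= P -> `|dx3 H x t p| <= C.
Proof. by case: H_C2 => [[_ _ hC _ _] _ _ _]; exact: C0_3_bounded (per3_dx H_per) hC. Qed.

Hypothesis H_superlinear : forall x t,
       H x t p / `|p| @[p --> +oo] --> +oo /\
       H x t p / `|p| @[p --> -oo] --> +oo.

(** By convexity H_p p is at least H (p) - H (0), which superlinearity makes
    larger than any multiple of the absolute value of p. *)
Lemma Hp_large (L x t : R) :
  exists p : R, [/\ 0 < p, L < dp3 H x t p & dp3 H x t (- p) < - L].
Proof.
have [/cvgryPge h1 /cvgryPge h2] := H_superlinear x t.
pose A := Num.max L 0 + `|H x t 0| + 1.
have A0 : 0 < A by rewrite /A ltr_wpDl// addr_ge0// le_max lexx orbT.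
have LA : L < A - `|H x t 0| by rewrite /A; have h : L <= Num.max L 0 by [rewrite le_max lexx]; lra.
have [p1 [_ hp1]] := h1 A; have [p2 [_ hp2]] := h2 A.
pose p := Num.max 1 (Num.max (p1 + 1) (1 - p2)).
have p_1 : 1 <= p by rewrite le_max lexx.
have p_p1 : p1 < p.
  by rewrite (lt_le_trans (_ : _ < p1 + 1)) ?ltrDl// !le_max lexx orbT.
have p_p2 : - p < p2.
  by rewrite ltrNl (lt_le_trans (_ : _ < 1 - p2)) ?ltrDr// !le_max lexx !orbT.
have p0 : 0 < p by lra.
exists p; split => //.
  have := hp1 _ p_p1; rewrite gtr0_norm // ler_pdivlMr// => hA.
  have := H_convex x t p 0; have := ler_norm (H x t 0); have := normr_ge0 (H x t 0) => *.
  rewrite -(ltr_pM2r p0); nra.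
have := hp2 _ p_p2; rewrite normrN gtr0_norm // ler_pdivlMr// => hA.
have := H_convex x t (- p) 0; have := ler_norm (H x t 0); have := normr_ge0 (H x t 0) => *.
rewrite -(ltr_pM2r p0); nra.
Qed.

(** The slopes allowed by a CFL condition are bounded uniformly in (x, t). Since
    H_p increases in p, the bound found at one point by [Hp_large] remains valid
    nearby, and the torus is compact. *)
Lemma Hp_coercive (L : R) :
  exists2 P : R, 0 < P & forall x t p, `|dp3 H x t p| <= L -> `|p| <= P.
Proof.
pose K : set (R * R) := `[0, 1] `*` `[0, 1].
have cK : compact K by apply: compact_setX; exact: segment_compact.
have Hpc : C0_3 (dp3 H) by case: H_C2 => [[]].
pose ok (P : R) (z : R * R) := L < dp3 H z.1 z.2 P /\ dp3 H z.1 z.2 (- P) < - L.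
have okle P Q z : P <= Q -> ok P z -> ok Q z.
  move=> PQ [h1 h2]; split.
    by apply: lt_le_trans h1 _; exact: Hp_le.
  by apply: le_lt_trans h2; apply: Hp_le; rewrite lerN2.
have loc (z : R * R) : exists2 P : R, 0 < P & \forall y \near z, ok P y.
  have [P [P0 h1 h2]] := @Hp_large L z.1 z.2; exists P => //.
  have cP (P' : R) : {for z, continuous (fun y : R * R => dp3 H y.1 y.2 P')}.
    apply: (@continuous_comp _ _ _ (fun y : R * R => (y, P')) (fun w : R * R * R => dp3 H w.1.1 w.1.2 w.2)).
      by apply: (cvg_pair (f := id) (g := cst P') (G := nbhs z) (H := nbhs P')); [exact: cvg_id|exact: cvg_cst].
    exact: Hpc.
  near=> y; split.
    by near: y; apply: (cP P [set w | L < w]); exact: lt_nbhsr.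
  by near: y; apply: (cP (- P) [set w | w < - L]); exact: lt_nbhsl.
have [P P0 hP] : exists2 P : R, 0 < P & forall z, K z -> ok P z.
  have cov := (compact_near_coveringP K).1 cK nat \oo (fun n z => ok n.+1%:R z) _.
  case: cov => [z Kz|N _ hN].
    have [P P0 lP] := loc z.
    have [N /ltW PN] : exists N : nat, P < N%:R.
      by exists (Num.truncn P).+1; exact: truncnS_gt.
    near=> y n => /=; apply: (@okle P).
      apply: (le_trans PN); rewrite ler_nat; apply: leqW; near: n.
      exact: nbhs_infty_ge.
    by near: y.
  by exists N.+1%:R => // z Kz; apply: (hN N) => //=.
exists P => // x t p.
rewrite -(per3_frac x t p (per3_dp H_per)) ler_norml => /andP[h1 h2].
have [k1 k2] : ok P (frac x, frac t).
  by apply: hP; split; rewrite /= in_itv/=; have /andP[? /ltW ?] := frac_itv x;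
    have /andP[? /ltW ?] := frac_itv t; apply/andP.
rewrite ler_norml; apply/andP; split; rewrite leNgt; apply/negP => /ltW/(Hp_le (frac x) (frac t)) h /=.
  by have := le_lt_trans h k2 => /=; lra.
by have := lt_le_trans k1 h => /=; lra.
Unshelve. all: by end_near.
Qed.

End Flux.
End Calculus.

(** * Contraction of oscillations *)

Lemma neighbour_parity (m m0 : int) (k n : nat) :
  grid_odd k m0 -> grid_odd (k + n).+1 m -> (2 %| m - m0 - n%:Z - 1)%Z.
Proof. rewrite /grid_odd /grid_even; lia. Qed.

Lemma neighbour_closer (m m0 : int) (n : nat) :
  (2 %| m - m0 - n%:Z - 1)%Z -> `|m - m0| <= n.+1%:Z ->
  `|m - 1 - m0| <= n%:Z \/ `|m + 1 - m0| <= n%:Z.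
Proof.
move=> /dvdzP[q e] h.
have [lt|le] := ltP m0 m; [left|right]; lia.
Qed.

Section Contraction.
Context {R : realType}.

Lemma int_periodic_mul (T : Type) (f : int -> T) (P : int) (k m : int) :
  (forall m, f (m + P) = f m) -> f (m + P * k) = f m.
Proof.
move=> fP.
have Pn (n : nat) j : f (j + P * n%:Z) = f j.
  elim: n j => [|n IH] j; first by rewrite mulr0 addr0.
  by rewrite -addn1 PoszD mulrDr mulr1 addrA fP IH.
case: k => n; first exact: Pn.
rewrite NegzE mulrN -[LHS](Pn n.+1); congr f.
by rewrite subrK.
Qed.

Lemma int_periodic_bounded (f : int -> R) (P : nat) : (0 < P)%N ->
  (forall m, f (m + P%:Z) = f m) -> exists B : R, forall m, `|f m| <= B.
Proof.
move=> P0 fP; exists (\sum_(i < P) `|f i%:Z|) => m.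
have [k [i [iP ->]]] : exists k : int, exists i : nat, (i < P)%N /\ m = i%:Z + P%:Z * k.
  exists (m %/ P%:Z)%Z; exists `|(m %% P%:Z)%Z|%N; lia.
rewrite int_periodic_mul// (bigD1 (Ordinal iP))//= lerDl.
exact: sumr_ge0.
Qed.

(* Z is the difference of two orbits of a scheme: a time step takes averages of
   the two neighbours, each with a weight of at least eta. *)
Variables (N : nat) (eta : R) (Z : nat -> int -> R).
Hypothesis N0 : (0 < N)%N.
Hypothesis eta01 : 0 <= eta <= 1 / 2.
Hypothesis Zper : forall k m, Z k (m + (2 * N)%N%:Z) = Z k m.
Hypothesis Zrec : forall k m, grid_even k m -> exists2 al : R,
  eta <= al <= 1 - eta & Z k.+1 m = al * Z k (m - 1) + (1 - al) * Z k (m + 1).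

(** The sign s gives the bounds from below and from above at once. *)
Lemma Z_max_principle k (lo : R) (s : R) : s = 1 \/ s = -1 ->
  (forall m, grid_odd k m -> lo <= s * Z k m) ->
  forall n m, grid_odd (k + n) m -> lo <= s * Z (k + n)%N m.
Proof.
move=> s1 h0; elim=> [|n IH] m; first by rewrite addn0; exact: h0.
rewrite addnS => om.
have em : grid_even (k + n) m by move: om; rewrite /grid_odd /grid_even; clear; lia.
have [al /andP[a1 a2] ->] := Zrec em.
have h1 : lo <= s * Z (k + n)%N (m - 1) by apply: IH; move: om; rewrite /grid_odd /grid_even; clear; lia.
have h2 : lo <= s * Z (k + n)%N (m + 1) by apply: IH; move: om; rewrite /grid_odd /grid_even; clear; lia.
move/andP: eta01 => [e0 e1].
case: s1 h1 h2 => -> h1 h2; nra.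
Qed.

(** In n steps the value at m0 reaches all nodes within distance n, each step
    keeping a weight of at least eta; all other values are at least lo. *)
Lemma Z_spread k (lo s : R) (m0 : int) : s = 1 \/ s = -1 ->
  (forall m, grid_odd k m -> lo <= s * Z k m) -> grid_odd k m0 ->
  forall n m, `|m - m0| <= n%:Z -> grid_odd (k + n) m ->
    lo + eta ^+ n * (s * Z k m0 - lo) <= s * Z (k + n)%N m.
Proof.
move=> s1 h0 om0; elim=> [|n IH] m mm0 om.
  have -> : m = m0 by lia.
  by rewrite addn0 expr0 mul1r addrC subrK.
have := Z_max_principle s1 h0 (n := n).
move: om IH; rewrite addnS exprS => om IH hn.
have em : grid_even (k + n) m by move: om; rewrite /grid_odd /grid_even; clear; lia.
have [al /andP[a1 a2] ->] := Zrec em.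
have om1 : grid_odd (k + n) (m - 1) by move: om; rewrite /grid_odd /grid_even; clear; lia.
have om2 : grid_odd (k + n) (m + 1) by move: om; rewrite /grid_odd /grid_even; clear; lia.
have h1 := hn _ om1; have h2 := hn _ om2.
move/andP: eta01 => [e0 e1].
have D0 : 0 <= s * Z k m0 - lo by rewrite subr_ge0 h0.
have E0 : 0 <= eta ^+ n * (s * Z k m0 - lo) by rewrite mulr_ge0// exprn_ge0.
rewrite -mulrA; set D := eta ^+ n * _ in IH E0 *.
have -> : s * (al * Z (k + n)%N (m - 1) + (1 - al) * Z (k + n)%N (m + 1)) =
  al * (s * Z (k + n)%N (m - 1)) + (1 - al) * (s * Z (k + n)%N (m + 1)) by ring.
have [c|c] : `|m - 1 - m0| <= n%:Z \/ `|m + 1 - m0| <= n%:Z.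
  exact: (neighbour_closer (neighbour_parity om0 om)).
- have := IH _ c om1; set A := s * _ in h1 *; set B := s * _ in h2 *; nra.
- have := IH _ c om2; set A := s * _ in h1 *; set B := s * Z _ (m + 1) in h2 *; nra.
Qed.

(** For N <= n the value at one node has reached a full period, so it pulls all
    values towards itself and both ends of the range move. *)
Lemma Z_osc_step k n (lo hi : R) : (N <= n)%N ->
  (forall m, grid_odd k m -> lo <= Z k m <= hi) ->
  exists lo' hi' : R, [/\ lo <= lo', hi' <= hi, hi' - lo' = (1 - eta ^+ n) * (hi - lo)
   & forall m, grid_odd (k + n) m -> lo' <= Z (k + n)%N m <= hi'].
Proof.
move=> Nn h.
pose m0 : int := (k%:Z + 1).
have om0 : grid_odd k m0 by rewrite /grid_odd /grid_even /m0; lia.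
exists (lo + eta ^+ n * (Z k m0 - lo)), (hi - eta ^+ n * (hi - Z k m0)).
have en0 : 0 <= eta ^+ n by move/andP: eta01 => [e0 _]; exact: exprn_ge0.
have /andP[l1 l2] := h _ om0.
split; [nra|nra|ring|] => m om.
have [j hj] : exists j : int, `|m + (2 * N)%N%:Z * j - m0| <= N%:Z.
  exists (- ((m - m0 + N%:Z) %/ (2 * N)%N%:Z)%Z); nia.
have om' : grid_odd (k + n) (m + (2 * N)%N%:Z * j).
  by move: om; rewrite /grid_odd /grid_even; nia.
have hj' : `|m + (2 * N)%N%:Z * j - m0| <= n%:Z by lia.
rewrite -(int_periodic_mul j m (Zper (k + n))).
have h1 m' : grid_odd k m' -> lo <= 1 * Z k m' by rewrite mul1r => /h/andP[].
have h2 m' : grid_odd k m' -> - hi <= -1 * Z k m' by rewrite mulN1r lerN2 => /h/andP[].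
have := Z_spread (or_introl erefl) h1 om0 hj' om'.
have := Z_spread (or_intror erefl) h2 om0 hj' om'.
rewrite !mul1r !mulN1r => *; apply/andP; split; lra.
Qed.

Lemma Z_osc_geometric n (lo hi : R) : (N <= n)%N ->
  (forall m, grid_odd 0 m -> lo <= Z 0 m <= hi) ->
  forall j m m', grid_odd (n * j) m -> grid_odd (n * j) m' ->
    `|Z (n * j)%N m - Z (n * j)%N m'| <= (1 - eta ^+ n) ^+ j * (hi - lo).
Proof.
move=> Nn h0 j.
have [lo' [hi' [<- h]]] : exists lo' hi' : R,
    hi' - lo' = (1 - eta ^+ n) ^+ j * (hi - lo) /\
    forall m, grid_odd (n * j) m -> lo' <= Z (n * j)%N m <= hi'.
  elim: j => [|j [lo' [hi' [e h]]]].
    by exists lo, hi; rewrite expr0 mul1r muln0.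
  have [lo2 [hi2 [_ _ e2 h2]]] := Z_osc_step Nn h.
  exists lo2, hi2; split; first by rewrite e2 e exprS mulrA.
  by move=> m; rewrite mulnSr; exact: h2.
move=> m m' /h/andP[h1 h2] /h/andP[h3 h4].
by rewrite ler_norml; apply/andP; split; lra.
Qed.

End Contraction.

Lemma geometric_cvg {R : realType} (X : nat -> R) (q C : R) : 0 <= q < 1 ->
  (forall j, `|X j.+1 - X j| <= C * q ^+ j) -> cvgn X.
Proof.
move=> /andP[q0 q1] h.
have s1 : cvgn (series (fun j => X j.+1 - X j)).
  apply: normed_cvg; apply: (@series_le_cvg _ _ (geometric C q)) => //.
  - by move=> n /=.
  - by move=> n /=; exact: le_trans (h n).
  - by apply: is_cvg_geometric_series; rewrite ger0_norm.
have -> : X = (fun n => X 0%N + series (fun j => X j.+1 - X j) n).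
  by apply/funext => n; rewrite seriesEnat /= telescope_sumr// addrC subrK.
by apply: is_cvgD => //; exact: is_cvg_cst.
Qed.

Lemma geometric_le0 {R : realType} (a q C : R) : 0 <= q < 1 ->
  (forall j, a <= q ^+ j * C) -> a <= 0.
Proof.
move=> /andP[q0 q1] h.
have : (fun j => q ^+ j * C) @ \oo --> (0 * C).
  by apply: cvgMl; apply: cvg_expr; rewrite ger0_norm.
rewrite mul0r => hc; rewrite -(cvg_lim _ hc)//; apply: limr_ge; first by apply/cvg_ex; exists 0.
by near=> j; exact: h.
Unshelve. all: by end_near.
Qed.

(** * The two schemes on the grid *)

Section GridSchemes.
Context {R : realType}.
Variable H : R -> R -> R -> R.
Hypothesis H_per : per3 H.
Hypothesis H_C2 : C2_3 H.
Hypothesis H_pp : forall x t p, 0 < dp3 (dp3 H) x t p.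
Variables (M : mesh) (c : R).
Implicit Types (h : R) (w s : int -> R) (k : nat) (m : int).

Local Notation dx := (space_step M : R).
Local Notation dt := (time_step M : R).
Local Notation N := (mesh_N M).
Local Notation K := (mesh_K M).
Local Notation xg := (@xgrid R M).
Local Notation tg := (@tgrid R M).

Lemma dx0 : 0 < dx. Proof. exact: space_step_gt0. Qed.
Lemma dt0 : 0 < dt. Proof. exact: time_step_gt0. Qed.

Lemma mesh_K_gt0 : (0 < K)%N.
Proof. exact: leq_trans (mesh_N_gt0 M) (mesh_NK M). Qed.

Lemma space_period : (2 * N)%:R * dx = 1.
Proof.
have : N%:R != 0 :> R by rewrite pnatr_eq0 -lt0n mesh_N_gt0.
by rewrite /space_step natrM => ?; field.
Qed.

Lemma time_period : (2 * K)%:R * dt = 1.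
Proof.
have : K%:R != 0 :> R by rewrite pnatr_eq0 -lt0n mesh_K_gt0.
by rewrite /time_step natrM => ?; field.
Qed.

Lemma xgrid_period m : xg (m + (2 * N)%N%:Z) = xg m + 1.
Proof. by rewrite /xgrid intrD mulrDl -pmulrn space_period. Qed.

Lemma tgrid_period k : tg (k + 2 * K) = tg k + 1.
Proof. by rewrite /tgrid natrD mulrDl time_period. Qed.

Definition slope w m := (w (m + 1) - w (m - 1)) / (2 * dx).

(** The two schemes started from arbitrary grid data, rather than from samples
    or cell averages of a function on the torus. *)
Fixpoint GHJ h w k : int -> R :=
  match k with
  | 0 => w
  | k'.+1 => fun m => let v := GHJ h w k' in
      (v (m - 1) + v (m + 1)) / 2
      - dt * (H (xg m) (tg k') (c + slope v m) - h)
  end.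

Fixpoint GLF s k : int -> R :=
  match k with
  | 0 => s
  | k'.+1 => fun m => let u := GLF s k' in
      (u (m - 1) + u (m + 1)) / 2
      - dt / (2 * dx) *
          (H (xg (m + 1)) (tg k') (c + u (m + 1))
           - H (xg (m - 1)) (tg k') (c + u (m - 1)))
  end.

Lemma HJ_grid h v0 k m : HJ H M c h v0 k m = GHJ h (fun m => v0 (xg m)) k m.
Proof. by elim: k m => [//|k IH] m /=; rewrite /slope !IH. Qed.

Lemma LF_grid u0 k m : LF H M c u0 k m = GLF (LF H M c u0 0) k m.
Proof. by elim: k m => [//|k IH] m /=; rewrite !IH. Qed.

(** The constant h adds a multiple of the time only, so that orbits and their
    contraction can be studied for h = 0. *)
Lemma GHJ_shift_h h w k m : GHJ h w k m = GHJ 0 w k m + k%:R * dt * h.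
Proof.
elim: k m => [|k IH] m /=; first by rewrite !mul0r addr0.
have -> : slope (GHJ h w k) m = slope (GHJ 0 w k) m.
  by rewrite /slope !IH; congr (_ / _); ring.
by rewrite !IH subr0 -natr1; field.
Qed.

Lemma GHJ_addc h w a k m : GHJ h (fun m => w m + a) k m = GHJ h w k m + a.
Proof.
elim: k m => [//|k IH] m /=.
have -> : slope (GHJ h (fun m => w m + a) k) m = slope (GHJ h w k) m.
  by rewrite /slope !IH; congr (_ / _); ring.
by rewrite !IH; field.
Qed.

Lemma GHJ_time h w k m : GHJ h w (k + 2 * K) m = GHJ h (GHJ h w (2 * K)) k m.
Proof.
elim: k m => [//|k IH] m; rewrite addSn.
rewrite [LHS]/= [RHS]/= /slope !IH tgrid_period.
by have [_ ->] := H_per (xg m) (tg k) (c + (GHJ h (GHJ h w (2 * K)) k (m + 1) - GHJ h (GHJ h w (2 * K)) k (m - 1)) / (2 * dx)).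
Qed.

Lemma GHJ_per h w k m : (forall m, w (m + (2 * N)%N%:Z) = w m) ->
  GHJ h w k (m + (2 * N)%N%:Z) = GHJ h w k m.
Proof.
move=> wP; elim: k m => [//|k IH] m /=.
have e1 : m + (2 * N)%N%:Z - 1 = m - 1 + (2 * N)%N%:Z by ring.
have e2 : m + (2 * N)%N%:Z + 1 = m + 1 + (2 * N)%N%:Z by ring.
rewrite /slope e1 e2 !IH xgrid_period.
by have [-> _] := H_per (xg m) (tg k) (c + (GHJ h w k (m + 1) - GHJ h w k (m - 1)) / (2 * dx)).
Qed.

Lemma GHJ_eq h w w' : (forall m, grid_odd 0 m -> w m = w' m) ->
  forall k m, grid_odd k m -> GHJ h w k m = GHJ h w' k m.
Proof.
move=> ww; elim=> [//|k IH] m om /=.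
have h1 : grid_odd k (m - 1) by move: om; rewrite /grid_odd /grid_even; clear; lia.
have h2 : grid_odd k (m + 1) by move: om; rewrite /grid_odd /grid_even; clear; lia.
by rewrite /slope !IH.
Qed.

(** The Lax-Friedrichs scheme is the difference quotient of the Hamilton-Jacobi
    scheme. *)
Lemma GHJ_slope h w s : (forall m, grid_even 0 m -> s m = slope w m) ->
  forall k m, grid_even k m -> GLF s k m = slope (GHJ h w k) m.
Proof.
move=> sw; elim=> [//|k IH] m em /=.
have h1 : grid_even k (m - 1) by move: em; rewrite /grid_even; clear; lia.
have h2 : grid_even k (m + 1) by move: em; rewrite /grid_even; clear; lia.
rewrite !IH// [in RHS]/slope /=.
set a := H _ _ _; set b := H _ _ _; rewrite /slope.
have -> : m - 1 + 1 = m by lia.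
have -> : m + 1 - 1 = m by lia.
by have /lt0r_neq0 d0 := dx0; field.
Qed.

Lemma GHJ_cvg h (X : nat -> int -> R) w :
  (forall m, grid_odd 0 m -> X ^~ m @ \oo --> w m) ->
  forall k m, grid_odd k m -> (fun j => GHJ h (X j) k m) @ \oo --> GHJ h w k m.
Proof.
move=> Xw; elim=> [//|k IH] m om /=.
have h1 : grid_odd k (m - 1) by move: om; rewrite /grid_odd /grid_even; clear; lia.
have h2 : grid_odd k (m + 1) by move: om; rewrite /grid_odd /grid_even; clear; lia.
have c1 := IH _ h1; have c2 := IH _ h2.
apply: cvgB; first by apply: cvgMl; exact: cvgD.
apply: cvgMr; apply: cvgB; last exact: cvg_cst.
have cH : {for (c + slope (GHJ h w k) m), continuous (H (xg m) (tg k))}.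
  apply: differentiable_continuous; apply/derivable1_diffP; exact: H_dp.
apply: (cvg_comp _ (H (xg m) (tg k)) _ cH).
by apply: cvgD; [exact: cvg_cst|apply: cvgMl; exact: cvgB].
Qed.

Variables (l1 r : R).
Hypothesis l1_gt0 : 0 < l1.
Hypothesis lam_l1 : (mesh_ratio M : R) < l1.

Definition cfl_at k w m := `|dp3 H (xg m) (tg k) (c + slope w m)| <= l1^-1.

(** A lower bound for the weights in [GHJ_diff_rec]. *)
Definition cfl_weight : R := (1 - mesh_ratio M / l1) / 2.

Lemma mesh_ratio_gt0 : 0 < mesh_ratio M :> R.
Proof. by rewrite divr_gt0// (dx0, dt0). Qed.

Lemma cfl_weight_itv : 0 < cfl_weight <= 1 / 2.
Proof.
have h : mesh_ratio M / l1 < 1 by rewrite ltr_pdivrMr// mul1r.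
have h0 : 0 < mesh_ratio M / l1 by rewrite divr_gt0// mesh_ratio_gt0.
rewrite /cfl_weight; apply/andP; split; lra.
Qed.

(** By the mean value theorem the difference of the two values of H is linear in
    the difference of the orbits. The weights of the neighbours are half of 1
    plus or minus the mesh ratio times H_p, where H_p is evaluated between two
    slopes that satisfy the CFL condition, and H_p is monotone in p. *)
Lemma GHJ_diff_rec h w w' k m :
  cfl_at k (GHJ h w k) m -> cfl_at k (GHJ h w' k) m ->
  exists2 al : R, cfl_weight <= al <= 1 - cfl_weight &
    GHJ h w k.+1 m - GHJ h w' k.+1 m =
      al * (GHJ h w k (m - 1) - GHJ h w' k (m - 1))
      + (1 - al) * (GHJ h w k (m + 1) - GHJ h w' k (m + 1)).
Proof.
rewrite /cfl_at; set v := GHJ h w k; set v' := GHJ h w' k => c1 c2.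
have [xi mxi e] := mvt_between (c + slope v' m) (c + slope v m) (@H_dp _ H H_C2 (xg m) (tg k)).
have hxi : `|dp3 H (xg m) (tg k) xi| <= l1^-1.
  move: c1 c2; rewrite !ler_norml => /andP[a1 a2] /andP[b1 b2].
  move: mxi => /andP[].
  rewrite ge_min le_max => /orP m1 /orP m2; apply/andP; split.
    by case: m1 => /(Hp_le H_C2 H_pp (xg m) (tg k)) ?; [apply: le_trans b1 _|apply: le_trans a1 _].
  by case: m2 => /(Hp_le H_C2 H_pp (xg m) (tg k)) hh; apply: (le_trans hh).
exists (1 / 2 + mesh_ratio M / 2 * dp3 H (xg m) (tg k) xi).
  have hl : `|mesh_ratio M * dp3 H (xg m) (tg k) xi| <= mesh_ratio M / l1.
    by rewrite normrM gtr0_norm ?mesh_ratio_gt0// ler_pM2l ?mesh_ratio_gt0.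
  move: hl; rewrite ler_norml /cfl_weight => /andP[? ?]; apply/andP; split; lra.
rewrite /= -/v -/v'; move: e; rewrite -[derive1 _ _]/(dp3 H (xg m) (tg k) xi).
set D := dp3 H _ _ _; set A := H _ _ _; set B := H _ _ _ => e.
have -> : (v (m - 1) + v (m + 1)) / 2 - dt * (A - h) - ((v' (m - 1) + v' (m + 1)) / 2 - dt * (B - h))
  = (v (m - 1) + v (m + 1)) / 2 - (v' (m - 1) + v' (m + 1)) / 2 - dt * (A - B) by ring.
rewrite e /slope /mesh_ratio.
by have /lt0r_neq0 d0 := dx0; field.
Qed.

Definition w_ok w := (forall m, w (m + (2 * N)%N%:Z) = w m) /\
  (forall m, grid_even 0 m -> `|slope w m| <= r).

Hypothesis r0 : 0 <= r.
Hypothesis CFLw : forall w, w_ok w ->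
  (forall k m, grid_even k m -> cfl_at k (GHJ 0 w k) m) /\
  (forall m, grid_even 0 m -> `|slope (GHJ 0 w (2 * K)) m| <= r).

Definition w_fixed h w := w_ok w /\ forall m, grid_odd 0 m -> GHJ h w (2 * K) m = w m.

Lemma w_ok_step w : w_ok w -> w_ok (GHJ 0 w (2 * K)).
Proof.
move=> wk; have [_ h2] := CFLw wk; split => // m.
by apply: GHJ_per; case: wk.
Qed.

Lemma N_le_2K : (N <= 2 * K)%N.
Proof. by have := mesh_NK M; lia. Qed.

Lemma grid_odd_2K k m j : grid_odd (k + 2 * K * j) m = grid_odd k m.
Proof. by rewrite /grid_odd /grid_even; congr (~~ _); nia. Qed.

Lemma grid_odd_2K0 m j : grid_odd (2 * K * j) m = grid_odd 0 m.
Proof. by rewrite -[(2 * K * j)%N]add0n grid_odd_2K. Qed.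

Lemma orbit_diff_geometric w w' : w_ok w -> w_ok w' -> exists C : R,
  forall j m m', grid_odd 0 m -> grid_odd 0 m' ->
   `|(GHJ 0 w (2 * K * j) m - GHJ 0 w' (2 * K * j) m)
     - (GHJ 0 w (2 * K * j) m' - GHJ 0 w' (2 * K * j) m')|
   <= (1 - cfl_weight ^+ (2 * K)) ^+ j * C.
Proof.
move=> wk wk'.
pose Z k m := GHJ 0 w k m - GHJ 0 w' k m.
have Zper k m : Z k (m + (2 * N)%N%:Z) = Z k m.
  by rewrite /Z !GHJ_per//; [case: wk'|case: wk].
have [B hB] := int_periodic_bounded (f := Z 0) (P := (2 * N)%N)
  (ltac:(by have := mesh_N_gt0 M; lia)) (Zper 0).
exists (B - - B) => j m m' om om'.
have Zrec k m1 : grid_even k m1 -> exists2 al : R,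
  cfl_weight <= al <= 1 - cfl_weight & Z k.+1 m1 = al * Z k (m1 - 1) + (1 - al) * Z k (m1 + 1).
  by move=> em; apply: GHJ_diff_rec; [case: (CFLw wk)|case: (CFLw wk')] => h _; exact: h.
have eta01 : 0 <= cfl_weight <= 1 / 2.
  by have /andP[/ltW ->] := cfl_weight_itv.
apply: (Z_osc_geometric (mesh_N_gt0 M) eta01 Zper Zrec N_le_2K (lo := - B) (hi := B)).
- by move=> m1 _; rewrite -ler_norml.
- by rewrite grid_odd_2K0.
- by rewrite grid_odd_2K0.
Qed.

Lemma rate_itv : 0 <= 1 - cfl_weight ^+ (2 * K) < 1.
Proof.
have /andP[e0 e1] := cfl_weight_itv.
have p0 : 0 < cfl_weight ^+ (2 * K) by rewrite exprn_gt0.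
have p1 : cfl_weight ^+ (2 * K) <= 1 by rewrite exprn_ile1//; lra.
by apply/andP; split; lra.
Qed.

Lemma fixed_orbit h w m j : w_fixed h w -> grid_odd 0 m ->
  GHJ 0 w (2 * K * j) m = w m - j%:R * h.
Proof.
move=> [_ wf]; elim: j m => [|j IH] m om; first by rewrite muln0 mul0r subr0.
rewrite mulnS addnC.
have e k m1 : GHJ 0 w (k + 2 * K) m1 = GHJ 0 (GHJ 0 w (2 * K)) k m1 by exact: GHJ_time.
rewrite e (@GHJ_eq 0 _ (fun m => w m - h)) => [||]; last 2 first.
- move=> m1 om1; have := wf m1 om1; rewrite GHJ_shift_h time_period mul1r => <-.
  by rewrite addrK.
- by rewrite grid_odd_2K0.
by rewrite GHJ_addc IH// -natr1; ring.
Qed.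

(** Starting from two fixed points, the difference of the orbits is w - w' up to
    a constant in space, so its oscillation does not change with time; it also
    decays geometrically. *)
Lemma fixed_unique h h' w w' : w_fixed h w -> w_fixed h' w' ->
  forall m m', grid_odd 0 m -> grid_odd 0 m' -> w m - w' m = w m' - w' m'.
Proof.
move=> wf wf' m m' om om'.
have [C hC] := orbit_diff_geometric wf.1 wf'.1.
apply/eqP; rewrite -subr_eq0 -normr_le0.
apply: (geometric_le0 rate_itv (C := C)) => j.
have := hC j m m' om om'.
rewrite !(fixed_orbit j wf)// !(fixed_orbit j wf')//.
by apply: le_trans; rewrite le_eqVlt; apply/orP; left; apply/eqP; congr (`|_|); ring.
Qed.

Lemma odd1 : grid_odd 0 1. Proof. by []. Qed.

Lemma GHJ_time_iter w j k : GHJ 0 w (k + 2 * K * j) = GHJ 0 (GHJ 0 w (2 * K * j)) k.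
Proof.
elim: j k => [|j IH] k; first by rewrite muln0 addn0.
rewrite mulnSr [in RHS]addnC IH.
have -> : (k + (2 * K * j + 2 * K) = (k + 2 * K) + 2 * K * j)%N by lia.
by rewrite IH; apply/funext => m; rewrite GHJ_time.
Qed.

(** The orbit of 0, sampled once per period and normalized to vanish at one
    node, is a Cauchy sequence: consecutive samples are themselves the data of
    two orbits whose difference contracts. The drift per period converges to the
    constant - h. *)
Lemma fixed_exists : exists h w, w_fixed h w.
Proof.
pose w0 : int -> R := fun=> 0.
pose W j := GHJ 0 w0 (2 * K * j).
have WS j : W j.+1 = GHJ 0 (W j) (2 * K) by rewrite /W mulnSr addnC GHJ_time_iter.
have WS' j : W j.+1 = GHJ 0 (GHJ 0 w0 (2 * K)) (2 * K * j).
  by rewrite /W mulnSr; apply/funext => m; rewrite GHJ_time.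
have w0ok : w_ok w0 by split => // m _; rewrite /slope subrr mul0r normr0.
have Wok j : w_ok (W j).
  by elim: j => [|j IH]; [rewrite /W muln0|rewrite WS; exact: w_ok_step].
have [C hC] := orbit_diff_geometric (w_ok_step w0ok) w0ok.
pose X j m := W j m - W j 1.
pose w m := limn (X ^~ m).
have Xw m : grid_odd 0 m -> X ^~ m @ \oo --> w m.
  move=> om; apply: (geometric_cvg rate_itv (C := C)) => j.
  have := hC j m 1 om odd1; rewrite -WS' -/(W j) /X mulrC.
  by apply: le_trans; rewrite le_eqVlt; apply/orP; left; apply/eqP; congr (`|_|); ring.
have X2K m : grid_odd 0 m ->
    (fun j => GHJ 0 (X j) (2 * K) m) @ \oo --> GHJ 0 w (2 * K) m.
  move=> om; apply: GHJ_cvg => //.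
  by rewrite -[(2 * K)%N]muln1 grid_odd_2K0.
have XE j m : GHJ 0 (X j) (2 * K) m = X j.+1 m + (W j.+1 1 - W j 1).
  by rewrite /X GHJ_addc -WS; ring.
pose d := GHJ 0 w (2 * K) 1.
have cd : (fun j => W j.+1 1 - W j 1) @ \oo --> d.
  rewrite (_ : (fun j => _) = (fun j => GHJ 0 (X j) (2 * K) 1)); first exact: X2K.
  by apply/funext => j; rewrite XE {1}/X subrr add0r.
have wE m : grid_odd 0 m -> GHJ 0 w (2 * K) m = w m + d.
  move=> om; have c1 := X2K m om.
  have c2 : (fun j => X j.+1 m + (W j.+1 1 - W j 1)) @ \oo --> w m + d.
    by apply: cvgD cd; have := Xw m om; rewrite -cvg_shiftS.
  move: c2; rewrite (_ : (fun j => _) = (fun j => GHJ 0 (X j) (2 * K) m)); last first.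
    by apply/funext => j; rewrite XE.
  by move=> c2; exact: (cvg_unique _ c1 c2).
exists (- d), w; split; last first.
  by move=> m om; rewrite GHJ_shift_h time_period mul1r wE// addrK.
split=> [m|m em].
  rewrite /w; have -> // : X ^~ (m + (2 * N)%N%:Z) = X ^~ m.
  by apply/funext => j; rewrite /X; case: (Wok j) => ->.
have o1 : grid_odd 0 (m + 1) by move: em; rewrite /grid_odd /grid_even; clear; lia.
have o2 : grid_odd 0 (m - 1) by move: em; rewrite /grid_odd /grid_even; clear; lia.
have cs : (fun j => `|slope (X j) m|) @ \oo --> `|slope w m|.
  by apply: cvg_norm; apply: cvgMl; apply: cvgB; exact: Xw.
rewrite -(cvg_lim _ cs)//; apply: limr_le; first by apply/cvg_ex; exists (`|slope w m|).
near=> j; have [_ /(_ m em)] := Wok j.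
by rewrite /slope /X opprB addrA subrK.
Unshelve. all: by end_near.
Qed.

(** The partial sums of s are periodic because s has sum 0 over a period. *)
Lemma grid_antiderivative (s : int -> R) :
  (forall m, s (m + (2 * N)%N%:Z) = s m) ->
  \sum_(i < N) s ((2 * i)%N%:Z) = 0 ->
  exists w, (forall m, w (m + (2 * N)%N%:Z) = w m) /\
    forall m, grid_even 0 m -> s m = slope w m.
Proof.
move=> sP s0.
pose idx (m : int) : nat := `|(((m + 1)%R %/ 2)%Z %% N%:Z)%Z|%N.
pose w m : R := 2 * dx * \sum_(i < idx m) s ((2 * i)%N%:Z).
exists w; split=> [m|m em].
  rewrite /w; congr (_ * _); rewrite (_ : idx _ = idx m)//.
  rewrite /idx.
  have -> : ((m + (2 * N)%N%:Z + 1)%R %/ 2)%Z = ((m + 1)%R %/ 2)%Z + N%:Z by lia.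
  by rewrite modzDr.
have /lt0r_neq0 d0 := dx0.
have [q mq] : exists q : int, m = 2 * q.
  by exists (m %/ 2)%Z; move: em; rewrite /grid_even; clear; lia.
have e1 : idx (m - 1) = `|(q %% N%:Z)%Z|%N by rewrite /idx mq; congr (`|(_ %% _)%Z|%N); lia.
have e2 : idx (m + 1) = `|((q + 1)%R %% N%:Z)%Z|%N by rewrite /idx mq; congr (`|(_ %% _)%Z|%N); lia.
have Npos := mesh_N_gt0 M.
set a := idx (m - 1) in e1 *.
have aN : (a < N)%N by rewrite e1; lia.
have sa : s m = s ((2 * a)%N%:Z).
  have -> : m = (2 * a)%N%:Z + (2 * N)%N%:Z * (q %/ N%:Z)%Z.
    by rewrite mq e1; have := divz_eq q N%:Z; have := modz_ge0 q (d := N%:Z); lia.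
  exact: int_periodic_mul.
have [aN'|aN'] : (a.+1 < N)%N \/ (a.+1 = N)%N by lia.
  have e3 : idx (m + 1) = a.+1.
    rewrite e2 -addn1; have -> : ((q + 1)%R %% N%:Z)%Z = a%:Z + 1.
      have -> : q + 1 = (a%:Z + 1) + (q %/ N%:Z)%Z * N%:Z.
        by rewrite e1; have := divz_eq q N%:Z; have := modz_ge0 q (d := N%:Z); lia.
      by rewrite addrC modzMDl modz_small//; lia.
    lia.
  rewrite /slope /w e3 -/a big_ord_recr /= sa; field.
  done.
have e3 : idx (m + 1) = 0%N.
  rewrite e2; have -> : q + 1 = ((q %/ N%:Z)%Z + 1) * N%:Z.
    by have := divz_eq q N%:Z; have := modz_ge0 q (d := N%:Z); lia.
  by rewrite modzMl.
move: s0; rewrite -aN' big_ord_recr /= => /eqP; rewrite addr_eq0 => /eqP sE.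
by rewrite /slope /w e3 -/a big_ord0 sE sa; field.
Qed.

Lemma slope_constant w : (forall m, grid_even 0 m -> slope w m = 0) ->
  forall m, grid_odd 0 m -> w m = w 1.
Proof.
move=> h; have /lt0r_neq0 d0 := dx0.
have step m : grid_odd 0 m -> w (m + 2) = w m.
  move=> om; have em : grid_even 0 (m + 1) by move: om; rewrite /grid_odd /grid_even; clear; lia.
  have /eqP := h _ em; rewrite /slope mulf_eq0 invr_eq0 mulf_eq0 (negbTE d0) pnatr_eq0 /= orbF.
  by rewrite subr_eq0 -addrA addrK => /eqP.
have P1 (n : nat) m : grid_odd 0 m -> w (m + (2 * n)%N%:Z) = w m.
  elim: n m => [|n IH] m om; first by rewrite addr0.
  rewrite (_ : m + (2 * n.+1)%N%:Z = (m + 2) + (2 * n)%N%:Z); last by lia.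
  by rewrite IH ?step//; move: om; rewrite /grid_odd /grid_even; lia.
move=> m om; have [h1|h1] := leP 1 m.
  rewrite -(P1 `|((m - 1)%R %/ 2)%Z|%N 1)//; congr w.
  by move: om; rewrite /grid_odd /grid_even; lia.
rewrite -(P1 `|((1 - m)%R %/ 2)%Z|%N m)//; congr w.
by move: om; rewrite /grid_odd /grid_even; lia.
Qed.

(** A fixed zero-mean state s is the slope of some grid function v. One period
    changes v by a function of slope 0, that is, by a constant; so v is a fixed
    point of the Hamilton-Jacobi scheme for some h, and the uniqueness of these
    applies. *)
Lemma LF_fixed_slope h w s : w_fixed h w ->
  (forall m, s (m + (2 * N)%N%:Z) = s m) ->
  (forall m, grid_even 0 m -> `|s m| <= r) ->
  \sum_(i < N) s ((2 * i)%N%:Z) = 0 ->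
  (forall m, grid_even 0 m -> GLF s (2 * K) m = s m) ->
  forall m, grid_even 0 m -> s m = slope w m.
Proof.
move=> wf sP sr s0 sfix m em.
have [v [vP sv]] := grid_antiderivative sP s0.
have vok : w_ok v by split => // m1 em1; rewrite -sv// sr.
pose g m := GHJ 0 v (2 * K) m - v m.
have g0 m1 : grid_odd 0 m1 -> g m1 = g 1.
  apply: slope_constant => m2 em2.
  have em2' : grid_even (2 * K) m2 by move: em2; rewrite /grid_even; clear; lia.
  have := sfix _ em2; rewrite (GHJ_slope 0 sv)// sv// /g /slope => e.
  by rewrite (_ : forall a b a' b' : R, (a - a') - (b - b') = (a - b) - (a' - b'))//;
     [rewrite mulrBl e subrr|move=> *; ring].
have vf : w_fixed (- g 1) v.
  split => // m1 om1; rewrite GHJ_shift_h time_period mul1r -(g0 _ om1) /g.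
  by rewrite opprB addrCA subrr addr0.
rewrite sv//.
have o1 : grid_odd 0 (m + 1) by move: em; rewrite /grid_odd /grid_even; clear; lia.
have o2 : grid_odd 0 (m - 1) by move: em; rewrite /grid_odd /grid_even; clear; lia.
rewrite /slope; congr (_ / _).
by have := fixed_unique vf wf o1 o2 => e; lra.
Qed.

End GridSchemes.

(** * A priori estimates for periodic schemes *)

(** Extends [grid_even] to negative times, where a periodic solution lives, too. *)
Definition evn (k m : int) : bool := (2 %| m + k)%Z.

Lemma evnDm k m : evn k (m + 1) = ~~ evn k m. Proof. rewrite /evn; lia. Qed.
Lemma evnBm k m : evn k (m - 1) = ~~ evn k m. Proof. rewrite /evn; lia. Qed.
Lemma evnDk k m : evn (k + 1) m = ~~ evn k m. Proof. rewrite /evn; lia. Qed.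
Lemma evnBk k m : evn (k - 1) m = ~~ evn k m. Proof. rewrite /evn; lia. Qed.
Lemma evnD2 k m : evn k (m + 2) = evn k m. Proof. rewrite /evn; lia. Qed.
Lemma evnB2 k m : evn k (m - 2) = evn k m. Proof. rewrite /evn; lia. Qed.
Definition evnE := (evnDm, evnBm, evnDk, evnBk, evnD2, evnB2, negbK).

Lemma intD11 (m : int) : m + 1 + 1 = m + 2. Proof. by rewrite -addrA. Qed.
Lemma intB11 (m : int) : m - 1 - 1 = m - 2. Proof. by rewrite -addrA. Qed.
Lemma intDB1 (m : int) : m + 1 - 1 = m. Proof. by rewrite addrK. Qed.
Lemma intBD1 (m : int) : m - 1 + 1 = m. Proof. by rewrite subrK. Qed.
Definition intE1 := (intD11, intB11, intDB1, intBD1).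

(** For d < 0 the right-hand side is 2 er - (d / 2 - X), so s = -1 is immediate,
    and s >= 0 is the case of the bound er; d > 0 is symmetric. *)
Lemma sign_excess {R : realType} (s d X er : R) : [\/ s = 0, s = 1 | s = -1] -> 0 <= er ->
  (0 <= s -> d < 0 -> d / 2 - X <= er) -> (s <= 0 -> 0 < d -> - (d / 2 - X) <= er) ->
  (d = 0 -> X = 0) -> s * (d / 2 - X) <= `|d| / 2 - Num.sg d * X + 2 * er.
Proof.
move=> s3 er0 neg pos zero.
have [d0|d0|d0] := ltgtP d 0.
- rewrite (ltr0_sg d0) (ltr0_norm d0); case: s3 => es; move: neg; rewrite es => neg.
  + by have := neg (lexx _) d0; lra.
  + by have := neg ler01 d0; lra.
  + lra.
- rewrite (gtr0_sg d0) (gtr0_norm d0); case: s3 => es; move: pos; rewrite es => pos.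
  + by have := pos (lexx _) d0; lra.
  + lra.
  + by have := pos (lerN10 _) d0; lra.
by rewrite (zero d0) d0 normr0 !mulr0 !mul0r subr0 mulr0; lra.
Qed.

(** One of the weights 1/2 + rH and 1/2 - rH is at least 1/2, and d |-> th d - a
    t d ^ 2 / 4 increases up to E for th >= 1/2. So the value at the neighbour
    with the larger weight can be replaced by E in the quadratic term too. *)
Lemma convex_step {R : realType} (a t E K rH Dp Dm S : R) : 0 < a -> 0 < t -> a * t * E <= 1 ->
  `|rH| <= 1 / 2 -> Dp <= E -> Dm <= E ->
  rH * (Dp - Dm) + t * (a / 4 * (Dp ^+ 2 + Dm ^+ 2) - K) <= S ->
  (Dp + Dm) / 2 - S <= E - a * t / 4 * E ^+ 2 + t * K.
Proof.
move=> a0 t0 aE rc D1 D2 hS.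
have P2 (d : R) : 0 <= t * (a / 4 * d ^+ 2).
  by apply: mulr_ge0; [exact: ltW|apply: mulr_ge0; [by rewrite divr_ge0// ltW|exact: sqr_ge0]].
have key (th d : R) : 1 / 2 <= th -> d <= E ->
   th * d - t * (a / 4 * d ^+ 2) <= th * E - t * (a / 4 * E ^+ 2).
  move=> th2 dE'.
  rewrite -subr_ge0 (_ : _ - _ = (E - d) * (th - a * t / 4 * (E + d))); last by ring.
  apply: mulr_ge0; first by rewrite subr_ge0.
  have : a * t * d <= a * t * E by rewrite ler_pM2l ?mulr_gt0.
  by clear -aE th2; lra.
move: rc; rewrite ler_norml => /andP[rc1 rc2].
have [rp|rn] := leP 0 rH.
  have k1 := key (1/2 + rH) Dm ltac:(clear -rp; lra) D2.
  have k2 : (1/2 - rH) * Dp <= (1/2 - rH) * E by rewrite ler_wpM2l// subr_ge0.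
  by have := P2 Dp; clear -k1 k2 hS; lra.
have k1 := key (1/2 - rH) Dp ltac:(clear -rn; lra) D1.
have k2 : (1/2 + rH) * Dm <= (1/2 + rH) * E by rewrite ler_wpM2l//; clear -rc1; lra.
by have := P2 Dm; clear -k1 k2 hS; lra.
Qed.

Section PeriodicScheme.
Context {R : realType}.
Variable H : R -> R -> R -> R.
Hypothesis H_per : per3 H.
Hypothesis H_C2 : C2_3 H.
Hypothesis H_pp : forall x t p, 0 < dp3 (dp3 H) x t p.
Variables (c l0 l1 : R).
Hypothesis l0_gt0 : 0 < l0.
Hypothesis l1_gt0 : 0 < l1.

Local Notation dx M := (space_step M : R).
Local Notation dt M := (time_step M : R).

Definition tz (M : mesh) (k : int) : R := k%:~R * dt M.

(** A periodic solution of the Hamilton-Jacobi scheme on all integer times: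
    every node then has a past, and suprema over all nodes and times are suprema
    over a period. *)
Record pscheme (M : mesh) (h : R) (V : int -> int -> R) : Prop := PScheme {
  ps_ratio : l0 <= mesh_ratio M < l1;
  ps_xper : forall k m, V k (m + (2 * mesh_N M)%N%:Z) = V k m;
  ps_tper : forall k m, ~~ evn k m -> V (k + (2 * mesh_K M)%N%:Z) m = V k m;
  ps_rec : forall k m, evn k m ->
    V (k + 1) m = (V k (m - 1) + V k (m + 1)) / 2
      - dt M * (H (xgrid M m) (tz M k) (c + slope M (V k) m) - h);
  ps_cfl : forall k m, evn k m ->
    `|dp3 H (xgrid M m) (tz M k) (c + slope M (V k) m)| <= l1^-1 }.

Lemma tz_period M (k : int) : tz M (k + (2 * mesh_K M)%N%:Z) = tz M k + 1.
Proof. by rewrite /tz intrD mulrDl -pmulrn time_period. Qed.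

Lemma tz_mod M (k j : int) (g : R -> R -> R -> R) x p : per3 g ->
  g x (tz M (k + (2 * mesh_K M)%N%:Z * j)) p = g x (tz M k) p.
Proof.
move=> gP; apply: (int_periodic_mul (f := fun k => g x (tz M k) p)) => i.
by rewrite tz_period; case: (gP x (tz M i) p).
Qed.

(** The periodic extension satisfies the recursion across the end of a period
    because the data are fixed and H is periodic in time. *)
Lemma pscheme_of_fixed M h w :
  l0 <= mesh_ratio M < l1 ->
  (forall m, w (m + (2 * mesh_N M)%N%:Z) = w m) ->
  (forall m, grid_odd 0 m -> GHJ H M c h w (2 * mesh_K M) m = w m) ->
  (forall (k : nat) m, grid_even k m -> cfl_at H M c l1 k (GHJ H M c h w k) m) ->
  pscheme M h (fun k => GHJ H M c h w `|(k %% (2 * mesh_K M)%N%:Z)%Z|%N).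
Proof.
move=> lam wP wf cfl.
set T := (2 * mesh_K M)%N.
have T0 : (0 < T)%N by rewrite /T; have := mesh_K_gt0 M; lia.
have kE k : exists (i : nat) (j : int), [/\ (i < T)%N, k = i%:Z + T%:Z * j & `|(k %% T%:Z)%Z|%N = i].
  exists `|(k %% T%:Z)%Z|%N, (k %/ T%:Z)%Z.
  by have := divz_eq k T%:Z; have := modz_ge0 k (d := T%:Z); split; lia.
split => //.
- by move=> k m; apply: GHJ_per.
- by move=> k m _; rewrite modzDr.
- move=> k m em; have [i [j [iT ki ->]]] := kE k.
  have ei : grid_even i m by move: em; rewrite /evn /grid_even ki /T; lia.
  have -> : H (xgrid M m) (tz M k) = H (xgrid M m) (tgrid M i).
    by apply/funext => p; rewrite ki tz_mod.
  have [lt|eqT] : (i.+1 < T)%N \/ i.+1 = T by lia.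
    have -> : `|((k + 1) %% T%:Z)%Z|%N = i.+1.
      have -> : k + 1 = j * T%:Z + (i.+1)%:Z by lia.
      by rewrite modzMDl modz_small; lia.
    by [].
  have -> : `|((k + 1) %% T%:Z)%Z|%N = 0%N.
    have -> : k + 1 = (j + 1) * T%:Z by lia.
    by rewrite modzMl.
  rewrite -[LHS]/(w m) -wf -/T -?eqT//.
  by move: ei; rewrite /grid_odd /grid_even; lia.
- move=> k m em; have [i [j [iT ki ->]]] := kE k.
  have ei : grid_even i m by move: em; rewrite /evn /grid_even ki /T; lia.
  rewrite [k in tz M k]ki tz_mod; first exact: cfl.
  exact: per3_dp.
Qed.

Section Estimates.
Variables (M : mesh) (h : R) (V : int -> int -> R).
Hypothesis psV : pscheme M h V.
Let dx_gt0 : 0 < dx M. Proof. exact: space_step_gt0. Qed.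
Let dt_gt0 : 0 < dt M. Proof. exact: time_step_gt0. Qed.
Let U k m := slope M (V k) m.

Lemma slope_rec k m : evn (k + 1) m ->
  U (k + 1) m = (U k (m - 1) + U k (m + 1)) / 2
      - dt M / (2 * dx M) *
          (H (xgrid M (m + 1)) (tz M k) (c + U k (m + 1))
           - H (xgrid M (m - 1)) (tz M k) (c + U k (m - 1))).
Proof.
move=> em.
have e1 : evn k (m + 1) by move: em; rewrite ?evnE.
have e2 : evn k (m - 1) by move: em; rewrite ?evnE.
rewrite {1}/U /slope (ps_rec psV e1) (ps_rec psV e2) -/(U k (m + 1)) -/(U k (m - 1)).
set a := H _ _ _; set b := H _ _ _; rewrite /U /slope.
rewrite !intE1.
by have /lt0r_neq0 d0 := dx_gt0; field.
Qed.

Lemma xgridD2 m : xgrid M (m + 2) = xgrid M m + 2 * dx M.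
Proof. by rewrite /xgrid intrD mulrDl. Qed.
Lemma xgridB2 m : xgrid M (m - 2) = xgrid M m - 2 * dx M.
Proof. by rewrite /xgrid intrB mulrBl. Qed.

Variables (P : R).
Hypothesis P_gt0 : 0 < P.
Hypothesis Pcoer : forall x t p, `|dp3 H x t p| <= l1^-1 -> `|p| <= P.

Lemma slope_strip k m : evn k m -> `|c + U k m| <= P.
Proof. by move=> em; apply: Pcoer; exact: (ps_cfl psV em). Qed.

Lemma slope_bound k m : evn k m -> `|U k m| <= P + `|c|.
Proof.
move=> /slope_strip h1; rewrite -[U k m](addKr c) (le_trans (ler_normD _ _))//.
by rewrite normrN addrC lerD2r.
Qed.

Lemma dt_dx : dt M <= l1 * dx M.
Proof.
have /andP[_ /ltW] := ps_ratio psV.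
by rewrite /mesh_ratio ler_pdivrMr ?dx_gt0.
Qed.

Lemma dx_dt : l0 * dx M <= dt M.
Proof.
have /andP[+ _] := ps_ratio psV.
by rewrite /mesh_ratio ler_pdivlMr ?dx_gt0.
Qed.

Lemma ratio_cfl y : `|y| <= l1^-1 -> `|dt M / (2 * dx M) * y| <= 1 / 2.
Proof.
move=> hy; rewrite normrM.
have h1 : dt M / (2 * dx M) <= l1 / 2.
  by rewrite ler_pdivrMr ?mulr_gt0 ?dx_gt0//; have := dt_dx; lra.
have h2 : 0 < dt M / (2 * dx M) by rewrite divr_gt0 ?mulr_gt0 ?dx_gt0 ?dt_gt0.
have <- : l1 / 2 * l1^-1 = 1 / 2 by field; rewrite lt0r_neq0.
by rewrite gtr0_norm// ler_pM// ltW.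
Qed.

Variables (a Cx : R).
Hypothesis a_gt0 : 0 < a.
Hypothesis Cx_ge0 : 0 <= Cx.
Hypothesis a_conv : forall x t p q, `|p| <= P -> `|q| <= P ->
  dp3 H x t p * (q - p) + a / 2 * (q - p) ^+ 2 <= H x t q - H x t p.
Hypothesis Hx_strip : strip_lip (dx3 H) P Cx.

(** Strong convexity in p gives the quadratic gain. The variation of H in x is
    handled by the mean value theorem, and costs terms of first order in the
    increments of p. *)
Lemma second_difference x t p dp dm g : 0 < g ->
  `|p| <= P -> `|p + dp| <= P -> `|p - dm| <= P ->
  dp3 H x t p * (dp - dm) + a / 2 * (dp ^+ 2 + dm ^+ 2)
    - Cx * g * (2 * g + `|dp| + `|dm|)
  <= H (x + g) t (p + dp) - 2 * H x t p + H (x - g) t (p - dm).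
Proof.
move=> g0 h0 h1 h2.
have [x1 m1 e1] := @mvt_between _ (fun y => H y t (p + dp)) x (x + g) (fun y => @H_dx _ H H_C2 y t (p + dp)).
have [x2 m2 e2] := @mvt_between _ (fun y => H y t (p - dm)) x (x - g) (fun y => @H_dx _ H H_C2 y t (p - dm)).
move: e1; rewrite -[derive1 _ _]/(dx3 H x1 t (p + dp)) => e1.
move: e2; rewrite -[derive1 _ _]/(dx3 H x2 t (p - dm)) => e2.
have c1 := a_conv x t h0 h1; have c2 := a_conv x t h0 h2.
have := Hx_strip x1 t x2 t h1 h2.
have -> : p + dp - (p - dm) = dp + dm by ring.
rewrite subrr normr0 addr0.
have l2 : `|x1 - x2| <= 2 * g.
  have g1 : x <= x + g by lra.
  have g2 : x - g <= x by lra.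
  move: m1 m2; rewrite (min_l g1) (max_r g1) (min_r g2) (max_l g2).
  by move=> /andP[? ?] /andP[? ?]; rewrite ler_norml; apply/andP; split; lra.
have l3 := ler_normD dp dm.
set A := dx3 H x1 _ _ in e1 *; set B := dx3 H x2 _ _ in e2 * => hAB.
have hAB2 : - (Cx * (2 * g + `|dp| + `|dm|)) <= A - B.
  rewrite lerNl opprB; apply: le_trans (ler_norm _) _; rewrite distrC.
  apply: (le_trans hAB); rewrite ler_wpM2l//; lra.
have e1' : H (x + g) t (p + dp) = H x t (p + dp) + A * g by lra.
have e2' : H (x - g) t (p - dm) = H x t (p - dm) - B * g by lra.
rewrite e1' e2'.
have d1 : p + dp - p = dp by ring.
have d2 : p - dm - p = - dm by ring.
rewrite d1 in c1; rewrite d2 in c2; move: c1 c2.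
have := ler_wpM2r (ltW g0) hAB2; rewrite sqrrN => *; lra.
Qed.

Hypothesis a_small : a * ((P + `|c|) * l1) <= 1.

Let D k m := (U k (m + 1) - U k (m - 1)) / (2 * dx M).

(** A discrete Riccati inequality for the second difference quotients D of V:
    the recursion for the slopes is differenced once more, and the strong
    convexity of H produces the square. *)
Lemma D_step (E : R) k m : E <= (a * dt M)^-1 ->
  (forall k m, ~~ evn k m -> D k m <= E) -> evn k m ->
  D (k + 1) m <= E - a * dt M / 4 * E ^+ 2 + dt M * (2 * Cx + 2 * Cx ^+ 2 / a).
Proof.
move=> Ea DE em.
have g0 : 0 < 2 * dx M by rewrite mulr_gt0 ?dx_gt0.
have d0 := dt_gt0.
have o1 : ~~ evn k (m + 1) by move: em; rewrite ?evnE.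
have o2 : ~~ evn k (m - 1) by move: em; rewrite ?evnE.
have e1 : evn (k + 1) (m + 1) by move: em; rewrite ?evnE.
have e2 : evn (k + 1) (m - 1) by move: em; rewrite ?evnE.
have e3 : evn k (m + 2) by move: em; rewrite ?evnE.
have e4 : evn k (m - 2) by move: em; rewrite ?evnE.
have D1 := DE _ _ o1; have D2 := DE _ _ o2.
set Dp := D k (m + 1) in D1; set Dm := D k (m - 1) in D2.
have eDp : U k (m + 2) = U k m + 2 * dx M * Dp.
  rewrite /Dp /D mulrC divfK ?lt0r_neq0// addrK -addrA.
  by rewrite (_ : 1 + 1 = 2 :> int)//; ring.
have eDm : U k (m - 2) = U k m - 2 * dx M * Dm.
  rewrite /Dm /D [2 * _ * _]mulrC divfK ?lt0r_neq0// subrK -addrA.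
  by rewrite (_ : -1 - 1 = - 2 :> int)//; ring.
set g := 2 * dx M in g0 eDp eDm *.
have s1 := slope_strip em.
have s2 : `|c + U k m + g * Dp| <= P by rewrite -addrA -eDp; exact: slope_strip.
have s3 : `|c + U k m - g * Dm| <= P by rewrite -addrA -eDm; exact: slope_strip.
have := @second_difference (xgrid M m) (tz M k) _ _ _ _ g0 s1 s2 s3.
have := ratio_cfl (ps_cfl psV em); rewrite -/(U k m) -/g.
rewrite -!addrA -eDp -eDm {1}/D (slope_rec e1) (slope_rec e2) -/g.
rewrite !intE1.
rewrite xgridD2 xgridB2 -/g eDp eDm.
set Hp := dp3 _ _ _ _; set H2 := H _ _ _; set H0 := H _ _ _; set H1 := H _ _ _.
rewrite (normrM g Dp) (normrM g Dm) (gtr0_norm g0); set rho := dt M / g => rc sd.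
have rho0 : 0 < rho by rewrite divr_gt0.
have dE : dt M = rho * g by rewrite /rho divfK ?lt0r_neq0.
(* a Riccati inequality per unit of time: divide by the grid size *)
have step1 : ((U k m + (U k m + g * Dp)) / 2 - rho * (H2 - H0)
   - ((U k m - g * Dm + U k m) / 2 - rho * (H0 - H1))) / g =
   (Dp + Dm) / 2 - rho / g * (H2 - 2 * H0 + H1).
  by field; rewrite lt0r_neq0.
rewrite step1.
have sd' : rho / g * (Hp * (g * Dp - g * Dm) + a / 2 * ((g * Dp) ^+ 2 + (g * Dm) ^+ 2) - Cx * g * (2 * g + g * `|Dp| + g * `|Dm|)) <= rho / g * (H2 - 2 * H0 + H1).
  apply: ler_wpM2l; [by rewrite divr_ge0// ltW|lra].
have step2 : rho / g * (Hp * (g * Dp - g * Dm) + a / 2 * ((g * Dp) ^+ 2 + (g * Dm) ^+ 2) - Cx * g * (2 * g + g * `|Dp| + g * `|Dm|)) =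
   rho * Hp * (Dp - Dm) + dt M * (a / 2 * (Dp ^+ 2 + Dm ^+ 2) - Cx * (2 + `|Dp| + `|Dm|)).
  by rewrite dE; field; rewrite lt0r_neq0.
rewrite step2 in sd'.
have y d : Cx * `|d| <= a / 4 * d ^+ 2 + Cx ^+ 2 / a.
  have := sqr_ge0 (a / 2 * `|d| - Cx); rewrite -(real_normK (num_real d)) => h1.
  rewrite -(ler_pM2l a_gt0) mulrDr [a * (_ / a)]mulrC divfK ?lt0r_neq0//; nra.
have q : dt M * (a / 2 * (Dp ^+ 2 + Dm ^+ 2) - Cx * (2 + `|Dp| + `|Dm|)) >=
     dt M * (a / 4 * (Dp ^+ 2 + Dm ^+ 2) - (2 * Cx + 2 * Cx ^+ 2 / a)).
  by rewrite ler_pM2l//; have := y Dp; have := y Dm; lra.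
set rH := rho * Hp in rc sd'.
have aE : a * dt M * E <= 1.
  by move: Ea; rewrite -[(_)^-1]mul1r ler_pdivlMr ?mulr_gt0// mulrC.
rewrite [leRHS]addrA; apply: (convex_step a_gt0 d0 aE rc D1 D2).
by apply: le_trans sd'; rewrite lerD2l.
Qed.

(** The supremum E of the second difference quotients is finite, as slopes are
    bounded, and by [D_step] satisfies E <= E - a dt E ^ 2 / 4 + dt C', in which
    dt cancels. *)
Lemma one_sided k m : ~~ evn k m ->
  U k (m + 1) - U k (m - 1) <= 2 * dx M * (1 + 4 * (2 * Cx + 2 * Cx ^+ 2 / a) / a).
Proof.
set C' := 2 * Cx + _.
have g0 : 0 < 2 * dx M by rewrite mulr_gt0 ?dx_gt0.
have d0 := dt_gt0.
have Dub k' m' : ~~ evn k' m' -> D k' m' <= (a * dt M)^-1.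
  move=> om.
  have e1 : evn k' (m' + 1) by move: om; rewrite ?evnE.
  have e2 : evn k' (m' - 1) by move: om; rewrite ?evnE.
  rewrite /D ler_pdivrMr//.
  apply: le_trans (_ : 2 * (P + `|c|) <= _).
    have := slope_bound e1; have := slope_bound e2.
    by rewrite !ler_norml => /andP[? ?] /andP[? ?]; lra.
  rewrite [_^-1 * _]mulrC ler_pdivlMr ?mulr_gt0//.
  have B0 : 0 <= P + `|c| by rewrite addr_ge0// ltW.
  have : a * (P + `|c|) * dt M <= a * (P + `|c|) * (l1 * dx M).
    by apply: ler_wpM2l dt_dx; rewrite mulr_ge0// ltW.
  have : a * ((P + `|c|) * l1) * dx M <= 1 * dx M by apply: ler_wpM2r => //; exact: ltW.
  lra.
pose S : set R := [set y | exists k m, ~~ evn k m /\ y = D k m].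
have S0 : S !=set0 by exists (D 0 1), 0, 1.
have Sub : has_sup S by split => //; exists (a * dt M)^-1 => y [k' [m' [om ->]]]; exact: Dub.
pose E := sup S.
have DE k' m' : ~~ evn k' m' -> D k' m' <= E.
  by move=> om; apply: sup_upper_bound => //; exists k', m'.
have Ea : E <= (a * dt M)^-1.
  by apply: ge_sup => // y [k' [m' [om ->]]]; exact: Dub.
have : E <= E - a * dt M / 4 * E ^+ 2 + dt M * C'.
  apply: ge_sup => // y [k' [m' [om ->]]].
  rewrite -(subrK 1 k').
  by apply: D_step => //; rewrite evnE.
move=> hE.
have hE2 : a * E ^+ 2 <= 4 * C'.
  rewrite -(ler_pM2l d0); lra.
have C0 : 0 <= C' by apply: addr_ge0; [exact: mulr_ge0|apply: mulr_ge0; [by apply: mulr_ge0 => //; exact: sqr_ge0|by rewrite invr_ge0 ltW]].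
have : E <= 1 + 4 * C' / a.
  have [E1|E1] := leP E 1.
    by rewrite (le_trans E1)// lerDl divr_ge0// ?mulr_ge0// ltW.
  apply: le_trans (_ : 4 * C' / a <= _); last by rewrite lerDr.
  rewrite ler_pdivlMr//; apply: le_trans hE2.
  have : 0 <= a * (E * (E - 1)).
    by apply: mulr_ge0; [exact: ltW|apply: mulr_ge0; lra].
  lra.
move=> E1 /DE/le_trans/(_ E1).
by rewrite /D ler_pdivrMr// mulrC.
Qed.

End Estimates.

Section CellEntropy.
Variables (M : mesh) (h : R) (V : int -> int -> R).
Hypothesis psV : pscheme M h V.
Let U k m := slope M (V k) m.
Variables (P a Cp kap : R).
Hypothesis Pcoer : forall x t p, `|dp3 H x t p| <= l1^-1 -> `|p| <= P.
Hypothesis kapP : `|c + kap| <= P.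
Hypothesis a_gt0 : 0 < a.
Hypothesis Cp_ge0 : 0 <= Cp.
Hypothesis a_conv : forall x t p q, `|p| <= P -> `|q| <= P ->
  dp3 H x t p * (q - p) + a / 2 * (q - p) ^+ 2 <= H x t q - H x t p.
Hypothesis Hp_strip : strip_lip (dp3 H) P Cp.

(** Here d is the distance between a slope of the scheme and the level, and e
    bounds by how much the derivative of H at the level exceeds the CFL range. *)
Lemma quadratic_excess (e d y : R) : 0 <= d -> 0 <= e ->
  y <= e * d - a / 2 * d ^+ 2 -> y <= e ^+ 2 / (2 * a).
Proof.
move=> d0 e0 /le_trans; apply.
rewrite ler_pdivlMr ?mulr_gt0//.
have := sqr_ge0 (e - a * d); nra.
Qed.

(** Where the scheme is monotone between kap and the old slopes, this is the
    inequality of Kruzhkov without error. Monotonicity can fail only if kap lies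
    outside the CFL range. The sign of the new slope relative to kap decides on
    which side this matters, and the CFL bound at the new node, transported to
    the old ones, shows that the derivative of H at kap exceeds the range by at
    most e = O(dx + dt). By strong convexity the excess is of order e ^ 2. *)
Lemma cell_entropy k m : evn (k + 1) m ->
  let lam := dt M / dx M in
  let Hl := H (xgrid M (m - 1)) (tz M k) in
  let Hr := H (xgrid M (m + 1)) (tz M k) in
  let ul := U k (m - 1) in let ur := U k (m + 1) in
  is_true (`|U (k + 1) m - kap| <=
    (`|ul - kap| + `|ur - kap|) / 2
    - lam / 2 * (Num.sg (ur - kap) * (Hr (c + ur) - Hr (c + kap))
                 - Num.sg (ul - kap) * (Hl (c + ul) - Hl (c + kap)))
    - Num.sg (U (k + 1) m - kap) * (lam / 2 * (Hr (c + kap) - Hl (c + kap)))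
    + lam * (Cp * (dx M + dt M)) ^+ 2 / a).
Proof.
move=> em lam Hl Hr ul ur.
have er : evn k (m + 1) by move: em; rewrite !evnE.
have el : evn k (m - 1) by move: em; rewrite !evnE.
have dxp : 0 < dx M := space_step_gt0 M.
have dtp : 0 < dt M := time_step_gt0 M.
have lam0 : 0 < lam by rewrite divr_gt0.
have laml1 : lam < l1 by have /andP[] := ps_ratio psV.
have laml : lam / 2 * l1^-1 <= 1 / 2.
  by rewrite mulrAC ler_pM2r// ler_pdivrMr// mul1r ltW.
pose un := U (k + 1) m.
have cl : `|dp3 H (xgrid M (m - 1)) (tz M k) (c + ul)| <= l1^-1 := ps_cfl psV el.
have cr : `|dp3 H (xgrid M (m + 1)) (tz M k) (c + ur)| <= l1^-1 := ps_cfl psV er.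
have cn : `|dp3 H (xgrid M m) (tz M (k + 1)) (c + un)| <= l1^-1 := ps_cfl psV em.
have pl := Pcoer cl; have pr := Pcoer cr.
have unE : un = (ul + ur) / 2 - lam / 2 * (Hr (c + ur) - Hl (c + ul)).
  rewrite (_ : lam / 2 = dt M / (2 * dx M)); first exact: (slope_rec psV em).
  by rewrite /lam; field; rewrite lt0r_neq0.
rewrite -/un.
pose e : R := Cp * (dx M + dt M).
have e0 : 0 <= e by rewrite mulr_ge0// addr_ge0// ltW.
pose er2 := lam / 2 * (e ^+ 2 / (2 * a)).
have er20 : 0 <= er2.
  by rewrite mulr_ge0// ?divr_ge0// ?sqr_ge0// ?mulr_ge0// ltW.
(* the CFL bound at the new point, transported to the old neighbours *)
have near m' : m' = m + 1 \/ m' = m - 1 ->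
   `|dp3 H (xgrid M m') (tz M k) (c + kap) - dp3 H (xgrid M m) (tz M (k + 1)) (c + kap)| <= e.
  move=> hm'; apply: le_trans (Hp_strip _ _ _ _ kapP kapP) _.
  rewrite subrr normr0 addr0 ler_wpM2l//; apply: lerD.
    rewrite /xgrid -mulrBl -intrB normrM (gtr0_norm dxp); apply: ler_piMl; first exact: ltW.
    by case: hm' => ->; rewrite addrAC subrr add0r ?mulrNz mulr1z ?normrN normr1.
  by rewrite /tz intrD mulrDl mul1r opprD addNKr normrN gtr0_norm.
have hr : 0 <= Num.sg (un - kap) -> ur < kap ->
    (ur - kap) / 2 - lam / 2 * (Hr (c + ur) - Hr (c + kap)) <= er2.
  move=> sg ud.
  have uk : kap <= un by move: sg; rewrite sgr_ge0 subr_ge0.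
  have b1 : dp3 H (xgrid M (m + 1)) (tz M k) (c + kap) <= l1^-1 + e.
    have := near _ (or_introl erefl); rewrite ler_norml => /andP[_ b2].
    have : dp3 H (xgrid M m) (tz M (k + 1)) (c + kap) <= l1^-1.
      apply: le_trans (le_trans (ler_norm _) cn).
      by apply: (Hp_le H_C2 H_pp); rewrite lerD2l.
    lra.
  have := a_conv (xgrid M (m + 1)) (tz M k) kapP pr; rewrite -/Hr.
  rewrite (_ : c + ur - (c + kap) = - (kap - ur)); last by ring.
  set d := kap - ur; have d0 : 0 < d by rewrite subr_gt0.
  set A := dp3 _ _ _ _ in b1 *; rewrite sqrrN => cv.
  rewrite /er2 (_ : ur - kap = - d); last by rewrite /d; ring.
  have lm : lam / 2 * (Hr (c + kap) - Hr (c + ur) - l1^-1 * d) <= lam / 2 * (e ^+ 2 / (2 * a)).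
    apply: ler_wpM2l; first by rewrite divr_ge0// ltW.
    apply: (quadratic_excess (ltW d0) e0).
    have := ler_wpM2r (ltW d0) b1; lra.
  have := ler_wpM2r (ltW d0) laml; lra.
have hr' : Num.sg (un - kap) <= 0 -> kap < ur ->
    0 <= (ur - kap) / 2 - lam / 2 * (Hr (c + ur) - Hr (c + kap)).
  move=> _ ud.
  have := @H_convex _ H H_C2 H_pp (xgrid M (m + 1)) (tz M k) (c + ur) (c + kap); rewrite -/Hr.
  rewrite (_ : c + kap - (c + ur) = - (ur - kap)); last by ring.
  set d := ur - kap; have d0 : 0 < d by rewrite subr_gt0.
  set A := dp3 _ _ _ _ in cr * => cv.
  have b1 : A <= l1^-1 := le_trans (ler_norm _) cr.
  have h1 : Hr (c + ur) - Hr (c + kap) <= l1^-1 * d by have := ler_wpM2r (ltW d0) b1; lra.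
  have h2 : lam / 2 * (Hr (c + ur) - Hr (c + kap)) <= lam / 2 * (l1^-1 * d).
    by apply: ler_wpM2l => //; rewrite divr_ge0// ltW.
  have := ler_wpM2r (ltW d0) laml; lra.
have hl : Num.sg (un - kap) <= 0 -> kap < ul ->
    - ((ul - kap) / 2 + lam / 2 * (Hl (c + ul) - Hl (c + kap))) <= er2.
  move=> sg ud.
  have uk : un <= kap by move: sg; rewrite sgr_le0 subr_le0.
  have b1 : - l1^-1 - e <= dp3 H (xgrid M (m - 1)) (tz M k) (c + kap).
    have := near _ (or_intror erefl); rewrite ler_norml => /andP[b2 _].
    have : - l1^-1 <= dp3 H (xgrid M m) (tz M (k + 1)) (c + kap).
      apply: (@le_trans _ _ (dp3 H (xgrid M m) (tz M (k + 1)) (c + un))).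
        by move: cn; rewrite ler_norml => /andP[].
      by apply: (Hp_le H_C2 H_pp); rewrite lerD2l.
    lra.
  have := a_conv (xgrid M (m - 1)) (tz M k) kapP pl; rewrite -/Hl.
  rewrite (_ : c + ul - (c + kap) = ul - kap); last by ring.
  set d := ul - kap; have d0 : 0 < d by rewrite subr_gt0.
  set A := dp3 _ _ _ _ in b1 * => cv.
  have lm : lam / 2 * (Hl (c + kap) - Hl (c + ul) - l1^-1 * d) <= er2.
    apply: ler_wpM2l; first by rewrite divr_ge0// ltW.
    apply: (quadratic_excess (ltW d0) e0).
    have := ler_wpM2r (ltW d0) b1; lra.
  have := ler_wpM2r (ltW d0) laml; lra.
have hl' : 0 <= Num.sg (un - kap) -> ul < kap ->
    (ul - kap) / 2 + lam / 2 * (Hl (c + ul) - Hl (c + kap)) <= 0.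
  move=> _ ud.
  have := @H_convex _ H H_C2 H_pp (xgrid M (m - 1)) (tz M k) (c + ul) (c + kap); rewrite -/Hl.
  rewrite (_ : c + kap - (c + ul) = kap - ul); last by ring.
  set d := kap - ul; have d0 : 0 < d by rewrite subr_gt0.
  set A := dp3 _ _ _ _ in cl * => cv.
  have b1 : - l1^-1 <= A by move: cl; rewrite ler_norml => /andP[].
  have h1 : - (l1^-1 * d) <= Hl (c + kap) - Hl (c + ul) by have := ler_wpM2r (ltW d0) b1; lra.
  have h2 : lam / 2 * - (l1^-1 * d) <= lam / 2 * (Hl (c + kap) - Hl (c + ul)).
    by apply: ler_wpM2l => //; rewrite divr_ge0// ltW.
  rewrite (_ : ul - kap = - d); last by rewrite /d; ring.
  have := ler_wpM2r (ltW d0) laml; lra.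
have er4 : lam * (Cp * (dx M + dt M)) ^+ 2 / a = 4 * er2.
  by rewrite /er2 -/e; field; rewrite lt0r_neq0.
rewrite er4 [`|un - kap|]normrEsg.
set s := Num.sg (un - kap) in hr hr' hl hl' *.
have s3 : [\/ s = 0, s = 1 | s = -1].
  by rewrite /s; case: sgrP => _; [exact: Or31|exact: Or32|exact: Or33].
have rpart : s * ((ur - kap) / 2 - lam / 2 * (Hr (c + ur) - Hr (c + kap))) <=
   `|ur - kap| / 2 - Num.sg (ur - kap) * (lam / 2 * (Hr (c + ur) - Hr (c + kap))) + 2 * er2.
  apply: (sign_excess s3 er20).
  - by move=> sg; rewrite subr_lt0; exact: hr.
  - by move=> sg; rewrite subr_gt0 => /(hr' sg) hh; apply: le_trans er20; rewrite oppr_le0.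
  - by move/eqP; rewrite subr_eq0 => /eqP ->; rewrite subrr mulr0.
have lpart : s * ((ul - kap) / 2 - - (lam / 2 * (Hl (c + ul) - Hl (c + kap)))) <=
   `|ul - kap| / 2 - Num.sg (ul - kap) * - (lam / 2 * (Hl (c + ul) - Hl (c + kap))) + 2 * er2.
  apply: (sign_excess s3 er20); rewrite ?opprK.
  - by move=> sg; rewrite subr_lt0 => /(hl' sg) hh; apply: le_trans hh er20.
  - by move=> sg; rewrite subr_gt0; exact: hl.
  - by move/eqP; rewrite subr_eq0 => /eqP ->; rewrite subrr mulr0 oppr0.
rewrite opprK mulrN opprK in lpart.
have -> : s * (un - kap) = s * ((ur - kap) / 2 - lam / 2 * (Hr (c + ur) - Hr (c + kap)))
  + s * ((ul - kap) / 2 + lam / 2 * (Hl (c + ul) - Hl (c + kap)))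
  - s * (lam / 2 * (Hr (c + kap) - Hl (c + kap))).
  by rewrite unE; field.
lra.
Qed.

End CellEntropy.

End PeriodicScheme.

(** * Interpolation in space and time *)

Section Interpolation.
Context {R : realType}.
Variable M : mesh.
Implicit Types (k m : int) (v : int -> R) (x y t : R).

Local Notation dx := (space_step M : R).
Local Notation dt := (time_step M : R).
Local Notation xg := (@xgrid R M).
Let dx_gt0 : 0 < dx. Proof. exact: space_step_gt0. Qed.
Let dt_gt0 : 0 < dt. Proof. exact: time_step_gt0. Qed.

(** The grid values of time layer k as functions on the line: [interp] is
    piecewise linear between the nodes m with m + k odd, and [interp_slope] is
    its slope. The cell of x is the one of [cell], for all integer times. *)
Definition layer t : int := Num.floor (t / dt).
Definition cellz k x : int := 2 * Num.floor ((x / dx - k%:~R + 1) / 2) + k.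
Definition interp k v x : R := let m := cellz k x in
  v (m - 1) + slope M v m * (x - xg (m - 1)).
Definition interp_slope k v x : R := slope M v (cellz k x).

Lemma xgD m j : xg (m + j) = xg m + j%:~R * dx.
Proof. by rewrite /xgrid intrD mulrDl. Qed.
Lemma xgD1 m : xg (m + 1) = xg m + dx. Proof. by rewrite xgD mul1r. Qed.
Lemma xgB1 m : xg (m - 1) = xg m - dx. Proof. by rewrite xgD mulrNz mulN1r. Qed.

Lemma le_xg m j : (xg m <= xg j) = (m <= j).
Proof. by rewrite /xgrid ler_pM2r// ler_int. Qed.
Lemma lt_xg m j : (xg m < xg j) = (m < j).
Proof. by rewrite /xgrid ltr_pM2r// ltr_int. Qed.

Lemma cellz_evn k x : evn k (cellz k x).
Proof. by rewrite /evn /cellz; apply/dvdzP; exists (Num.floor ((x / dx - k%:~R + 1) / 2) + k); ring. Qed.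

Lemma cellz_itv k x : xg (cellz k x - 1) <= x < xg (cellz k x + 1).
Proof.
rewrite /xgrid -ler_pdivlMr// -ltr_pdivrMr// /cellz.
set y := x / dx.
have /andP[] := floor_itv ((y - k%:~R + 1) / 2).
set f := Num.floor _ => h1 h2.
rewrite !(rmorphD, rmorphM, rmorphN) /=.
by apply/andP; split; lra.
Qed.

Lemma cellz_unique k m x : evn k m -> xg (m - 1) <= x < xg (m + 1) -> cellz k x = m.
Proof.
move=> em /andP[h1 h2]; have /andP[h3 h4] := cellz_itv k x.
have := le_lt_trans h3 h2; have := le_lt_trans h1 h4; rewrite !lt_xg.
by have := cellz_evn k x; move: em; rewrite /evn; lia.
Qed.

Lemma le_cellz k x y : x <= y -> cellz k x <= cellz k y.
Proof.
move=> xy; have /andP[h1 _] := cellz_itv k x; have /andP[_ h2] := cellz_itv k y.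
have := le_lt_trans h1 (le_lt_trans xy h2); rewrite lt_xg.
by have := cellz_evn k x; have := cellz_evn k y; rewrite /evn; lia.
Qed.

Lemma cellz_add1 k x : cellz k (x + 1) = cellz k x + (2 * mesh_N M)%N%:Z.
Proof.
apply: cellz_unique; first by have := cellz_evn k x; rewrite /evn; lia.
have -> : cellz k x + (2 * mesh_N M)%N%:Z - 1 = cellz k x - 1 + (2 * mesh_N M)%N%:Z by ring.
have -> : cellz k x + (2 * mesh_N M)%N%:Z + 1 = cellz k x + 1 + (2 * mesh_N M)%N%:Z by ring.
by rewrite !xgrid_period lerD2r ltrD2r cellz_itv.
Qed.

Lemma cellz_evn_eq k j x : evn 0 (k - j) -> cellz k x = cellz j x.
Proof.
move=> e; apply: cellz_unique; last exact: cellz_itv.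
by have := cellz_evn j x; move: e; rewrite /evn; lia.
Qed.

Lemma evn_double k (n : nat) : evn 0 (k + (2 * n)%N%:Z - k).
Proof. by rewrite /evn; lia. Qed.

Lemma slopeE v m : v (m + 1) = v (m - 1) + slope M v m * (2 * dx).
Proof.
have /lt0r_neq0 d0 : 0 < 2 * dx by rewrite mulr_gt0.
by rewrite /slope divfK//; ring.
Qed.

Lemma slopeN v m : slope M (fun m => - v m) m = - slope M v m.
Proof. by rewrite /slope -opprD mulNr. Qed.

Lemma interpN k v x : interp k (fun m => - v m) x = - interp k v x.
Proof. by rewrite /interp slopeN mulNr opprD. Qed.

Lemma interp_addc k v a x : interp k (fun m => v m + a) x = interp k v x + a.
Proof.
rewrite /interp; have -> : slope M (fun m => v m + a) (cellz k x) = slope M v (cellz k x).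
  by rewrite /slope; congr (_ / _); ring.
by ring.
Qed.

Lemma interp_node k v m : ~~ evn k m -> interp k v (xg m) = v m.
Proof.
move=> om; have cE : cellz k (xg m) = m + 1.
  apply: cellz_unique; first by rewrite evnE.
  by rewrite addrK lexx intD11 lt_xg; lia.
by rewrite /interp cE addrK subrr mulr0 addr0.
Qed.

(** Induction on the number of cells between x and y. *)
Lemma interp_climb k v (S : R) x y : x <= y ->
  (forall m, evn k m -> cellz k x <= m <= cellz k y -> slope M v m <= S) ->
  interp k v y - interp k v x <= S * (y - x).
Proof.
move=> xy; have [n nE] : exists n : nat, cellz k y = cellz k x + (2 * n)%N%:Z.
  exists `|((cellz k y - cellz k x)%R %/ 2)%Z|%N.
  by have := le_cellz k xy; have := cellz_evn k x; have := cellz_evn k y; rewrite /evn; lia.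
elim: n x xy nE => [|n IH] x xy nE hS.
  have cxy : cellz k y = cellz k x by rewrite nE muln0 addr0.
  rewrite /interp cxy (_ : _ - _ = slope M v (cellz k x) * (y - x)); last by ring.
  rewrite ler_wpM2r ?subr_ge0// hS ?cellz_evn//.
  by rewrite cxy lexx.
pose z := xg (cellz k x + 1).
have /andP[h1 h2] := cellz_itv k x.
have cz : cellz k z = cellz k x + 2.
  apply: cellz_unique; first by rewrite evnE cellz_evn.
  by rewrite /z le_xg lt_xg; lia.
have zy : z <= y.
  have /andP[h3 _] := cellz_itv k y; apply: le_trans h3.
  by rewrite /z le_xg nE; lia.
have gz : interp k v z = v (cellz k x + 1) by rewrite interp_node// evnE cellz_evn.
have i1 : interp k v z - interp k v x <= S * (z - x).
  rewrite gz slopeE /interp.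
  rewrite (_ : _ - _ = slope M v (cellz k x) * (xg (cellz k x - 1) + 2 * dx - x)); last by ring.
  have -> : xg (cellz k x - 1) + 2 * dx = z by rewrite /z xgB1 xgD1; ring.
  rewrite ler_wpM2r ?subr_ge0 ?(ltW h2)// hS ?cellz_evn// lexx /=.
  by rewrite nE; lia.
have i2 : interp k v y - interp k v z <= S * (y - z).
  apply: IH => //; first by rewrite cz nE; lia.
  move=> m em /andP[m1 m2]; apply: hS => //; rewrite m2 andbT.
  by move: m1; rewrite cz; lia.
lra.
Qed.

Lemma interp_descend k v (S : R) x y : x <= y ->
  (forall m, evn k m -> cellz k x <= m <= cellz k y -> S <= slope M v m) ->
  S * (y - x) <= interp k v y - interp k v x.
Proof.
move=> xy h; have := @interp_climb k (fun m => - v m) (- S) x y xy.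
rewrite !interpN => /(_ _)/wrap[|]; last lra.
by move=> m em mm; rewrite slopeN lerN2 h.
Qed.

Lemma interp_lip k v (B : R) x y : (forall m, evn k m -> `|slope M v m| <= B) ->
  `|interp k v y - interp k v x| <= B * `|y - x|.
Proof.
move=> hB; wlog xy : x y / x <= y.
  move=> W; have [xy|/ltW yx] := leP x y; first exact: W.
  by rewrite distrC [`|y - x|]distrC; exact: W.
rewrite [`|y - x|]ger0_norm ?subr_ge0// ler_norml; apply/andP; split.
  rewrite -mulNr; apply: interp_descend => // m em _.
  by have := hB m em; rewrite ler_norml => /andP[].
by apply: interp_climb => // m em _; have := hB m em; rewrite ler_norml => /andP[].
Qed.

Section OneSided.
Variables (k : int) (v : int -> R) (E : R).
Hypothesis E0 : 0 <= E.
Hypothesis vE : forall m, ~~ evn k m -> slope M v (m + 1) - slope M v (m - 1) <= 2 * dx * E.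

Lemma slope_growth m m' : evn k m -> evn k m' -> m <= m' ->
  slope M v m' <= slope M v m + E * ((m' - m)%:~R * dx).
Proof.
move=> em em' mm; have [n nE] : exists n : nat, m' = m + (2 * n)%N%:Z.
  exists `|((m' - m)%R %/ 2)%Z|%N.
  by move: em em'; rewrite /evn; lia.
elim: n m' mm nE em' => [|n IH] m' mm nE em'.
  by rewrite nE addr0 subrr mul0r mulr0 addr0.
have e1 : evn k (m' - 2) by rewrite evnE.
have i1 := IH (m' - 2) ltac:(lia) ltac:(lia) e1.
have := vE (m := m' - 1); rewrite !evnE => /(_ em').
rewrite !intE1.
have -> : (m' - m)%:~R = (m' - 2 - m)%:~R + 2 :> R.
  by rewrite !intrB; ring.
lra.
Qed.

(** To the right of x the slopes exceed the slope at x at most by E times the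
    distance of the cells. In this form, with difference quotients instead of
    second differences, the one-sided bound passes to the limit. *)
Lemma one_sided_right x h : 0 < h ->
  interp k v (x + h) - interp k v x <= h * interp_slope k v x + E * (h * (h + 2 * dx)).
Proof.
move=> h0; have xh : x <= x + h by lra.
apply: (le_trans (interp_climb (S := interp_slope k v x + E * (h + 2 * dx)) xh _)); last by lra.
move=> m em /andP[m1 m2].
apply: (le_trans (slope_growth (cellz_evn k x) em m1)); rewrite /interp_slope lerD2l ler_wpM2l//.
have /andP[h1 h2] := cellz_itv k x; have /andP[h3 h4] := cellz_itv k (x + h).
have h5 : xg m <= xg (cellz k (x + h)) by rewrite le_xg.
move: h2 h3 h5; rewrite xgB1 xgD1 intrB mulrBl -!/(xg _) => h2 h3 h5; lra.
Qed.

Lemma one_sided_left x h : 0 < h ->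
  h * interp_slope k v x <= interp k v x - interp k v (x - h) + E * (h * (h + 2 * dx)).
Proof.
move=> h0; have xh : x - h <= x by lra.
have : (interp_slope k v x - E * (h + 2 * dx)) * (x - (x - h)) <= interp k v x - interp k v (x - h).
  apply: (interp_descend xh) => m em /andP[m1 m2].
  rewrite lerBlDr; apply: (le_trans (slope_growth em (cellz_evn k x) m2)).
  rewrite lerD2l ler_wpM2l//.
  have /andP[h1 h2] := cellz_itv k x; have /andP[h3 h4] := cellz_itv k (x - h).
  have h5 : xg (cellz k (x - h)) <= xg m by rewrite le_xg.
  move: h1 h4; rewrite xgB1 xgD1 intrB mulrBl => h1 h4.
  by rewrite /xgrid in h1 h4 h5 *; lra.
rewrite subKr; lra.
Qed.
End OneSided.

End Interpolation.

Section SchemeEstimates.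
Context {R : realType}.
Variable H : R -> R -> R -> R.
Hypothesis H_per : per3 H.
Hypothesis H_C2 : C2_3 H.
Hypothesis H_pp : forall x t p, 0 < dp3 (dp3 H) x t p.
Variables (c l0 l1 : R).
Hypothesis l0_gt0 : 0 < l0.
Hypothesis l1_gt0 : 0 < l1.

Local Notation dx M := (space_step M : R).
Local Notation dt M := (time_step M : R).

Definition vinterp M (V : int -> int -> R) (x t : R) : R := interp M (layer M t) (V (layer M t)) x.
Definition uinterp M (V : int -> int -> R) (x t : R) : R := interp_slope M (layer M t) (V (layer M t)) x.

Lemma nat_mul_ge0 (b y : R) : (forall i : nat, b <= i%:R * y) -> 0 <= y.
Proof.
move=> hi; rewrite leNgt; apply/negP => y0.
have := hi (Num.truncn (b / y)).+1; apply/negP; rewrite -ltNge.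
rewrite -ltr_ndivrMr//; exact: truncnS_gt.
Qed.

Section OneMesh.
Variables (M : mesh) (h : R) (V : int -> int -> R).
Hypothesis psV : pscheme H c l0 l1 M h V.
Variables (P CH B Ct : R).
Hypothesis Pcoer : forall x t p, `|dp3 H x t p| <= l1^-1 -> `|p| <= P.
Hypothesis HCH : forall x t p, `|p| <= P -> `|H x t p| <= CH.
Hypothesis HB : forall k m, evn k m -> `|slope M (V k) m| <= B.

Let dxp : 0 < dx M. Proof. exact: space_step_gt0. Qed.
Let dtp : 0 < dt M. Proof. exact: time_step_gt0. Qed.

Lemma flux_bound k m : evn k m -> `|H (xgrid M m) (tz M k) (c + slope M (V k) m)| <= CH.
Proof. by move=> em; apply: HCH; apply: Pcoer; exact: (ps_cfl psV em). Qed.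

(** The recursion takes an average and adds dt times a bounded quantity. *)
Lemma V_growth (s A : R) : s = 1 \/ s = -1 ->
  (forall m, ~~ evn 0 m -> s * V 0 m <= A) ->
  forall (j : nat) m, ~~ evn j m -> s * V j m <= A + j%:R * dt M * (s * h + CH).
Proof.
move=> s1 h0; elim=> [|j IH] m om; first by rewrite !mul0r addr0 h0.
have em : evn j m by move: om; rewrite -addn1 PoszD evnDk negbK.
have o1 : ~~ evn j (m + 1) by rewrite evnE em.
have o2 : ~~ evn j (m - 1) by rewrite evnE em.
have i1 := IH _ o1; have i2 := IH _ o2.
have b := flux_bound em.
rewrite -addn1 PoszD (ps_rec psV em).
set F := H _ _ _ in b *.
have sF : - (s * F) <= CH.
  by move: b; rewrite ler_norml => /andP[? ?]; case: s1 => ->; lra.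
rewrite natrD.
have := ler_wpM2l (ltW dtp) sF; lra.
Qed.

(** Periodicity in time excludes a growth of V over many periods, so h cannot
    exceed the bound of the values of H. *)
Lemma h_bound_sign s : s = 1 \/ s = -1 -> 0 <= s * h + CH.
Proof.
move=> s1.
have [A hA] := int_periodic_bounded (f := V 0) (P := (2 * mesh_N M)%N)
   ltac:(have := mesh_N_gt0 M; lia) (fun m => ps_xper psV 0 m).
have hA' m : ~~ evn 0 m -> s * V 0 m <= A.
  by move=> _; have := hA m; rewrite ler_norml => /andP[? ?]; case: s1 => ->; lra.
have g := V_growth s1 hA'.
apply: (@nat_mul_ge0 (s * V 0 1 - A)) => i.
have VT : V ((2 * mesh_K M)%N%:Z * i%:Z) 1 = V 0 1.
  elim: i => [|i IH]; first by rewrite mulr0.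
  by rewrite intS mulrDr mulr1 addrC (ps_tper psV)// /evn; nia.
have := g (2 * mesh_K M * i)%N 1; rewrite PoszM VT => /(_ _)/wrap[|].
  by rewrite /evn; lia.
rewrite natrM [_ * i%:R]mulrC -[i%:R * _ * _]mulrA time_period mulr1; lra.
Qed.

Lemma h_bound : `|h| <= CH.
Proof.
have h1 := h_bound_sign (or_introl erefl); have h2 := h_bound_sign (or_intror erefl).
by rewrite ler_norml; apply/andP; split; lra.
Qed.

Lemma B_ge0 : 0 <= B.
Proof. by apply: le_trans (HB (k := 0) (m := 0) _). Qed.

(** Consecutive layers live on staggered nodes; they are compared through the
    value at a node of the next layer. *)
Lemma interp_time_step k x : `|interp M (k + 1) (V (k + 1)) x - interp M k (V k) x|
   <= 4 * B * dx M + 2 * CH * dt M.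
Proof.
set m := cellz M k x; have em : evn k m := cellz_evn M k x.
have B0 := B_ge0.
have nd : interp M (k + 1) (V (k + 1)) (xgrid M m) = V (k + 1) m.
  by rewrite interp_node// evnE em.
have l1' := @interp_lip _ M (k + 1) (V (k + 1)) B x (xgrid M m) (@HB (k + 1)).
have nd2 : interp M k (V k) (xgrid M (m - 1)) = V k (m - 1).
  by rewrite interp_node// evnE em.
have l2' := @interp_lip _ M k (V k) B (xgrid M (m - 1)) x (@HB k).
rewrite nd in l1'; rewrite nd2 in l2'.
have /andP[] := cellz_itv M k x; rewrite -/m xgB1 xgD1 => c1 c2.
rewrite xgB1 in l2'.
have d1 : `|xgrid M m - x| <= dx M by rewrite ler_norml; apply/andP; split; lra.
have d2 : `|x - (xgrid M m - dx M)| <= 2 * dx M.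
  by rewrite ler_norml; apply/andP; split; lra.
have hb := h_bound; have fb := flux_bound em.
have r := ps_rec psV em; set F := H _ _ _ in fb r.
have sl := slopeE M (V k) m.
have bm := HB em.
have e3 : `|V (k + 1) m - V k (m - 1)| <= B * dx M + 2 * CH * dt M.
  rewrite r sl.
  set S := slope _ _ _ in bm *.
  have -> : (V k (m - 1) + (V k (m - 1) + S * (2 * dx M))) / 2 - dt M * (F - h) - V k (m - 1)
     = S * dx M - dt M * (F - h) by field.
  apply: le_trans (ler_normB _ _) _; rewrite (normrM S) (gtr0_norm dxp) (normrM (dt M)) (gtr0_norm dtp).
  apply: lerD; first by rewrite ler_wpM2r// ltW.
  rewrite mulrC ler_wpM2r ?(ltW dtp)//.
  by apply: le_trans (ler_normB _ _) _; lra.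
have t1 := ler_wpM2l B0 d1; have t2 := ler_wpM2l B0 d2.
rewrite (_ : _ - _ = (interp M (k + 1) (V (k + 1)) x - V (k + 1) m)
   + (V (k + 1) m - V k (m - 1)) + (V k (m - 1) - interp M k (V k) x)); last by ring.
apply: le_trans (ler_normD _ _) _; rewrite [`|V k _ - _|]distrC.
apply: le_trans (lerD (ler_normD _ _) (lexx _)) _.
rewrite [`|interp _ _ _ x - V (k + 1) m|]distrC; lra.
Qed.

Hypothesis hCt : 4 * B * dx M + 2 * CH * dt M <= Ct * dt M.

Lemma interp_time_lip k j x : `|interp M k (V k) x - interp M j (V j) x| <= Ct * dt M * `|k - j|%:~R.
Proof.
wlog jk : k j / j <= k.
  move=> W; have [jk|/ltW kj] := leP j k; first exact: W.
  by rewrite distrC [X in X%:~R]distrC; exact: W.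
have [n nE] : exists n : nat, k = j + n%:Z by exists `|k - j|%N; lia.
rewrite nE (_ : j + n%:Z - j = n%:Z); last by ring.
rewrite [`|n%:Z|]ger0_norm// {k jk nE}.
elim: n => [|n i1]; first by rewrite addr0 subrr normr0 mulr0.
have := interp_time_step (j + n%:Z) x.
rewrite (_ : j + n.+1%:Z = j + n%:Z + 1); last by lia.
set a := interp _ (j + n%:Z + 1) _ _; set b := interp _ _ _ _ in i1 *; set d := interp _ _ _ _ in i1 * => h1.
rewrite (_ : a - d = (a - b) + (b - d)); last by ring.
apply: le_trans (ler_normD _ _) _.
rewrite intS intrD mulrDr mulr1.
by apply: lerD => //; exact: le_trans hCt.
Qed.

Lemma layer_itv (t : R) : tz M (layer M t) <= t < tz M (layer M t + 1).
Proof.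
rewrite /tz -ler_pdivlMr// -ltr_pdivrMr//; exact: floor_itv.
Qed.

Lemma layer_dist (t s : R) : dt M * `|layer M t - layer M s|%:~R <= `|t - s| + dt M.
Proof.
wlog st : t s / s <= t.
  move=> W; have [st|/ltW ts] := leP s t; first exact: W.
  by rewrite [X in X%:~R]distrC [`|t - s|]distrC; exact: W.
have ks : layer M s <= layer M t by apply: le_floor; apply: ler_wpM2r => //; rewrite invr_ge0 ltW.
rewrite ger0_norm ?subr_ge0// ger0_norm ?subr_ge0//.
have /andP[+ _] := layer_itv t; have /andP[_] := layer_itv s.
by rewrite /tz intrD intrB; lra.
Qed.

Lemma vinterp_lip x t y s : 0 <= Ct ->
  `|vinterp M V x t - vinterp M V y s| <= B * `|x - y| + Ct * (`|t - s| + dt M).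
Proof.
move=> Ct0; rewrite /vinterp.
rewrite (_ : _ - _ = (interp M (layer M t) (V (layer M t)) x - interp M (layer M t) (V (layer M t)) y) +
  (interp M (layer M t) (V (layer M t)) y - interp M (layer M s) (V (layer M s)) y)); last by ring.
apply: le_trans (ler_normD _ _) _; apply: lerD.
  by apply: interp_lip => m em; exact: HB.
apply: le_trans (interp_time_lip _ _ _) _.
by rewrite -mulrA ler_wpM2l// layer_dist.
Qed.

Lemma layer_add1 (t : R) : layer M (t + 1) = layer M t + (2 * mesh_K M)%N%:Z.
Proof.
rewrite /layer mulrDl mul1r.
have -> : (dt M)^-1 = (2 * mesh_K M)%N%:Z%:~R.
  by apply: (mulIf (lt0r_neq0 dtp)); rewrite mulVf ?lt0r_neq0// time_period.
by rewrite floorDrz ?intrKfloor// intr_int.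
Qed.

Lemma vinterp_x1 x t : vinterp M V (x + 1) t = vinterp M V x t.
Proof.
rewrite /vinterp /interp cellz_add1.
set m := cellz _ _ _; set k := layer _ _.
have -> : m + (2 * mesh_N M)%N%:Z - 1 = m - 1 + (2 * mesh_N M)%N%:Z by ring.
have -> : slope M (V k) (m + (2 * mesh_N M)%N%:Z) = slope M (V k) m.
  rewrite /slope -!(ps_xper psV k (m - 1)) -!(ps_xper psV k (m + 1)).
  by congr ((V _ _ - V _ _) / _); ring.
by rewrite (ps_xper psV) xgrid_period opprD addrACA subrr addr0.
Qed.

Lemma vinterp_t1 x t : vinterp M V x (t + 1) = vinterp M V x t.
Proof.
rewrite /vinterp layer_add1 /interp.
set k := layer _ _.
have -> : cellz M (k + (2 * mesh_K M)%N%:Z) x = cellz M k x.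
  by apply: cellz_evn_eq; exact: evn_double.
have em : evn k (cellz M k x) := cellz_evn M k x.
set m := cellz _ _ _ in em *.
by rewrite /slope !(ps_tper psV)// evnE em.
Qed.

End OneMesh.

(** All constants are independent of the mesh. The convexity constant is
    decreased so far that the trivial bound of the second differences is in the
    range where [D_step] applies. *)
Lemma scheme_estimates :
  (exists2 P : R, 0 < P & forall x t p, `|dp3 H x t p| <= l1^-1 -> `|p| <= P) ->
  exists P B E C : R, [/\ [/\ 0 <= P, 0 <= B, 0 <= E & 0 <= C],
    forall x t p, `|dp3 H x t p| <= l1^-1 -> `|p| <= P &
    forall M h V, pscheme H c l0 l1 M h V ->
     [/\ `|h| <= C, forall k m, evn k m -> `|slope M (V k) m| <= B,
       forall k m, ~~ evn k m -> slope M (V k) (m + 1) - slope M (V k) (m - 1) <= 2 * dx M * E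
     & forall x t y s, `|vinterp M V x t - vinterp M V y s| <= B * `|x - y| + C * (`|t - s| + dt M)]].
Proof.
move=> [P P0 Pcoer].
have [CH hCH] := H_bounded H_per H_C2 P.
have [a0 a00 ha0] := H_strongly_convex H_per H_C2 H_pp P.
have [Cx0 hCx0] := Hx_lip H_per H_C2 P.
pose B := P + `|c|.
have B0 : 0 < B by rewrite ltr_pwDl.
pose a := Num.min a0 (B * l1)^-1.
have a_gt0 : 0 < a by rewrite lt_min a00 invr_gt0 mulr_gt0.
have a_a0 : a <= a0 by rewrite ge_min lexx.
have a_small : a * (B * l1) <= 1.
  by rewrite -ler_pdivlMr ?mulr_gt0// mul1r ge_min lexx orbT.
pose Cx := `|Cx0|.
have hCx : strip_lip (dx3 H) P Cx.
  move=> x t p y s q pP qP; apply: le_trans (hCx0 x t p y s q pP qP) _.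
  by rewrite ler_wpM2r ?ler_norm// !addr_ge0.
have ha x t p q : `|p| <= P -> `|q| <= P ->
    dp3 H x t p * (q - p) + a / 2 * (q - p) ^+ 2 <= H x t q - H x t p.
  move=> pP qP; apply: le_trans (ha0 x t p q pP qP); rewrite lerD2l ler_wpM2r ?sqr_ge0//.
  by rewrite ler_pM2r.
pose E := 1 + 4 * (2 * Cx + 2 * Cx ^+ 2 / a) / a.
have CH0 : 0 <= CH by apply: le_trans (hCH 0 0 0 _); rewrite ?normr0 ?(ltW P0).
pose C := 4 * B / l0 + 2 * CH.
have C0 : 0 <= C by rewrite addr_ge0 ?mulr_ge0 ?invr_ge0 ?(ltW B0) ?(ltW l0_gt0).
have E0 : 0 <= E.
  have aI : 0 <= a^-1 by rewrite invr_ge0 ltW.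
  have Cx1 : 0 <= Cx := normr_ge0 Cx0.
  apply: addr_ge0 => //; apply: mulr_ge0 => //; apply: mulr_ge0 => //.
  apply: addr_ge0; first exact: mulr_ge0.
  by apply: mulr_ge0 => //; apply: mulr_ge0 => //; exact: sqr_ge0.
exists P, B, E, C; split => //; first by split => //; exact: ltW.
move=> M h V psV.
have HB k m : evn k m -> `|slope M (V k) m| <= B by exact: (slope_bound psV Pcoer).
split => //.
- apply: le_trans (h_bound psV Pcoer hCH) _.
  by rewrite /C; have := divr_ge0 (mulr_ge0 (ler0n R 4) (ltW B0)) (ltW l0_gt0); lra.
- by move=> k m om; exact: (one_sided H_C2 l1_gt0 psV P0 Pcoer a_gt0 (normr_ge0 Cx0) ha hCx a_small om).
- move=> x t y s; apply: (vinterp_lip psV Pcoer hCH HB) => //.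
  have := dx_dt psV => dd.
  have -> : C * dt M = 4 * B / l0 * dt M + 2 * CH * dt M by rewrite /C mulrDl.
  rewrite lerD2r -!mulrA !ler_pM2l// ler_pdivlMl//.
Qed.

End SchemeEstimates.

(** * Compactness *)

Section ArzelaAscoli.
Context {R : realType}.

Lemma ultra_bounded_cvg (U : set_system nat) (a : nat -> R) (B : R) :
  UltraFilter U -> (forall j, `|a j| <= B) -> exists l : R, a @ U --> l.
Proof.
move=> UU aB.
have PU : ProperFilter U by exact: ultra_proper.
have [|l [_ lcl]] := @segment_compact R (- B) B (a @ U) _.
  rewrite /fmap /=; suff -> : (a @^-1` `[- B, B]) = setT by exact: filterT.
  by apply/seteqP; split => // j _; rewrite /= in_itv/= -ler_norml.
exists l => A lA.
have [//|nA] := in_ultra_setVsetC (a @^-1` A) UU.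
by have [y [nAy Ay]] := lcl (~` A) A nA lA.
Qed.

Variables (f : nat -> R -> R -> R) (h e : nat -> R) (C : R).
Hypothesis C0 : 0 <= C.
Hypothesis fx : forall j x t, f j (x + 1) t = f j x t.
Hypothesis ft : forall j x t, f j x (t + 1) = f j x t.
Hypothesis f0 : forall j, f j 0 0 = 0.
Hypothesis flip : forall j x t y s, `|f j x t - f j y s| <= C * (`|x - y| + `|t - s| + e j).
Hypothesis e0 : e @ \oo --> (0 : R).
Hypothesis e1 : forall j, e j <= 1.
Hypothesis hC : forall j, `|h j| <= C.

Lemma f_frac j x t : f j (frac x) (frac t) = f j x t.
Proof.
rewrite (@frac_periodic _ _ (fun y => f j y (frac t)))//.
by rewrite (@frac_periodic _ _ (fun s => f j x s)).
Qed.

Lemma f_bounded j x t : `|f j x t| <= C * 3.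
Proof.
rewrite -f_frac; have := flip j (frac x) (frac t) 0 0; rewrite f0 !subr0.
move/le_trans; apply; rewrite ler_wpM2l//.
have /andP[? /ltW ?] := frac_itv x; have /andP[? /ltW ?] := frac_itv t.
by rewrite !ger0_norm//; have := e1 j; lra.
Qed.

(** Arzela-Ascoli. The pointwise limit is taken along an ultrafilter; the
    Lipschitz bounds make the convergence uniform by comparison on a finite grid
    of the period; a sequence is chosen only at the end. The errors e j account
    for functions that are Lipschitz in time only down to the mesh size. *)
Lemma uniform_subsequence : exists (phi : nat -> nat) (hl : R) (v : R -> R -> R),
  [/\ forall n, (n <= phi n)%N, forall n, `|h (phi n) - hl| <= n.+1%:R^-1,
    forall n x t, `|f (phi n) x t - v x t| <= n.+1%:R^-1,
    forall x t, v (x + 1) t = v x t /\ v x (t + 1) = v x t &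
    forall x t y s, `|v x t - v y s| <= C * (`|x - y| + `|t - s|)].
Proof.
have [U [UU sU]] := @ultraFilterLemma nat \oo _.
have PU : ProperFilter U by exact: ultra_proper.
have [hl hU] := ultra_bounded_cvg UU hC.
have vex (z : R * R) : exists l : R, (fun j => f j z.1 z.2) @ U --> l.
  by apply: ultra_bounded_cvg => j; exact: f_bounded.
have [v0 v0U] := choice vex.
pose v x t := v0 (x, t).
have vU x t : (fun j => f j x t) @ U --> v x t by exact: (v0U (x, t)).
have eU : e @ U --> (0 : R) by move=> A /e0; exact: sU.
have v_lip x t y s : `|v x t - v y s| <= C * (`|x - y| + `|t - s|).
  have c1 : (fun j => `|f j x t - f j y s|) @ U --> `|v x t - v y s|.
    by apply: cvg_norm; apply: cvgB; exact: vU.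
  have c2 : (fun j => C * (`|x - y| + `|t - s| + e j)) @ U --> C * (`|x - y| + `|t - s| + 0).
    by apply: cvgMr; apply: cvgD eU; exact: cvg_cst.
  rewrite addr0 in c2.
  apply: (ler_cvg_to c1 c2); near=> j; exact: flip.
have vx x t : v (x + 1) t = v x t.
  have vx1 := vU (x + 1) t.
  rewrite (_ : (fun j => f j (x + 1) t) = (fun j => f j x t)) in vx1.
    exact: (cvg_unique _ vx1 (vU x t)).
  by apply/funext => j; rewrite fx.
have vt x t : v x (t + 1) = v x t.
  have vt1 := vU x (t + 1).
  rewrite (_ : (fun j => f j x (t + 1)) = (fun j => f j x t)) in vt1.
    exact: (cvg_unique _ vt1 (vU x t)).
  by apply/funext => j; rewrite ft.
have v_frac x t : v (frac x) (frac t) = v x t.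
  rewrite (@frac_periodic _ _ (fun y => v y (frac t)))//.
  by rewrite (@frac_periodic _ _ (fun s => v x s)).
have unif (ep : R) : 0 < ep -> \forall j \near U, forall x t, `|f j x t - v x t| <= ep.
  move=> ep0.
  pose n := (Num.truncn (8 * C / ep)).+1.
  have n0 : 0 < n%:R :> R by rewrite ltr0n.
  have nC : 8 * C < ep * n%:R.
    by rewrite [ep * _]mulrC -ltr_pdivrMr//; exact: truncnS_gt.
  have grid : \forall j \near U, forall ab : 'I_n * 'I_n,
      `|f j (ab.1%:R / n%:R) (ab.2%:R / n%:R) - v (ab.1%:R / n%:R) (ab.2%:R / n%:R)| <= ep / 4.
    apply: filter_forall => ab; have := vU (ab.1%:R / n%:R) (ab.2%:R / n%:R).
    move=> /cvgr_dist_le /(_ (ep / 4)) /(_ ltac:(lra)).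
    by apply: filterS => j; rewrite distrC.
  have ee : \forall j \near U, C * e j <= ep / 4.
    have c2 : (fun j => C * e j) @ U --> C * 0 by exact: cvgMr.
    rewrite mulr0 in c2; move: c2 => /cvgr_dist_le /(_ (ep / 4)) /(_ ltac:(lra)).
    by apply: filterS => j; rewrite sub0r normrN; apply: le_trans; exact: ler_norm.
  near=> j => x t.
  rewrite -f_frac -v_frac; have := frac_itv x; have := frac_itv t.
  set y := frac x; set s := frac t => s01 y01.
  have idx (z : R) : 0 <= z < 1 -> exists a : 'I_n, `|z - a%:R / n%:R| <= n%:R^-1.
    move=> /andP[z0 z1].
    have nz0 : 0 <= n%:R * z by rewrite mulr_ge0// ltW.
    have an : (Num.truncn (n%:R * z) < n)%N.
      have /andP[t0 _] := truncn_itv nz0.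
      by rewrite -(ltr_nat R) (le_lt_trans t0)// gtr_pMr.
    exists (Ordinal an) => /=.
    have /andP[t1 t2] := truncn_itv nz0.
    rewrite -(ler_pM2l n0) divff ?lt0r_neq0// -{1}(gtr0_norm n0) -normrM mulrBr.
    rewrite mulrCA divff ?lt0r_neq0// mulr1 ler_norml; move: t2; rewrite -natr1 => t2.
    by apply/andP; split; lra.
  have [a ha] := idx y y01; have [b hb] := idx s s01.
  have g : forall ab : 'I_n * 'I_n,
      `|f j (ab.1%:R / n%:R) (ab.2%:R / n%:R) - v (ab.1%:R / n%:R) (ab.2%:R / n%:R)| <= ep / 4.
    by near: j; exact: grid.
  have ej : C * e j <= ep / 4 by near: j.
  have g1 := g (a, b); rewrite /= in g1.
  have l1 := flip j y s (a%:R / n%:R) (b%:R / n%:R).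
  have l2 := v_lip y s (a%:R / n%:R) (b%:R / n%:R).
  have l3 : C * (`|y - a%:R / n%:R| + `|s - b%:R / n%:R|) <= C * (2 / n%:R).
    by rewrite ler_wpM2l//; lra.
  have l4 : C * (2 / n%:R) <= ep / 4.
    by rewrite mulrA ler_pdivrMr//; lra.
  set F := f j _ _ in g1 l1; set W := v _ _ in g1 l2.
  rewrite (_ : f j y s - v y s = (f j y s - F) + (F - W) + (W - v y s)); last by ring.
  apply: le_trans (ler_normD _ _) _; rewrite [`|W - _|]distrC.
  have := ler_normD (f j y s - F) (F - W); lra.
have ex n : exists j, [/\ (n <= j)%N, `|h j - hl| <= n.+1%:R^-1 &
    forall x t, `|f j x t - v x t| <= n.+1%:R^-1].
  have p0 : 0 < n.+1%:R^-1 :> R by rewrite invr_gt0 ltr0n.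
  apply: (@filter_ex _ U); near=> j; split.
  - by near: j; apply: sU; exact: nbhs_infty_ge.
  - near: j; move: hU => /cvgr_dist_le /(_ _ p0).
    by apply: filterS => j; rewrite distrC.
  - by near: j; exact: unif.
have [phi hphi] := choice ex.
exists phi, hl, v; split => // n; by have [] := hphi n.
Unshelve. all: by end_near.
Qed.

End ArzelaAscoli.

(** * Test functions and lattices *)

Section TestFunctions.
Context {R : realType}.
Implicit Types (f g : R -> R -> R).

Lemma C0_2_cvg f (x t : R) (a b : nat -> R) : C0_2 f ->
  a @ \oo --> x -> b @ \oo --> t -> (fun n => f (a n) (b n)) @ \oo --> f x t.
Proof.
move=> fC ax bt.
apply: (cvg_comp (fun n => (a n, b n)) (fun z : R * R => f z.1 z.2)); last exact: (fC (x, t)).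
exact: (cvg_pair (G := nbhs x) (H := nbhs t)).
Qed.

Lemma C0_3_cvg (g : R -> R -> R -> R) (x t p : R) (a b d : nat -> R) : C0_3 g ->
  a @ \oo --> x -> b @ \oo --> t -> d @ \oo --> p ->
  (fun n => g (a n) (b n) (d n)) @ \oo --> g x t p.
Proof.
move=> gC ax bt dp.
apply: (cvg_comp (fun n => (a n, b n, d n)) (fun z : R * R * R => g z.1.1 z.1.2 z.2));
  last exact: (gC (x, t, p)).
apply: (cvg_pair (G := nbhs (x, t)) (H := nbhs p)) => //.
exact: (cvg_pair (G := nbhs x) (H := nbhs t)).
Qed.

Definition quad (a x0 t0 : R) : R -> R -> R := fun x t => a * ((x - x0) ^+ 2 + (t - t0) ^+ 2).

Lemma is_derive_quad (a x0 b x : R) :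
  is_derive x (1 : R) (fun y : R => a * ((y - x0) ^+ 2 + b)) (2 * a * (x - x0)).
Proof. by apply: is_derive_eq; rewrite /GRing.scale /=; ring. Qed.

Lemma dx2_quad a x0 t0 x t : dx2 (quad a x0 t0) x t = 2 * a * (x - x0).
Proof. by rewrite /dx2 derive1E; have := is_derive_quad a x0 ((t - t0) ^+ 2) x => -[]. Qed.

Lemma quadC a x0 t0 x t : quad a x0 t0 x t = quad a t0 x0 t x.
Proof. by rewrite /quad addrC. Qed.

Lemma dt2_quad a x0 t0 x t : dt2 (quad a x0 t0) x t = 2 * a * (t - t0).
Proof.
rewrite /dt2 (_ : quad a x0 t0 x = (fun s => a * ((s - t0) ^+ 2 + (x - x0) ^+ 2))); last first.
  by apply/funext => s; rewrite quadC.
by rewrite derive1E; have := is_derive_quad a t0 ((x - x0) ^+ 2) t => -[].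
Qed.

Lemma C0_2_fst (g : R -> R) : continuous g -> C0_2 (fun x _ => g x).
Proof.
by move=> c1 z; apply: (cvg_comp fst g); [exact: cvg_fst|exact: c1].
Qed.
Lemma C0_2_snd (g : R -> R) : continuous g -> C0_2 (fun _ t => g t).
Proof.
by move=> c1 z; apply: (cvg_comp snd g); [exact: cvg_snd|exact: c1].
Qed.

Lemma C0_2D f g : C0_2 f -> C0_2 g -> C0_2 (fun x t => f x t + g x t).
Proof. by move=> cf cg z; apply: cvgD; [exact: cf|exact: cg]. Qed.

Lemma derivable_continuous (g : R -> R) : (forall x, derivable g x (1 : R)) -> continuous g.
Proof. by move=> dg x; apply: differentiable_continuous; apply/derivable1_diffP. Qed.

Lemma continuous_affine (a x0 : R) : continuous (fun x : R => a * (x - x0)).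
Proof.
apply: derivable_continuous => x.
have : is_derive x (1 : R) (fun x : R => a * (x - x0)) a.
  by apply: is_derive_eq; rewrite /GRing.scale /=; ring.
by case.
Qed.

Lemma C1_2_quad a x0 t0 : C1_2 (quad a x0 t0).
Proof.
have d1 b x : derivable (fun y : R => a * ((y - x0) ^+ 2 + b)) x (1 : R).
  by have := is_derive_quad a x0 b x => -[].
have d2 b t : derivable (fun y : R => a * ((y - t0) ^+ 2 + b)) t (1 : R).
  by have := is_derive_quad a t0 b t => -[].
have e x : quad a x0 t0 x = (fun s => a * ((s - t0) ^+ 2 + (x - x0) ^+ 2)).
  by apply/funext => s; rewrite quadC.
split.
- by move=> x t; split; [exact: d1|rewrite e; exact: d2].
- rewrite (_ : quad a x0 t0 = (fun x t => a * (x - x0) ^+ 2 + a * (t - t0) ^+ 2)); last first.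
    by apply/funext => x; apply/funext => t; rewrite /quad mulrDr.
  have c (z : R) : continuous (fun x : R => a * (x - z) ^+ 2).
    apply: derivable_continuous => x.
    have : is_derive x (1 : R) (fun y : R => a * ((y - z) ^+ 2 + 0)) (2 * a * (x - z)).
      exact: is_derive_quad.
    by move=> [+ _]; under eq_fun do rewrite addr0.
  by apply: C0_2D; [exact: C0_2_fst|exact: (C0_2_snd (c t0))].
- rewrite (_ : dx2 _ = (fun x _ => 2 * a * (x - x0))).
    by apply: C0_2_fst; exact: continuous_affine.
  by apply/funext => x; apply/funext => t; rewrite dx2_quad.
- rewrite (_ : dt2 _ = (fun _ t => 2 * a * (t - t0))).
    by apply: (C0_2_snd (g := fun t => 2 * a * (t - t0))); exact: continuous_affine.
  by apply/funext => x; apply/funext => t; rewrite dt2_quad.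
Qed.

Lemma derive1D (f g : R -> R) x : derivable f x (1 : R) -> derivable g x (1 : R) ->
  derive1 (fun y => f y + g y) x = derive1 f x + derive1 g x.
Proof. by move=> df dg; have := deriveD df dg; rewrite -!derive1E. Qed.

Lemma dx2D f g x t : C1_2 f -> C1_2 g ->
  dx2 (fun x t => f x t + g x t) x t = dx2 f x t + dx2 g x t.
Proof. by move=> [df _ _ _] [dg _ _ _]; exact: (derive1D (df x t).1 (dg x t).1). Qed.

Lemma dt2D f g x t : C1_2 f -> C1_2 g ->
  dt2 (fun x t => f x t + g x t) x t = dt2 f x t + dt2 g x t.
Proof. by move=> [df _ _ _] [dg _ _ _]; exact: (derive1D (df x t).2 (dg x t).2). Qed.

Lemma C1_2D f g : C1_2 f -> C1_2 g -> C1_2 (fun x t => f x t + g x t).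
Proof.
move=> fC gC; have [df cf cfx cft] := fC; have [dg cg cgx cgt] := gC; split.
- move=> x t; have [a1 a2] := df x t; have [b1 b2] := dg x t.
  by split; apply: derivableD.
- exact: C0_2D.
- rewrite (_ : dx2 _ = (fun x t => dx2 f x t + dx2 g x t)); first exact: C0_2D.
  by apply/funext => x; apply/funext => t; rewrite dx2D.
- rewrite (_ : dt2 _ = (fun x t => dt2 f x t + dt2 g x t)); first exact: C0_2D.
  by apply/funext => x; apply/funext => t; rewrite dt2D.
Qed.

Lemma between_cvg (a b xi : nat -> R) (x : R) : a @ \oo --> x -> b @ \oo --> x ->
  (forall n, Num.min (a n) (b n) <= xi n <= Num.max (a n) (b n)) -> xi @ \oo --> x.
Proof.
move=> ax bx h.
pose d n := `|a n - x| + `|b n - x|.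
have d0 : d @ \oo --> (0 : R).
  rewrite (_ : 0 = `|x - x| + `|x - x|); last by rewrite subrr normr0 addr0.
  by apply: cvgD; apply: cvg_norm; apply: cvgB => //; exact: cvg_cst.
apply: (squeeze_cvgr (f := fun n => x - d n) (h := fun n => x + d n)).
- near=> n; move: (h n); rewrite ge_min le_max /d => /andP[/orP h1 /orP h2].
  have := ler_norm (a n - x); have := ler_norm (b n - x).
  have := ler_norm (- (a n - x)); have := ler_norm (- (b n - x)); rewrite !normrN => ? ? ? ?.
  by apply/andP; split; [case: h1|case: h2]; lra.
- by rewrite -[x in _ --> x]subr0; apply: cvgB => //; exact: cvg_cst.
- by rewrite -[x in _ --> x]addr0; apply: cvgD => //; exact: cvg_cst.
Unshelve. all: by end_near.
Qed.

Lemma diffquot_x f (x0 t0 : R) (a b t : nat -> R) : C1_2 f ->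
  a @ \oo --> x0 -> b @ \oo --> x0 -> t @ \oo --> t0 ->
  exists2 Q : nat -> R, Q @ \oo --> dx2 f x0 t0 &
    forall n, f (b n) (t n) - f (a n) (t n) = Q n * (b n - a n).
Proof.
move=> [df _ cfx _] ax bx tt.
have mvt n := @mvt_between _ (f ^~ (t n)) (a n) (b n) (fun x => (df x (t n)).1).
have /choice[xi hxi] : forall n, exists y : R, Num.min (a n) (b n) <= y <= Num.max (a n) (b n) /\
    f (b n) (t n) - f (a n) (t n) = dx2 f y (t n) * (b n - a n).
  by move=> n; have [y hy e] := mvt n; exists y.
exists (fun n => dx2 f (xi n) (t n)); last by move=> n; case: (hxi n).
apply: C0_2_cvg => //; apply: (between_cvg ax bx) => n; by case: (hxi n).
Qed.

Lemma diffquot_t f (x0 t0 : R) (a b x : nat -> R) : C1_2 f ->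
  a @ \oo --> t0 -> b @ \oo --> t0 -> x @ \oo --> x0 ->
  exists2 Q : nat -> R, Q @ \oo --> dt2 f x0 t0 &
    forall n, f (x n) (b n) - f (x n) (a n) = Q n * (b n - a n).
Proof.
move=> [df _ _ cft] ax bx tt.
have mvt n := @mvt_between _ (f (x n)) (a n) (b n) (fun s => (df (x n) s).2).
have /choice[xi hxi] : forall n, exists y : R, Num.min (a n) (b n) <= y <= Num.max (a n) (b n) /\
    f (x n) (b n) - f (x n) (a n) = dt2 f (x n) y * (b n - a n).
  by move=> n; have [y hy e] := mvt n; exists y.
exists (fun n => dt2 f (x n) (xi n)); last by move=> n; case: (hxi n).
apply: C0_2_cvg => //; apply: (between_cvg ax bx) => n; by case: (hxi n).
Qed.

End TestFunctions.

Section LatticeMax.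
Context {R : realType}.
Variables (M : nat -> mesh) (W : nat -> int -> int -> R) (w : R -> R -> R).
Variables (e : nat -> R) (x0 t0 rho : R).
Hypothesis rho0 : 0 < rho.
Local Notation dx n := (space_step (M n) : R).
Local Notation dt n := (time_step (M n) : R).
Hypothesis dx_cvg : (fun n => dx n) @ \oo --> (0 : R).
Hypothesis dt_cvg : (fun n => dt n) @ \oo --> (0 : R).
Hypothesis e_cvg : e @ \oo --> (0 : R).
Hypothesis wC : C0_2 w.
Hypothesis We : forall n k m, ~~ evn k m -> `|W n k m - w (xgrid (M n) m) (tz (M n) k)| <= e n.
Hypothesis w_max : forall x t, `|x - x0| <= rho -> `|t - t0| <= rho ->
  w x t <= w x0 t0 - ((x - x0) ^+ 2 + (t - t0) ^+ 2).

Let in_box n k m := `|xgrid (M n) m - x0| <= rho /\ `|tz (M n) k - t0| <= rho.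
Let S n : set R := [set y | exists k m, [/\ ~~ evn k m, in_box n k m & y = W n k m]].
Let cond n := 2 * dx n <= rho /\ dt n <= rho.
Let dxp n : 0 < dx n. Proof. exact: space_step_gt0. Qed.
Let dtp n : 0 < dt n. Proof. exact: time_step_gt0. Qed.

Let kc n : int := layer (M n) t0.
Let mc n : int := cellz (M n) (kc n) x0 - 1.

Lemma near_odd n : ~~ evn (kc n) (mc n).
Proof. by rewrite /mc evnE cellz_evn. Qed.

Lemma near_dist n : `|xgrid (M n) (mc n) - x0| <= 2 * dx n /\ `|tz (M n) (kc n) - t0| <= dt n.
Proof.
have /andP[h1 h2] := cellz_itv (M n) (kc n) x0.
have /andP[h3 h4] := layer_itv (M n) t0.
split.
  move: h2; rewrite /mc xgB1 in h1 *; rewrite xgD1 => h2.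
  by rewrite ler_norml; apply/andP; split; have := dxp n; lra.
move: h4; rewrite /tz intrD mulrDl mul1r -/(kc n) => h4.
by rewrite ler_norml; apply/andP; split; have := dtp n; rewrite /tz -/(kc n) in h3; lra.
Qed.

Lemma S_has_sup n : cond n -> has_sup (S n).
Proof.
move=> [c1 c2]; split.
  have [d1 d2] := near_dist n; exists (W n (kc n) (mc n)), (kc n), (mc n).
  by split; [exact: near_odd|split; [exact: le_trans c1|exact: le_trans c2]|].
exists (w x0 t0 + e n) => y [k [m [om [b1 b2] ->]]].
have := We n om; rewrite ler_norml => /andP[_ h1].
have := w_max b1 b2; have := sqr_ge0 (xgrid (M n) m - x0); have := sqr_ge0 (tz (M n) k - t0); lra.
Qed.

(** Grid functions uniformly close to a function with a strict maximum have an
    almost maximal node near the maximum point. Almost means up to dt ^ 2, which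
    remains negligible after division by dt, so that no compactness of the grid
    is needed. *)
Lemma lattice_max : exists k m : nat -> int,
  [/\ forall n, evn (k n) (m n),
     (fun n => xgrid (M n) (m n)) @ \oo --> x0,
     (fun n => tz (M n) (k n)) @ \oo --> t0 &
     \forall n \near \oo, forall k' m', ~~ evn k' m' ->
        `|m' - m n| <= 2 -> `|k' - (k n + 1)| <= 1 ->
        W n k' m' <= W n (k n + 1) (m n) + dt n ^+ 2].
Proof.
have ex n : exists km : int * int, evn km.1 km.2 /\ (cond n ->
    in_box n (km.1 + 1) km.2 /\ sup (S n) - dt n ^+ 2 <= W n (km.1 + 1) km.2).
  have [cn|] := pselect (cond n); last by exists (0, 0).
  have [y [k [m [om bx ->]]] hy] := sup_adherent (exprn_gt0 2 (dtp n)) (S_has_sup cn).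
  exists (k - 1, m) => /=; rewrite evnBk om subrK; split => // _; split => //.
  exact: ltW.
have [km hkm] := choice ex.
pose k n := (km n).1; pose m n := (km n).2.
pose r n := 2 * e n + dt n ^+ 2 + `|w x0 t0 - w (xgrid (M n) (mc n)) (tz (M n) (kc n))|.
have near_x : (fun n => xgrid (M n) (mc n)) @ \oo --> x0.
  apply/cvgrPdist_le => ep ep0.
  have := dx_cvg => /cvgr_dist_le /(_ (ep / 2)) /(_ ltac:(lra)); apply: filterS => n.
  rewrite sub0r normrN gtr0_norm// => h; rewrite distrC.
  by have [+ _] := near_dist n; lra.
have near_t : (fun n => tz (M n) (kc n)) @ \oo --> t0.
  apply/cvgrPdist_le => ep ep0.
  have := dt_cvg => /cvgr_dist_le /(_ ep ep0); apply: filterS => n.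
  rewrite sub0r normrN gtr0_norm// => h; rewrite distrC.
  by have [_ +] := near_dist n; lra.
have r_cvg : r @ \oo --> (0 : R).
  rewrite (_ : 0 = 2 * 0 + 0 * 0 + `|w x0 t0 - w x0 t0|); last by rewrite subrr normr0 !mulr0 !addr0.
  apply: cvgD; first apply: cvgD; first exact: cvgMr.
    by under eq_fun do rewrite expr2; exact: cvgM.
  by apply: cvg_norm; apply: cvgB; [exact: cvg_cst|exact: C0_2_cvg].
have rho2 : 0 < rho / 2 by rewrite divr_gt0.
have rho3 : 0 < rho / 3 by rewrite divr_gt0.
have cond_near : \forall n \near \oo, cond n.
  have c1 : \forall n \near \oo, 2 * dx n <= rho.
    have := dx_cvg => /cvgr_dist_le /(_ _ rho2).
    by apply: filterS => n; rewrite sub0r normrN gtr0_norm//; lra.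
  have c2 : \forall n \near \oo, dt n <= rho.
    have := dt_cvg => /cvgr_dist_le /(_ _ rho0).
    by apply: filterS => n; rewrite sub0r normrN gtr0_norm//.
  by near=> n; split; near: n.
have supW n k' m' : cond n -> ~~ evn k' m' -> in_box n k' m' -> W n k' m' <= sup (S n).
  move=> cn om bx; apply: sup_upper_bound; first exact: S_has_sup.
  by exists k', m'.
have dist n : cond n ->
   (xgrid (M n) (m n) - x0) ^+ 2 + (tz (M n) (k n + 1) - t0) ^+ 2 <= r n.
  move=> cn; have [em /(_ cn)[[b1 b2] hs]] := hkm n.
  have om : ~~ evn (k n + 1) (m n) by rewrite evnDk negbK.
  have := We n om; rewrite ler_norml => /andP[_ h1].
  have h2 := w_max b1 b2.
  have [d1 d2] := near_dist n; case: (cn) => c1 c2.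
  have h3 := supW n _ _ cn (near_odd n) (conj (le_trans d1 c1) (le_trans d2 c2)).
  have := We n (near_odd n); rewrite ler_norml => /andP[h4 _].
  have := ler_norm (w x0 t0 - w (xgrid (M n) (mc n)) (tz (M n) (kc n))).
  rewrite /r -/(k n) -/(m n) in hs h1 h2 *; lra.
have sq_small (y ep : R) : 0 < ep -> y ^+ 2 <= ep ^+ 2 -> `|y| <= ep.
  by move=> ep0; rewrite -[y ^+ 2](real_normK (num_real y)) ler_sqr ?nnegrE ?normr_ge0// ltW.
have mx : (fun n => xgrid (M n) (m n)) @ \oo --> x0.
  apply/cvgrPdist_le => ep ep0.
  have := r_cvg => /cvgr_dist_le /(_ (ep ^+ 2)) /(_ (exprn_gt0 _ ep0)) hr.
  near=> n; rewrite distrC; apply: sq_small => //.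
  have cn : cond n by near: n.
  have : `|0 - r n| <= ep ^+ 2 by near: n.
  rewrite sub0r normrN => /(le_trans (ler_norm _)).
  by have := dist n cn; have := sqr_ge0 (tz (M n) (k n + 1) - t0); lra.
have kt1 : (fun n => tz (M n) (k n + 1)) @ \oo --> t0.
  apply/cvgrPdist_le => ep ep0.
  have := r_cvg => /cvgr_dist_le /(_ (ep ^+ 2)) /(_ (exprn_gt0 _ ep0)) hr.
  near=> n; rewrite distrC; apply: sq_small => //.
  have cn : cond n by near: n.
  have : `|0 - r n| <= ep ^+ 2 by near: n.
  rewrite sub0r normrN => /(le_trans (ler_norm _)).
  by have := dist n cn; have := sqr_ge0 (xgrid (M n) (m n) - x0); lra.
have kt : (fun n => tz (M n) (k n)) @ \oo --> t0.
  rewrite (_ : (fun n => _) = (fun n => tz (M n) (k n + 1) - dt n)); last first.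
    by apply/funext => n; rewrite /tz intrD mulrDl mul1r addrK.
  by rewrite -[t0]subr0; exact: cvgB.
exists k, m; split => //; first by move=> n; case: (hkm n).
have near1 : \forall n \near \oo, `|xgrid (M n) (m n) - x0| <= rho / 3.
  by move: mx => /cvgr_dist_le /(_ _ rho3); apply: filterS => n; rewrite distrC.
have near2 : \forall n \near \oo, `|tz (M n) (k n + 1) - t0| <= rho / 3.
  by move: kt1 => /cvgr_dist_le /(_ _ rho3); apply: filterS => n; rewrite distrC.
have near3 : \forall n \near \oo, dx n <= rho / 3.
  have := dx_cvg => /cvgr_dist_le /(_ _ rho3).
  by apply: filterS => n; rewrite sub0r normrN gtr0_norm//; lra.
have near4 : \forall n \near \oo, dt n <= rho / 3.
  have := dt_cvg => /cvgr_dist_le /(_ _ rho3).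
  by apply: filterS => n; rewrite sub0r normrN gtr0_norm//; lra.
near=> n => k' m' om hm hk.
have cn : cond n by near: n.
have [em /(_ cn)[bx hs]] := hkm n.
suff : W n k' m' <= sup (S n) by rewrite -/(k n) -/(m n) in hs *; lra.
apply: supW => //.
have n1 : `|xgrid (M n) (m n) - x0| <= rho / 3 by near: n.
have n2 : `|tz (M n) (k n + 1) - t0| <= rho / 3 by near: n.
have n3 : dx n <= rho / 3 by near: n.
have n4 : dt n <= rho / 3 by near: n.
have hm' : `|(m' - m n)%:~R| <= 2 :> R by rewrite -intr_norm (ler_int _ _ 2).
have hk' : `|(k' - (k n + 1))%:~R| <= 1 :> R by rewrite -intr_norm (ler_int _ _ 1).
split.
  rewrite (_ : xgrid (M n) m' - x0 = (m' - m n)%:~R * dx n + (xgrid (M n) (m n) - x0)).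
    apply: le_trans (ler_normD _ _) _; rewrite normrM (gtr0_norm (dxp n)).
    by have := ler_wpM2r (ltW (dxp n)) hm'; lra.
  by rewrite /xgrid intrB; ring.
rewrite (_ : tz (M n) k' - t0 = (k' - (k n + 1))%:~R * dt n + (tz (M n) (k n + 1) - t0)).
  apply: le_trans (ler_normD _ _) _; rewrite normrM (gtr0_norm (dtp n)).
  by have := ler_wpM2r (ltW (dtp n)) hk'; lra.
by rewrite /tz intrB; ring.
Unshelve. all: by end_near.
Qed.

End LatticeMax.

(** * The limit is a viscosity solution *)

Section DiscreteExtrema.
Context {R : realType}.

Lemma excess_ge (V F A d : R) : V - F <= A + d -> - d <= F + A - V.
Proof. by move=> h; lra. Qed.

Lemma excess_le (V F A d : R) : F - V <= A + d -> F - A - V <= d.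
Proof. by move=> h; lra. Qed.

(** Here a and b are the slopes of the scheme and of the test function at a node
    where their difference is maximal up to d, and dp and dm are the excesses of
    the test function at the two neighbours. A lower bound on dp + dm controls b
    - a because the mesh ratio is below l. The derivative q is taken at the
    slope b of the test function, which satisfies the CFL condition up to om. *)
Lemma discrete_sub (Hf : R -> R) (q l dx dt a b dp dm d : R) :
  0 < dx -> 0 < dt -> dt <= l * dx -> 0 < l ->
  Hf b - Hf a <= q * (b - a) -> b - a = (dp - dm) / (2 * dx) ->
  - d <= dp -> - d <= dm -> forall om, `|q| <= l^-1 + om -> 0 <= om ->
  Hf b - Hf a - (dp + dm) / (2 * dt) <= d / dt + om * `|b - a|.
Proof.
move=> dx0 dt0 dtl l0' cv ba hp hm om hq om0.
have h1 : q * (b - a) <= (l^-1 + om) * `|b - a|.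
  by apply: le_trans (ler_norm _) _; rewrite normrM ler_wpM2r.
have n1 : `|b - a| <= (dp + dm + 2 * d) / (2 * dx).
  rewrite ba normrM [`|(2 * dx)^-1|]gtr0_norm ?invr_gt0 ?mulr_gt0//.
  apply: ler_wpM2r; first by rewrite invr_ge0 mulr_ge0// ltW.
  by rewrite ler_norml; apply/andP; split; lra.
have n2 : l^-1 * `|b - a| <= (dp + dm + 2 * d) / (2 * dt).
  have s0 : 0 <= dp + dm + 2 * d by lra.
  apply: le_trans (ler_wpM2l (_ : 0 <= l^-1) n1) _; first by rewrite invr_ge0 ltW.
  rewrite mulrCA ler_wpM2l// -invfM lef_pV2 ?posrE ?mulr_gt0//; lra.
have e1 : (dp + dm + 2 * d) / (2 * dt) = (dp + dm) / (2 * dt) + d / dt.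
  by field; rewrite lt0r_neq0.
lra.
Qed.

(** At a minimum, the convexity inequality runs in the direction that needs the
    derivative q at the slope a of the scheme, where the CFL condition holds
    exactly. *)
Lemma discrete_super (Hf : R -> R) (q l dx dt a b dp dm d : R) :
  0 < dx -> 0 < dt -> dt <= l * dx -> 0 < l ->
  q * (b - a) <= Hf b - Hf a -> b - a = (dp - dm) / (2 * dx) ->
  dp <= d -> dm <= d -> `|q| <= l^-1 ->
  - (d / dt) <= Hf b - Hf a - (dp + dm) / (2 * dt).
Proof.
move=> dx0 dt0 dtl l0' cv ba hp hm hq.
have h1 : - (q * (b - a)) <= l^-1 * `|b - a|.
  by apply: le_trans (ler_norm _) _; rewrite normrN normrM ler_wpM2r.
have n1 : `|b - a| <= (2 * d - dp - dm) / (2 * dx).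
  rewrite ba normrM [`|(2 * dx)^-1|]gtr0_norm ?invr_gt0 ?mulr_gt0//.
  apply: ler_wpM2r; first by rewrite invr_ge0 mulr_ge0// ltW.
  by rewrite ler_norml; apply/andP; split; lra.
have n2 : l^-1 * `|b - a| <= (2 * d - dp - dm) / (2 * dt).
  have s0 : 0 <= 2 * d - dp - dm by lra.
  apply: le_trans (ler_wpM2l (_ : 0 <= l^-1) n1) _; first by rewrite invr_ge0 ltW.
  rewrite mulrCA ler_wpM2l// -invfM lef_pV2 ?posrE ?mulr_gt0//; lra.
have e1 : (2 * d - dp - dm) / (2 * dt) = d / dt - (dp + dm) / (2 * dt).
  by field; rewrite lt0r_neq0.
lra.
Qed.

End DiscreteExtrema.

Section ViscosityLimit.
Context {R : realType}.
Variable H : R -> R -> R -> R.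
Hypothesis H_per : per3 H.
Hypothesis H_C2 : C2_3 H.
Hypothesis H_pp : forall x t p, 0 < dp3 (dp3 H) x t p.
Variables (c l0 l1 : R).
Hypothesis l0_gt0 : 0 < l0.
Hypothesis l1_gt0 : 0 < l1.

Lemma tz_layer (M : mesh) (k : int) : layer M (tz M k : R) = k.
Proof.
have /lt0r_neq0 d0 : 0 < (time_step M : R) := time_step_gt0 M.
by rewrite /layer /tz mulfK// intrKfloor.
Qed.

Lemma vinterp_node (M : mesh) (V : int -> int -> R) k m : ~~ evn k m ->
  vinterp M V (xgrid M m) (tz M k) = V k m.
Proof. by move=> om; rewrite /vinterp tz_layer interp_node. Qed.

Variables (M : nat -> mesh) (h : nat -> R) (V : nat -> int -> int -> R).
Variables (v : R -> R -> R) (e : nat -> R) (hl B : R).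
Local Notation dx n := (space_step (M n) : R).
Local Notation dt n := (time_step (M n) : R).
Hypothesis psV : forall n, pscheme H c l0 l1 (M n) (h n) (V n).
Hypothesis dx_cvg : (fun n => dx n) @ \oo --> (0 : R).
Hypothesis dt_cvg : (fun n => dt n) @ \oo --> (0 : R).
Hypothesis e_cvg : e @ \oo --> (0 : R).
Hypothesis h_cvg : h @ \oo --> hl.
Hypothesis VB : forall n k m, evn k m -> `|slope (M n) (V n k) m| <= B.
Hypothesis Ve : forall n x t, `|vinterp (M n) (V n) x t - v x t| <= e n.
Hypothesis vC : C0_2 v.

Let dxp n : 0 < dx n. Proof. exact: space_step_gt0. Qed.
Let dtp n : 0 < dt n. Proof. exact: time_step_gt0. Qed.

Lemma nbhs_box (P : R * R -> Prop) (x0 t0 : R) : (\forall z \near ((x0, t0) : R * R), P z) ->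
  exists2 rho : R, 0 < rho & forall x t, `|x - x0| <= rho -> `|t - t0| <= rho -> P (x, t).
Proof.
move=> /nbhs_ballP[ep /= ep0 hP]; exists (ep / 2); first by rewrite divr_gt0.
move=> x t h1 h2; apply: hP; split; rewrite /= /ball /= distrC.
  by apply: le_lt_trans h1 _; rewrite ltr_pdivrMr// ltr_pMr// ltr1n.
by apply: le_lt_trans h2 _; rewrite ltr_pdivrMr// ltr_pMr// ltr1n.
Qed.

Section Sequences.
Variables (F : R -> R -> R) (x0 t0 : R) (k m : nat -> int).
Hypothesis FC : C1_2 F.
Hypothesis km_evn : forall n, evn (k n) (m n).
Hypothesis mx : (fun n => xgrid (M n) (m n)) @ \oo --> x0.
Hypothesis kt : (fun n => tz (M n) (k n)) @ \oo --> t0.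

Lemma shift_x (j : int) : (fun n => xgrid (M n) (m n + j)) @ \oo --> x0.
Proof.
rewrite (_ : (fun n => _) = (fun n => xgrid (M n) (m n) + j%:~R * dx n)).
  rewrite -[x in _ --> x]addr0; apply: cvgD => //.
  by rewrite -(mulr0 (j%:~R : R)); apply: cvgMr.
by apply/funext => n; rewrite xgD.
Qed.

Lemma shift_t : (fun n => tz (M n) (k n + 1)) @ \oo --> t0.
Proof.
rewrite (_ : (fun n => _) = (fun n => tz (M n) (k n) + dt n)).
  by rewrite -[x in _ --> x]addr0; apply: cvgD.
by apply/funext => n; rewrite /tz intrD mulrDl mul1r.
Qed.

Let Fp n j := F (xgrid (M n) (m n + j)) (tz (M n) (k n)).

Definition Fslope n : R := (Fp n 1 - Fp n (- 1)) / (2 * dx n).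
Definition Ftime n : R := (F (xgrid (M n) (m n)) (tz (M n) (k n + 1)) - (Fp n 1 + Fp n (- 1)) / 2) / dt n.

Lemma slope_cvg (i j : int) (s : nat -> R) : j - i = 2 -> s @ \oo --> t0 ->
  (fun n => (F (xgrid (M n) (m n + j)) (s n) - F (xgrid (M n) (m n + i)) (s n)) / (2 * dx n)) @ \oo
   --> dx2 F x0 t0.
Proof.
move=> ji st.
have [Q Qc QE] := diffquot_x FC (shift_x i) (shift_x j) st.
rewrite (_ : (fun n => _) = Q)//; apply/funext => n; rewrite QE !xgD.
rewrite (_ : _ - _ = (j - i)%:~R * dx n); last by rewrite intrB; ring.
by rewrite ji -mulrA divff ?mulr1// mulf_neq0// lt0r_neq0.
Qed.

Lemma Fslope_cvg : Fslope @ \oo --> dx2 F x0 t0.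
Proof. exact: slope_cvg. Qed.

Lemma Ftime_cvg : Ftime @ \oo --> dt2 F x0 t0.
Proof.
have [Q Qc QE] := diffquot_t FC kt shift_t mx.
have [Q1 Q1c Q1E] := diffquot_x FC mx (shift_x 1) kt.
have [Q2 Q2c Q2E] := diffquot_x FC mx (shift_x (- 1)) kt.
pose D n := Q2 n - Q1 n.
have Dc : D @ \oo --> (0 : R) by rewrite -(subrr (dx2 F x0 t0)); exact: cvgB.
have E n : Ftime n = Q n + dx n / (2 * dt n) * D n.
  rewrite /Ftime /Fp.
  have e1 := QE n; have e2 := Q1E n; have e3 := Q2E n.
  rewrite !xgD in e2 e3 *; rewrite /tz intrD mulrDl mul1r -/(tz _ _) addrAC subrr add0r in e1.
  rewrite addrAC subrr add0r in e2; rewrite addrAC subrr add0r in e3.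
  rewrite [_ * dx n]mul1r in e2 *; rewrite mulN1r in e3 *.
  have -> : tz (M n) (k n + 1) = tz (M n) (k n) + dt n by rewrite /tz intrD mulrDl mul1r.
  set A := F _ (tz (M n) (k n)) in e1 e2 e3.
  have a1 : F (xgrid (M n) (m n)) (tz (M n) (k n) + dt n) = A + Q n * dt n by lra.
  have a2 : F (xgrid (M n) (m n) + dx n) (tz (M n) (k n)) = A + Q1 n * dx n by lra.
  have a3 : F (xgrid (M n) (m n) - dx n) (tz (M n) (k n)) = A - Q2 n * dx n by lra.
  rewrite a1 a2 a3 /D; field; exact: lt0r_neq0.
rewrite (_ : Ftime = fun n => Q n + dx n / (2 * dt n) * D n); last exact/funext.
rewrite -[x in _ --> x]addr0; apply: cvgD; first exact: Qc.
apply/cvgrPdist_le => ep ep0.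
have := Dc => /cvgrPdist_le /(_ (2 * l0 * ep)); rewrite !mulr_gt0// => /(_ isT).
apply: filterS => n; rewrite !sub0r !normrN normrM => hD.
have d1 := dx_dt (psV n).
have r0 : 0 <= dx n / (2 * dt n) by rewrite divr_ge0 ?mulr_ge0// ltW.
rewrite (ger0_norm r0).
apply: le_trans (ler_wpM2l r0 hD) _.
rewrite mulrAC ler_pdivrMr ?mulr_gt0//.
by have := ler_wpM2l (ltW ep0) d1; lra.
Qed.

End Sequences.

(** The slope of the test function is in the CFL range in the limit: maximality
    over the neighbours at distance two in the same time layer compares it with
    slopes of the scheme, up to d / dx, which tends to 0. *)
Lemma sub_limit f (x0 t0 : R) : C1_2 f ->
  (\forall z \near ((x0, t0) : R * R), v z.1 z.2 - f z.1 z.2 <= v x0 t0 - f x0 t0) ->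
  dt2 f x0 t0 + H x0 t0 (c + dx2 f x0 t0) <= hl.
Proof.
move=> fC /nbhs_box[rho rho0 vf].
pose F x t := f x t + quad 1 x0 t0 x t.
have FC : C1_2 F := C1_2D fC (C1_2_quad 1 x0 t0).
have Fx : dx2 F x0 t0 = dx2 f x0 t0.
  by have := dx2D x0 t0 fC (C1_2_quad 1 x0 t0); rewrite dx2_quad subrr mulr0 addr0.
have Ft : dt2 F x0 t0 = dt2 f x0 t0.
  by have := dt2D x0 t0 fC (C1_2_quad 1 x0 t0); rewrite dt2_quad subrr mulr0 addr0.
pose w x t := v x t - F x t.
pose W n k m := V n k m - F (xgrid (M n) m) (tz (M n) k).
have wC : C0_2 w.
  by move=> z; apply: cvgB; [exact: vC|case: FC => _ + _ _; apply].
have We n k m : ~~ evn k m -> `|W n k m - w (xgrid (M n) m) (tz (M n) k)| <= e n.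
  move=> om; rewrite /W /w -(vinterp_node (M n) (V n) om).
  by rewrite opprB addrA subrK; exact: Ve.
have w_max x t : `|x - x0| <= rho -> `|t - t0| <= rho ->
    w x t <= w x0 t0 - ((x - x0) ^+ 2 + (t - t0) ^+ 2).
  move=> h1 h2; have := vf _ _ h1 h2; rewrite /w /F /quad /= !subrr; lra.
have [k [m [km_evn mx kt ext]]] := lattice_max rho0 dx_cvg dt_cvg e_cvg wC We w_max.
have FS := Fslope_cvg FC mx kt; have FT := Ftime_cvg FC mx kt.
rewrite Fx in FS; rewrite Ft in FT.
set p0 := dx2 f x0 t0 in FS *.
pose a n := slope (M n) (V n (k n)) (m n).
pose b n := Fslope F k m n.
pose d n : R := dt n ^+ 2.
have kt1 := shift_t kt.
have HpC : C0_3 (dp3 H) by case: H_C2 => [[]].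
have HC : C0_3 H by case: H_C2 => [[]].
have cb : (fun n => c + b n) @ \oo --> c + p0 by exact: (cvgD (cvg_cst c) FS).
(* d = dt ^ 2, and dt <= l1 dx *)
have d_dx : (fun n => d n / (2 * dx n)) @ \oo --> (0 : R).
  apply/cvgrPdist_le => ep ep0.
  have := dt_cvg => /cvgrPdist_le /(_ (2 * ep / l1)); rewrite divr_gt0 ?mulr_gt0// => /(_ isT).
  apply: filterS => n; rewrite !sub0r !normrN gtr0_norm// => hd.
  rewrite ger0_norm; last by rewrite divr_ge0 ?sqr_ge0// mulr_ge0// ltW.
  rewrite /d ler_pdivrMr ?mulr_gt0//.
  have d1 := dt_dx (psV n).
  rewrite ler_pdivlMr// in hd; rewrite expr2.
  have := ler_wpM2l (ltW (dtp n)) d1; have := ler_wpM2r (ltW (dxp n)) hd; lra.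
have lowerq : - l1^-1 <= dp3 H x0 t0 (c + p0).
  have S1 := slope_cvg FC mx (i := 0) (j := 2) erefl kt1.
  rewrite Fx -/p0 in S1.
  have lim : (fun n => dp3 H (xgrid (M n) (m n + 1)) (tz (M n) (k n + 1))
     (c + ((F (xgrid (M n) (m n + 2)) (tz (M n) (k n + 1)) - F (xgrid (M n) (m n + 0)) (tz (M n) (k n + 1))) / (2 * dx n)
       + d n / (2 * dx n)))) @ \oo --> dp3 H x0 t0 (c + (p0 + 0)).
    apply: C0_3_cvg => //; first exact: (shift_x mx).
    by apply: cvgD; [exact: cvg_cst|exact: cvgD].
  rewrite addr0 in lim; rewrite -(cvg_lim _ lim)//; apply: limr_ge; first by apply/cvg_ex; exists (dp3 H x0 t0 (c + p0)).
  near=> n.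
  have en : evn (k n + 1) (m n + 1) by rewrite !evnE km_evn.
  have := ps_cfl (psV n) en; rewrite ler_norml => /andP[h1 _].
  apply: le_trans h1 _; apply: (Hp_le H_C2 H_pp); rewrite lerD2l.
  have ex : W n (k n + 1) (m n + 2) <= W n (k n + 1) (m n) + d n.
    near: n; move: ext; apply: filterS => n; apply; rewrite ?evnE ?km_evn//; last by rewrite subrr.
    by rewrite addrAC subrr.
  rewrite addr0 /slope intD11 addrK -mulrDl ler_pM2r ?invr_gt0 ?mulr_gt0//.
  by move: ex; rewrite /W; lra.
have upperq : dp3 H x0 t0 (c + p0) <= l1^-1.
  have S1 := slope_cvg FC mx (i := - 2) (j := 0) erefl kt1.
  rewrite Fx -/p0 in S1.
  have lim : (fun n => dp3 H (xgrid (M n) (m n - 1)) (tz (M n) (k n + 1))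
     (c + ((F (xgrid (M n) (m n + 0)) (tz (M n) (k n + 1)) - F (xgrid (M n) (m n - 2)) (tz (M n) (k n + 1))) / (2 * dx n)
       - d n / (2 * dx n)))) @ \oo --> dp3 H x0 t0 (c + (p0 - 0)).
    apply: C0_3_cvg => //; first exact: (shift_x mx).
    by apply: cvgD; [exact: cvg_cst|exact: cvgB].
  rewrite subr0 in lim; rewrite -(cvg_lim _ lim)//; apply: limr_le; first by apply/cvg_ex; exists (dp3 H x0 t0 (c + p0)).
  near=> n.
  have en : evn (k n + 1) (m n - 1) by rewrite !evnE km_evn.
  have := ps_cfl (psV n) en; rewrite ler_norml => /andP[_ h1].
  apply: (le_trans _ h1); apply: (Hp_le H_C2 H_pp); rewrite lerD2l.
  have ex : W n (k n + 1) (m n - 2) <= W n (k n + 1) (m n) + d n.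
    near: n; move: ext; apply: filterS => n; apply; rewrite ?evnE ?km_evn//; last by rewrite subrr.
    by rewrite addrAC subrr add0r normrN.
  rewrite addr0 /slope intB11 subrK -mulrBl ler_pM2r ?invr_gt0 ?mulr_gt0//.
  by move: ex; rewrite /W; lra.
set q0 := dp3 H x0 t0 (c + p0) in lowerq upperq.
pose q n := dp3 H (xgrid (M n) (m n)) (tz (M n) (k n)) (c + b n).
have qc : q @ \oo --> q0 by exact: C0_3_cvg.
pose om n := `|q n - q0|.
have omc : om @ \oo --> (0 : R).
  by rewrite -(normr0 R) -(subrr q0); apply: cvg_norm; exact: (cvgB qc (cvg_cst q0)).
have qle n : `|q n| <= l1^-1 + om n.
  rewrite -[q n](subrK q0) addrC (le_trans (ler_normD _ _))// lerD2r.
  by rewrite ler_norml lowerq upperq.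
pose X n := Ftime F k m n + H (xgrid (M n) (m n)) (tz (M n) (k n)) (c + b n) - h n.
have Xc : X @ \oo --> dt2 f x0 t0 + H x0 t0 (c + p0) - hl.
  apply: cvgB; last exact: h_cvg.
  by apply: cvgD; [exact: FT|exact: (C0_3_cvg HC mx kt cb)].
pose Y n := dt n + om n * (`|b n| + B).
have Yc : Y @ \oo --> 0 + 0 * (`|p0| + B).
  exact: (cvgD dt_cvg (cvgM omc (cvgD (cvg_norm FS) (cvg_cst B)))).
rewrite mul0r addr0 in Yc.
suff : dt2 f x0 t0 + H x0 t0 (c + p0) - hl <= 0 by lra.
apply: (ler_cvg_to Xc Yc).
near=> n.
have exp : W n (k n) (m n + 1) <= W n (k n + 1) (m n) + d n.
  near: n; move: ext; apply: filterS => n; apply; rewrite ?evnE ?km_evn//.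
    by rewrite addrAC subrr.
  by rewrite opprD addrA subrr add0r normrN.
have exm : W n (k n) (m n - 1) <= W n (k n + 1) (m n) + d n.
  near: n; move: ext; apply: filterS => n; apply; rewrite ?evnE ?km_evn//.
    by rewrite addrAC subrr add0r normrN.
  by rewrite opprD addrA subrr add0r normrN.
have r := ps_rec (psV n) (km_evn n).
have fl := H_convex H_C2 H_pp (xgrid (M n) (m n)) (tz (M n) (k n)) (c + b n) (c + a n).
set Hn := H (xgrid (M n) (m n)) (tz (M n) (k n)) in r fl.
pose A := W n (k n + 1) (m n).
pose dp := F (xgrid (M n) (m n + 1)) (tz (M n) (k n)) + A - V n (k n) (m n + 1).
pose dm := F (xgrid (M n) (m n - 1)) (tz (M n) (k n)) + A - V n (k n) (m n - 1).
have ba : (c + b n) - (c + a n) = (dp - dm) / (2 * dx n).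
  by rewrite /a /b /Fslope /slope /dp /dm; field; exact: lt0r_neq0.
have cv : Hn (c + b n) - Hn (c + a n) <= q n * ((c + b n) - (c + a n)).
  by move: fl; rewrite -/(q n) -lerN2 -mulrN !opprB.
have := discrete_sub (dxp n) (dtp n) (dt_dx (psV n)) l1_gt0 cv ba _ _ (qle n) (normr_ge0 _).
move=> /(_ (d n)); rewrite {1}/dp {1}/dm => /(_ _)/wrap[|].
  exact: excess_ge exp.
move=> /(_ _)/wrap[|]; first exact: excess_ge exm.
rewrite -/dp -/dm => key.
have eX : X n = Hn (c + b n) - Hn (c + a n) - (dp + dm) / (2 * dt n).
  rewrite /X -/Hn /Ftime /dp /dm /A /W r -/(a n); field; exact: lt0r_neq0.
rewrite eX; apply: le_trans key _; rewrite /Y.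
have -> : d n / dt n = dt n by rewrite /d expr2 mulfK// lt0r_neq0.
rewrite lerD2l; apply: ler_wpM2l; first exact: normr_ge0.
rewrite opprD addrACA subrr add0r.
apply: le_trans (ler_normB _ _) _; rewrite lerD2l; exact: VB.
Unshelve. all: by end_near.
Qed.

Lemma super_limit f (x0 t0 : R) : C1_2 f ->
  (\forall z \near ((x0, t0) : R * R), v x0 t0 - f x0 t0 <= v z.1 z.2 - f z.1 z.2) ->
  hl <= dt2 f x0 t0 + H x0 t0 (c + dx2 f x0 t0).
Proof.
move=> fC /nbhs_box[rho rho0 vf].
pose F x t := f x t + quad (- 1) x0 t0 x t.
have FC : C1_2 F := C1_2D fC (C1_2_quad (- 1) x0 t0).
have Fx : dx2 F x0 t0 = dx2 f x0 t0.
  by have := dx2D x0 t0 fC (C1_2_quad (- 1) x0 t0); rewrite dx2_quad subrr mulr0 addr0.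
have Ft : dt2 F x0 t0 = dt2 f x0 t0.
  by have := dt2D x0 t0 fC (C1_2_quad (- 1) x0 t0); rewrite dt2_quad subrr mulr0 addr0.
pose w x t := F x t - v x t.
pose W n k m := F (xgrid (M n) m) (tz (M n) k) - V n k m.
have wC : C0_2 w.
  by move=> z; apply: cvgB; [case: FC => _ + _ _; apply|exact: vC].
have We n k m : ~~ evn k m -> `|W n k m - w (xgrid (M n) m) (tz (M n) k)| <= e n.
  move=> om; rewrite /W /w -(vinterp_node (M n) (V n) om).
  set y := F _ _; set z := vinterp _ _ _ _; set u := v _ _.
  rewrite (_ : y - z - (y - u) = - (z - u)); last by ring.
  by rewrite normrN; exact: Ve.
have w_max x t : `|x - x0| <= rho -> `|t - t0| <= rho ->
    w x t <= w x0 t0 - ((x - x0) ^+ 2 + (t - t0) ^+ 2).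
  move=> h1 h2; have := vf _ _ h1 h2; rewrite /w /F /quad /= !subrr; lra.
have [k [m [km_evn mx kt ext]]] := lattice_max rho0 dx_cvg dt_cvg e_cvg wC We w_max.
have FS := Fslope_cvg FC mx kt; have FT := Ftime_cvg FC mx kt.
rewrite Fx in FS; rewrite Ft in FT.
set p0 := dx2 f x0 t0 in FS *.
pose a n := slope (M n) (V n (k n)) (m n).
pose b n := Fslope F k m n.
pose d n : R := dt n ^+ 2.
have HC : C0_3 H by case: H_C2 => [[]].
have cb : (fun n => c + b n) @ \oo --> c + p0 by exact: (cvgD (cvg_cst c) FS).
pose X n := Ftime F k m n + H (xgrid (M n) (m n)) (tz (M n) (k n)) (c + b n) - h n.
have Xc : X @ \oo --> dt2 f x0 t0 + H x0 t0 (c + p0) - hl.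
  apply: cvgB; last exact: h_cvg.
  by apply: cvgD; [exact: FT|exact: (C0_3_cvg HC mx kt cb)].
have Yc : (fun n => - dt n) @ \oo --> (0 : R).
  by rewrite -oppr0; exact: cvgN.
suff : 0 <= dt2 f x0 t0 + H x0 t0 (c + p0) - hl by lra.
apply: (ler_cvg_to Yc Xc).
near=> n.
have exp : W n (k n) (m n + 1) <= W n (k n + 1) (m n) + d n.
  near: n; move: ext; apply: filterS => n; apply; rewrite ?evnE ?km_evn//.
    by rewrite addrAC subrr.
  by rewrite opprD addrA subrr add0r normrN.
have exm : W n (k n) (m n - 1) <= W n (k n + 1) (m n) + d n.
  near: n; move: ext; apply: filterS => n; apply; rewrite ?evnE ?km_evn//.
    by rewrite addrAC subrr add0r normrN.
  by rewrite opprD addrA subrr add0r normrN.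
have r := ps_rec (psV n) (km_evn n).
have fl := H_convex H_C2 H_pp (xgrid (M n) (m n)) (tz (M n) (k n)) (c + a n) (c + b n).
have cfl := ps_cfl (psV n) (km_evn n).
set Hn := H (xgrid (M n) (m n)) (tz (M n) (k n)) in r fl.
pose A := - W n (k n + 1) (m n).
pose dp := F (xgrid (M n) (m n + 1)) (tz (M n) (k n)) + A - V n (k n) (m n + 1).
pose dm := F (xgrid (M n) (m n - 1)) (tz (M n) (k n)) + A - V n (k n) (m n - 1).
have ba : (c + b n) - (c + a n) = (dp - dm) / (2 * dx n).
  by rewrite /a /b /Fslope /slope /dp /dm; field; exact: lt0r_neq0.
have hp : dp <= d n := excess_le exp.
have hm : dm <= d n := excess_le exm.
have key := discrete_super (dxp n) (dtp n) (dt_dx (psV n)) l1_gt0 fl ba hp hm cfl.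
have eX : X n = Hn (c + b n) - Hn (c + a n) - (dp + dm) / (2 * dt n).
  rewrite /X -/Hn /Ftime /dp /dm /A /W r -/(a n); field; exact: lt0r_neq0.
rewrite eX; apply: le_trans key; rewrite lerN2.
by rewrite /d expr2 mulfK// lt0r_neq0.
Unshelve. all: by end_near.
Qed.

Lemma viscosity_limit : viscosity_solution H c hl v.
Proof.
by split => // f x t fC; split; [exact: sub_limit|exact: super_limit].
Qed.

End ViscosityLimit.

(** * Comparison and uniqueness of the effective Hamiltonian *)

Section Comparison.
Context {R : realType}.
Implicit Types v w : R -> R -> R.

Lemma Z2_frac v x t : Z2_periodic v -> v (frac x) (frac t) = v x t.
Proof.
move=> vP.
rewrite (@frac_periodic _ _ (fun y => v y (frac t))); last by move=> y; case: (vP y (frac t)).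
by rewrite (@frac_periodic _ _ (fun s => v x s))// => s; case: (vP x s).
Qed.

Lemma Z2_bounded v : Z2_periodic v -> C0_2 v -> exists B : R, forall x t, `|v x t| <= B.
Proof.
move=> vP vC.
have gP : per3 (fun x t (_ : R) => v x t) by move=> x t p; exact: vP.
have gC : C0_3 (fun x t (_ : R) => v x t).
  by move=> z; apply: (@cvg_comp _ _ _ (fun z : R * R * R => z.1) (fun w : R * R => v w.1 w.2));
    [exact: cvg_fst|exact: (vC z.1)].
have [C hC] := C0_3_bounded 0 gP gC.
by exists C => x t; apply: (hC x t 0); rewrite normr0.
Qed.

Definition lip2 (C : R) v := forall x t y s, `|v x t - v y s| <= C * (`|x - y| + `|t - s|).

Let Phi (v w : R -> R -> R) (a : R) (z : R * R * (R * R)) : R :=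
  v z.1.1 z.1.2 - w z.2.1 z.2.2 - a * ((z.1.1 - z.2.1) ^+ 2 + (z.1.2 - z.2.2) ^+ 2).

(** By periodicity (x, t) can be restricted to a unit square, and far from the
    diagonal the penalty exceeds the oscillation of v and w. *)
Lemma doubling_max v w (a : R) : 0 < a -> Z2_periodic v -> Z2_periodic w ->
  C0_2 v -> C0_2 w ->
  exists x t y s : R, forall x' t' y' s',
    v x' t' - w y' s' - a * ((x' - y') ^+ 2 + (t' - s') ^+ 2) <=
    v x t - w y s - a * ((x - y) ^+ 2 + (t - s) ^+ 2).
Proof.
move=> a0 vP wP vC wC.
have [Bv hBv] := Z2_bounded vP vC; have [Bw hBw] := Z2_bounded wP wC.
pose D := Bv + Bw.
have D0 : 0 <= D by rewrite addr_ge0// (le_trans _ (hBv 0 0), le_trans _ (hBw 0 0)).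
pose r := 1 + 2 * D / a.
have r1 : 1 <= r by rewrite lerDl divr_ge0// ?mulr_ge0// ltW.
have ar : 2 * D <= a * r ^+ 2.
  have e : a * r = a + 2 * D by rewrite /r mulrDr mulr1 mulrCA divff ?mulr1// lt0r_neq0.
  have : a * r <= a * r ^+ 2 by rewrite ler_pM2l// expr2 ler_peMr//; lra.
  lra.
pose K : set (R * R * (R * R)) := (`[0, 1] `*` `[0, 1]) `*` (`[- r - 1, r + 1] `*` `[- r - 1, r + 1]).
have cK : compact K by do 2 apply: compact_setX; apply: segment_compact.
have nK : K !=set0.
  by exists (0, 0, (0, 0)); split; split; rewrite /= in_itv /=; apply/andP; split; lra.
have cP : continuous (Phi v w a).
  move=> z; apply: cvgB.
    apply: cvgB.
      by apply: (@cvg_comp _ _ _ (fun z : R * R * (R * R) => z.1) (fun w : R * R => v w.1 w.2));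
        [exact: cvg_fst|exact: (vC z.1)].
    by apply: (@cvg_comp _ _ _ (fun z : R * R * (R * R) => z.2) (fun u : R * R => w u.1 u.2));
        [exact: cvg_snd|exact: (wC z.2)].
  have p11 : z'.1.1 @[z' --> z] --> z.1.1.
    by apply: (@cvg_comp _ _ _ (fun z : R * R * (R * R) => z.1) fst); exact: cvg_fst.
  have p12 : z'.1.2 @[z' --> z] --> z.1.2.
    by apply: (@cvg_comp _ _ _ (fun z : R * R * (R * R) => z.1) snd); [exact: cvg_fst|exact: cvg_snd].
  have p21 : z'.2.1 @[z' --> z] --> z.2.1.
    by apply: (@cvg_comp _ _ _ (fun z : R * R * (R * R) => z.2) fst); [exact: cvg_snd|exact: cvg_fst].
  have p22 : z'.2.2 @[z' --> z] --> z.2.2.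
    by apply: (@cvg_comp _ _ _ (fun z : R * R * (R * R) => z.2) snd); exact: cvg_snd.
  apply: cvgMr; apply: cvgD; under eq_fun do rewrite expr2; rewrite expr2.
    by apply: cvgM; apply: cvgB.
  by apply: cvgM; apply: cvgB.
have [z zK zmax] := compact_EVT_max nK cK (continuous_subspaceT cP).
exists z.1.1, z.1.2, z.2.1, z.2.2 => x t y s.
have [far|close] := leP (r ^+ 2) ((x - y) ^+ 2 + (t - s) ^+ 2).
  have h0 : Phi v w a (0, 0, (0, 0)) <= Phi v w a z.
    apply: zmax; rewrite inE; split; split; rewrite /= in_itv /=; apply/andP; split; clear -r1; lra.
  apply: le_trans h0; rewrite /Phi /= !subrr expr0n /= addr0 mulr0 subr0.
  have b1 := hBv x t; have b2 := hBw y s; have b3 := hBv 0 0; have b4 := hBw 0 0.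
  move: b1 b2 b3 b4; rewrite !ler_norml => /andP[? ?] /andP[? ?] /andP[? ?] /andP[? ?].
  have := ler_wpM2l (ltW a0) far; rewrite /D in ar; lra.
pose i := Num.floor x; pose j := Num.floor t.
have -> : v x t - w y s - a * ((x - y) ^+ 2 + (t - s) ^+ 2) =
   Phi v w a (frac x, frac t, (y - i%:~R, s - j%:~R)).
  rewrite /Phi /= Z2_frac//; congr (_ - _ - _ * (_ ^+ 2 + _ ^+ 2)); rewrite ?/frac -/i -/j; try ring.
  rewrite -!mulrNz.
  rewrite (@periodic_int _ _ (fun y => w y (s + (- j)%:~R))); last by move=> u; case: (wP u (s + (- j)%:~R)).
  by rewrite (@periodic_int _ _ (fun s => w y s))// => u; case: (wP y u).
apply: zmax; rewrite inE.
have sq (u : R) : u ^+ 2 < r ^+ 2 -> `|u| <= r.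
  by rewrite -[u ^+ 2](real_normK (num_real u)) ltr_sqr ?nnegrE ?normr_ge0//; [exact: ltW|lra].
have c1 : `|x - y| <= r by apply: sq; have := sqr_ge0 (t - s); lra.
have c2 : `|t - s| <= r by apply: sq; have := sqr_ge0 (x - y); lra.
have /andP[f1 f2] := frac_itv x; have /andP[g1 g2] := frac_itv t.
rewrite /frac -/i in f1 f2; rewrite /frac -/j in g1 g2.
move: c1 c2; rewrite !ler_norml => /andP[u1 u2] /andP[u3 u4].
by split; split; rewrite /= in_itv /= /frac -/i -/j; apply/andP; split;
  clear -f1 f2 g1 g2 u1 u2 u3 u4; lra.
Qed.

Variable H : R -> R -> R -> R.
Hypothesis H_per : per3 H.
Hypothesis H_C2 : C2_3 H.
Variable c : R.

Lemma near_all (P : R * R -> Prop) (z : R * R) : (forall z, P z) -> \forall z' \near z, P z'.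
Proof. by move=> h; near=> y; exact: h. Unshelve. all: by end_near. Qed.

(** Doubling of variables. One of the functions is Lipschitz, so at the maximum
    the penalty is controlled, the momentum p = 2 a (x - y) remains bounded as a
    grows, and the two values of H differ by O(1 / a). *)
Lemma comparison v w (h1 h2 C : R) : 0 <= C -> Z2_periodic v -> Z2_periodic w ->
  viscosity_solution H c h1 v -> viscosity_solution H c h2 w ->
  lip2 C v \/ lip2 C w -> h2 <= h1.
Proof.
move=> C0 vP wP [vC vs] [wC ws] lip.
have [CH0 hCH0] := H_lip H_per H_C2 (`|c| + 4 * C).
pose CH := `|CH0|.
have hCH : strip_lip H (`|c| + 4 * C) CH.
  move=> x t p y s q pP qP; apply: le_trans (hCH0 x t p y s q pP qP) _.
  by rewrite ler_wpM2r ?ler_norm// !addr_ge0.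
have main (a : R) : 0 < a -> h2 - h1 <= CH * (4 * C / a).
  move=> a0; have [x [t [y [s mx]]]] := doubling_max a0 vP wP vC wC.
  set X := x - y; set T := t - s.
  (* compare the maximum with a point of the diagonal *)
  have pen : a * (X ^+ 2 + T ^+ 2) <= C * (`|X| + `|T|).
    case: lip => [lv|lw].
      have m1 := mx y s y s; have := le_trans (ler_norm _) (lv x t y s).
      rewrite -/X -/T in m1 *; rewrite !subrr expr0n /= addr0 mulr0 in m1; lra.
    have m1 := mx x t x t; have := le_trans (ler_norm _) (lw x t y s).
    rewrite -/X -/T in m1 *; rewrite !subrr expr0n /= addr0 mulr0 in m1; lra.
  have sumb : a * (`|X| + `|T|) <= 2 * C.
    have [S0|S0] := leP (`|X| + `|T|) 0.
      have : a * (`|X| + `|T|) <= 0 by rewrite pmulr_rle0.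
      lra.
    rewrite -(ler_pM2r S0).
    have n1 := real_normK (num_real X); have n2 := real_normK (num_real T).
    have := sqr_ge0 (`|X| - `|T|).
    have : a * ((`|X| + `|T|) ^+ 2) <= a * (2 * (X ^+ 2 + T ^+ 2)).
      rewrite ler_pM2l// -n1 -n2; have := sqr_ge0 (`|X| - `|T|); lra.
    lra.
  have aX : 2 * a * `|X| <= 4 * C.
    have : 0 <= a * `|T| by rewrite mulr_ge0// ltW.
    lra.
  pose p := 2 * a * X.
  have pb : `|c + p| <= `|c| + 4 * C.
    apply: le_trans (ler_normD _ _) _; rewrite lerD2l /p normrM gtr0_norm//.
    by rewrite mulr_gt0.
  have := (vs (quad a y s) x t (C1_2_quad a y s)).1.
  move=> /(_ _)/wrap[|].
    apply: near_all => z; have := mx z.1 z.2 y s; rewrite /quad; lra.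
  rewrite dx2_quad dt2_quad -/X -/T -/p => sub.
  have := (ws (quad (- a) x t) y s (C1_2_quad (- a) x t)).2.
  move=> /(_ _)/wrap[|].
    apply: near_all => z; have := mx x t z.1 z.2; rewrite /quad.
    rewrite -[y - x]opprB -[s - t]opprB !sqrrN.
    rewrite -[z.1 - x]opprB -[z.2 - t]opprB !sqrrN; lra.
  rewrite dx2_quad dt2_quad.
  have -> : 2 * - a * (y - x) = p by rewrite /p /X; ring.
  have -> : 2 * - a * (s - t) = 2 * a * T by rewrite /T; ring.
  move=> super.
  have := le_trans (ler_norm _) (hCH y s (c + p) x t (c + p) pb pb).
  rewrite subrr normr0 addr0 [`|y - x|]distrC [`|s - t|]distrC -/X -/T => hh.
  have : CH * (`|X| + `|T|) <= CH * (4 * C / a).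
    rewrite ler_wpM2l ?normr_ge0// ler_pdivlMr// mulrC; lra.
  lra.
rewrite -subr_le0 leNgt; apply/negP => d0.
pose a := 8 * (CH * C + 1) / (h2 - h1).
have CC : 0 <= CH * C by rewrite mulr_ge0 ?normr_ge0.
have a0 : 0 < a by rewrite divr_gt0// mulr_gt0//; lra.
have := main a a0; rewrite mulrA ler_pdivlMr//.
by rewrite /a mulrCA divff ?lt0r_neq0// mulr1; lra.
Qed.

Lemma effective_hamiltonian_unique v (h C : R) : 0 <= C -> Z2_periodic v ->
  viscosity_solution H c h v -> lip2 C v -> effective_hamiltonian H c = h.
Proof.
move=> C0 vP vs lv; rewrite /effective_hamiltonian.
have [w [wP ws]] : [set h | exists v, Z2_periodic v /\ viscosity_solution H c h v]
    (get [set h | exists v, Z2_periodic v /\ viscosity_solution H c h v]).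
  by apply: (getI (x := h)); exists v.
apply/eqP; rewrite eq_le; apply/andP; split.
  by apply: (comparison C0 vP wP vs ws); left.
by apply: (comparison C0 wP vP ws vs); right.
Qed.

End Comparison.

(** * Measurability and one-sided derivatives *)

Section Measurability.
Context d (T : measurableType d) (R : realType).

Lemma measurable_countable_comp (I : countType) (q : T -> I) (phi : I -> R) :
  (forall i, measurable (q @^-1` [set i])) -> measurable_fun [set: T] (fun z => phi (q z)).
Proof.
move=> hq _ Y mY; rewrite setTI.
have -> : (fun z => phi (q z)) @^-1` Y = \bigcup_(i in phi @^-1` Y) (q @^-1` [set i]).
  by apply/seteqP; split => [z /= Yz|z [i Yi zi]]; [exists (q z)|rewrite /= zi].
rewrite bigcup_mkcond; apply: countable_bigcupT_measurable; first exact: countableP.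
by move=> i; case: ifPn => _ //; exact: measurable0.
Qed.

Lemma measurable_floor (a : T -> R) : measurable_fun [set: T] a ->
  forall i : int, measurable ((fun z => Num.floor (a z)) @^-1` [set i]).
Proof.
move=> ma i.
rewrite (_ : _ @^-1` _ = a @^-1` `[i%:~R, (i + 1)%:~R[).
  by rewrite -[X in measurable X]setTI; apply: ma => //; exact: measurable_itv.
apply/seteqP; split => z /=; rewrite in_itv /=.
  by move=> <-; exact: floor_itv.
by move=> h; apply: floor_def.
Qed.

Definition discr (n : nat) (y : R) : R := (Num.floor (n.+1%:R * y))%:~R / n.+1%:R.

Lemma discr_cvg (y : R) : (fun n => discr n y) @ \oo --> y.
Proof.
apply/cvgrPdist_le => ep ep0.
exists (Num.truncn ep^-1) => // n /= hn.
have n0 : 0 < n.+1%:R :> R by rewrite ltr0n.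
have /andP[] := floor_itv (n.+1%:R * y); rewrite intrD /discr.
set f := (Num.floor _)%:~R => h1 h2.
have en : ep^-1 <= n.+1%:R.
  by apply/ltW/(lt_le_trans (truncnS_gt _)); rewrite ler_nat.
have e1 : 1 <= ep * n.+1%:R by rewrite mulrC -ler_pdivrMr// mul1r.
have -> : y - f / n.+1%:R = (n.+1%:R * y - f) / n.+1%:R.
  by rewrite mulrBl mulrAC divff ?mul1r// lt0r_neq0.
rewrite normrM normfV (gtr0_norm n0) ler_pdivrMr//.
by rewrite ler_norml; apply/andP; split; lra.
Qed.

(** Rounding the arguments to multiples of 1 / (n + 1) leaves countably many
    values, and by continuity the rounded functions converge pointwise. *)
Lemma measurable_C0_3 (g : R -> R -> R -> R) (a b c : T -> R) : C0_3 g ->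
  measurable_fun [set: T] a -> measurable_fun [set: T] b -> measurable_fun [set: T] c ->
  measurable_fun [set: T] (fun z => g (a z) (b z) (c z)).
Proof.
move=> gC ma mb mc.
apply: (measurable_fun_cvg (h := fun n z => g (discr n (a z)) (discr n (b z)) (discr n (c z)))).
  move=> n; pose fl (y : T -> R) z := Num.floor (n.+1%:R * y z).
  have mfl y : measurable_fun [set: T] y -> forall i, measurable (fl y @^-1` [set i]).
    by move=> my; apply: measurable_floor; exact: measurable_funM.
  pose q z := (fl a z, fl b z, fl c z).
  apply: (@measurable_countable_comp _ q
    (fun i => g (i.1.1%:~R / n.+1%:R) (i.1.2%:~R / n.+1%:R) (i.2%:~R / n.+1%:R))).
  move=> [[i j] k].
  rewrite (_ : q @^-1` _ = fl a @^-1` [set i] `&` fl b @^-1` [set j] `&` fl c @^-1` [set k]).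
    by apply: measurableI; [apply: measurableI|]; exact: mfl.
  by apply/seteqP; split => z /=; [case=> <- <- <-|move=> [[<- <-] <-]].
move=> z _.
apply: (cvg_comp (fun n => (discr n (a z), discr n (b z), discr n (c z)))
   (fun z : R * R * R => g z.1.1 z.1.2 z.2)); last exact: (gC (a z, b z, c z)).
apply: (cvg_pair (G := nbhs (a z, b z)) (H := nbhs (c z))); last exact: discr_cvg.
by apply: (cvg_pair (G := nbhs (a z)) (H := nbhs (b z))); exact: discr_cvg.
Qed.

Lemma measurable_C0_2 (g : R -> R -> R) (a b : T -> R) : C0_2 g ->
  measurable_fun [set: T] a -> measurable_fun [set: T] b ->
  measurable_fun [set: T] (fun z => g (a z) (b z)).
Proof.
move=> gC ma mb.
apply: (@measurable_C0_3 (fun x t _ => g x t) a b a) => //.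
by move=> z; apply: (@cvg_comp _ _ _ (fun z : R * R * R => z.1) (fun w : R * R => g w.1 w.2));
    [exact: cvg_fst|exact: (gC z.1)].
Qed.

End Measurability.

Lemma inv_small {R : realType} (ep : R) : 0 < ep -> \forall n \near \oo, (n.+1%:R^-1 : R) <= ep.
Proof.
move=> ep0; exists (Num.truncn ep^-1) => // n /= hn.
rewrite -[ep]invrK lef_pV2 ?posrE ?invr_gt0 ?ltr0n//.
by apply/ltW/(lt_le_trans (truncnS_gt _)); rewrite ler_nat.
Qed.

Section Semiconcave.
Context {R : realType}.
Variables (g : R -> R) (E C : R).
Hypothesis E0 : 0 <= E.
Definition fwd_quot (g : R -> R) (h x : R) := (g (x + h) - g x) / h.
Definition bwd_quot (g : R -> R) (h x : R) := (g x - g (x - h)) / h.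

Hypothesis g_lip : forall x y, `|g x - g y| <= C * `|x - y|.
(* semiconcavity in terms of difference quotients, as it survives the limit *)
Hypothesis g_sc : forall x h h', 0 < h -> 0 < h' ->
  fwd_quot g h x - E * h <= bwd_quot g h' x + E * h'.

(** Semiconcavity at x + h', with the steps h - h' and h'. *)
Lemma fwd_quot_mono x h h' : 0 < h' -> h' <= h -> fwd_quot g h x - E * h <= fwd_quot g h' x - E * h'.
Proof.
move=> h0; rewrite le_eqVlt => /orP[/eqP->//|hh].
have d0 : 0 < h - h' by lra.
have h1 : 0 < h by lra.
have := g_sc (x + h') d0 h0.
rewrite /fwd_quot /bwd_quot addrK (_ : x + h' + (h - h') = x + h); last by ring.
set a := g (x + h); set b := g (x + h'); set c := g x => key.
have {}key : a - b <= (h - h') * ((b - c) / h' + E * h).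
  by rewrite mulrC -ler_pdivrMr//; lra.
have e1 : b - c = h' * ((b - c) / h') by rewrite mulrC divfK// lt0r_neq0.
set y := (b - c) / h' in key e1 *.
have : (a - c) / h <= y + E * (h - h').
  by rewrite ler_pdivrMr//; lra.
lra.
Qed.

Lemma bwd_quot_mono x h h' : 0 < h' -> h' <= h -> bwd_quot g h' x + E * h' <= bwd_quot g h x + E * h.
Proof.
move=> h0; rewrite le_eqVlt => /orP[/eqP->//|hh].
have d0 : 0 < h - h' by lra.
have h1 : 0 < h by lra.
have := g_sc (x - h') h0 d0.
rewrite /fwd_quot /bwd_quot subrK (_ : x - h' - (h - h') = x - h); last by ring.
set a := g (x - h); set b := g (x - h'); set c := g x => key.
have {}key : (h - h') * ((c - b) / h' - E * h) <= b - a.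
  by rewrite mulrC -ler_pdivlMr//; lra.
have e1 : c - b = h' * ((c - b) / h') by rewrite mulrC divfK// lt0r_neq0.
set y := (c - b) / h' in key e1 *.
have : y - E * (h - h') <= (c - a) / h.
  by rewrite ler_pdivlMr//; lra.
lra.
Qed.

Let s (n : nat) : R := n.+1%:R^-1.
Let s0 n : 0 < s n. Proof. by rewrite invr_gt0 ltr0n. Qed.

(** The one-sided derivatives exist by the monotonicity of the corrected
    quotients. As limits of sequences they depend measurably on parameters. *)
Definition rderiv (x : R) : R := limn (fun n => fwd_quot g (n.+1%:R^-1) x - E * n.+1%:R^-1).
Definition lderiv (x : R) : R := limn (fun n => bwd_quot g (n.+1%:R^-1) x + E * n.+1%:R^-1).

Lemma s_noninc n m : (n <= m)%N -> s m <= s n.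
Proof. by move=> nm; rewrite lef_pV2 ?posrE ?ltr0n// ler_nat. Qed.

Lemma rderiv_cvg x : (fun n => fwd_quot g (n.+1%:R^-1) x - E * n.+1%:R^-1) @ \oo --> rderiv x.
Proof.
apply: nondecreasing_is_cvgn.
  by move=> n m nm; apply: fwd_quot_mono => //; exact: s_noninc.
by exists (bwd_quot g 1 x + E * 1) => _ [n _ <-]; exact: g_sc.
Qed.

Lemma lderiv_cvg x : (fun n => bwd_quot g (n.+1%:R^-1) x + E * n.+1%:R^-1) @ \oo --> lderiv x.
Proof.
apply: nonincreasing_is_cvgn.
  by move=> n m nm; apply: bwd_quot_mono => //; exact: s_noninc.
by exists (fwd_quot g 1 x - E * 1) => _ [n _ <-]; exact: g_sc.
Qed.

Lemma fwd_quot_le_rderiv x h : 0 < h -> fwd_quot g h x - E * h <= rderiv x.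
Proof.
move=> h0; rewrite -(cvg_lim _ (@rderiv_cvg x))//; apply: limr_ge.
  by apply/cvg_ex; exists (rderiv x); exact: rderiv_cvg.
by have := inv_small h0; apply: filterS => n; exact: fwd_quot_mono.
Qed.

Lemma rderiv_le_bwd_quot x h : 0 < h -> rderiv x <= bwd_quot g h x + E * h.
Proof.
move=> h0; rewrite -(cvg_lim _ (@rderiv_cvg x))//; apply: limr_le.
  by apply/cvg_ex; exists (rderiv x); exact: rderiv_cvg.
by near=> n; exact: g_sc.
Unshelve. all: by end_near.
Qed.

Lemma lderiv_le_bwd_quot x h : 0 < h -> lderiv x <= bwd_quot g h x + E * h.
Proof.
move=> h0; rewrite -(cvg_lim _ (@lderiv_cvg x))//; apply: limr_le.
  by apply/cvg_ex; exists (lderiv x); exact: lderiv_cvg.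
by have := inv_small h0; apply: filterS => n; exact: bwd_quot_mono.
Qed.

Lemma fwd_quot_le_lderiv x h : 0 < h -> fwd_quot g h x - E * h <= lderiv x.
Proof.
move=> h0; rewrite -(cvg_lim _ (@lderiv_cvg x))//; apply: limr_ge.
  by apply/cvg_ex; exists (lderiv x); exact: lderiv_cvg.
by near=> n; exact: g_sc.
Unshelve. all: by end_near.
Qed.

Lemma fwd_quot_bound x h : 0 < h -> `|fwd_quot g h x| <= C.
Proof.
move=> h0; rewrite /fwd_quot normrM normfV (gtr0_norm h0) ler_pdivrMr//.
by apply: le_trans (g_lip _ _) _; rewrite addrAC subrr add0r gtr0_norm.
Qed.

Lemma bwd_quot_bound x h : 0 < h -> `|bwd_quot g h x| <= C.
Proof.
move=> h0; rewrite /bwd_quot normrM normfV (gtr0_norm h0) ler_pdivrMr//.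
by apply: le_trans (g_lip _ _) _; rewrite opprB addrCA subrr addr0 gtr0_norm.
Qed.

Lemma cst_le_lim (a b : R) : (forall h : R, 0 < h -> a <= b + E * h) -> a <= b.
Proof.
move=> h; rewrite leNgt; apply/negP => ba.
have := h ((a - b) / (2 * (E + 1))); rewrite divr_gt0 ?subr_gt0 ?mulr_gt0//; last by rewrite ltr_wpDl.
move=> /(_ isT).
have E1 : 0 < 2 * (E + 1) by rewrite mulr_gt0// ltr_wpDl.
rewrite mulrCA => ha; have : (a - b) * (E / (2 * (E + 1))) <= (a - b) * (1 / 2).
  rewrite ler_wpM2l ?subr_ge0 ?(ltW ba)// ler_pdivrMr//; lra.
lra.
Qed.

Lemma rderiv_bound x : `|rderiv x| <= C.
Proof.
rewrite ler_norml; apply/andP; split.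
  rewrite lerNl; apply: cst_le_lim => h h0.
  have := fwd_quot_le_rderiv x h0; have := fwd_quot_bound x h0.
  by rewrite ler_norml => /andP[]; lra.
apply: cst_le_lim => h h0.
have := rderiv_le_bwd_quot x h0; have := bwd_quot_bound x h0.
by rewrite ler_norml => /andP[]; lra.
Qed.

(** By monotonicity the quotients of small step lie between the quotient of one
    fixed step and the common value of the one-sided derivatives. *)
Lemma semiconcave_derivable x : lderiv x = rderiv x -> is_derive x (1 : R) g (rderiv x).
Proof.
move=> lr.
have cv : h^-1 *: (g (h + x) - g x) @[h --> (0 : R)^'] --> rderiv x.
  apply/cvgrPdist_le => ep ep0.
  pose C1 := E + 1.
  have C10 : 0 < C1 by rewrite ltr_wpDl.
  have c1 := @rderiv_cvg x; have c2 := @lderiv_cvg x.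
  have ep2 : 0 < ep / 2 by rewrite divr_gt0.
  move: c1 => /cvgrPdist_le /(_ _ ep2) [N1 _ hN1].
  move: c2 => /cvgrPdist_le /(_ _ ep2) [N2 _ hN2].
  pose n := maxn N1 N2.
  have r1 := hN1 n (leq_maxl _ _); have r2 := hN2 n (leq_maxr _ _).
  rewrite -/(s n) in r1 r2.
  pose del := Num.min (s n) (ep / (2 * C1)).
  have del0 : 0 < del by rewrite lt_min s0 divr_gt0// mulr_gt0.
  exists del => //= h /=; rewrite sub0r normrN => hd hn0.
  have hs : `|h| <= s n by apply: (le_trans (ltW hd)); rewrite ge_min lexx.
  have he : E * `|h| <= ep / 2.
    have : `|h| <= ep / (2 * C1) by apply: (le_trans (ltW hd)); rewrite ge_min lexx orbT.
    rewrite ler_pdivlMr ?mulr_gt0// /C1; have := normr_ge0 h; lra.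
  move: r1 r2; rewrite !ler_norml => /andP[a1 a2] /andP[b1 b2].
  rewrite /GRing.scale /=.
  have [hp|hneg|h0] := ltgtP 0 h; last by rewrite -h0 eqxx in hn0.
    rewrite (gtr0_norm hp) in hs he.
    have -> : h^-1 * (g (h + x) - g x) = fwd_quot g h x by rewrite /fwd_quot mulrC [h + x]addrC.
    have := mulr_ge0 E0 (ltW hp).
    have := fwd_quot_le_rderiv x hp; have := fwd_quot_mono x hp hs.
    by move=> *; apply/andP; split; lra.
  rewrite (ltr0_norm hneg) in hs he.
  have hp : 0 < - h by lra.
  have -> : h^-1 * (g (h + x) - g x) = bwd_quot g (- h) x.
    by rewrite /bwd_quot opprK [h + x]addrC invrN mulrN -mulNr opprB mulrC.
  rewrite -lr in a1 a2 *.
  have := mulr_ge0 E0 (ltW hp).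
  have := lderiv_le_bwd_quot x hp; have := bwd_quot_mono x hp hs.
  by move=> *; apply/andP; split; lra.
have eq : (fun h : R => h^-1 *: ((g \o shift x) (h *: (1 : R)) - g x)) = (fun h => h^-1 *: (g (h + x) - g x)).
  by apply/funext => h /=; rewrite /GRing.scale /= mulr1.
apply: DeriveDef.
  by rewrite /derivable eq; apply/cvg_ex; exists (rderiv x).
by rewrite /derive eq; exact: (cvg_lim _ cv).
Qed.

End Semiconcave.

(** * Integrals of difference quotients over a period *)

Section PeriodicIntegral.
Context {R : realType}.
Implicit Types (g w : R -> R).

Lemma lip_continuous g C : (forall x y, `|g x - g y| <= C * `|x - y|) -> continuous g.
Proof.
move=> gl x; apply/cvgrPdist_le => ep ep0.
have C1 : 0 < `|C| + 1 by rewrite ltr_wpDl.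
exists (ep / (`|C| + 1)); first by rewrite /= divr_gt0.
move=> y /= xy; apply: le_trans (gl x y) _.
move: xy; rewrite ltr_pdivlMr// => xy; have n0 := normr_ge0 (x - y).
have : C * `|x - y| <= `|C| * `|x - y| by apply: ler_wpM2r => //; exact: ler_norm.
lra.
Qed.

Lemma continuous_measurable_R g : continuous g -> measurable_fun [set: R] g.
Proof. exact: continuous_measurable_fun. Qed.

Lemma antiderivative g (a b : R) : continuous g -> 
  exists G, forall x, a < x < b -> is_derive x (1 : R) G (g x).
Proof.
move=> gc; exists (fun x => \int[@lebesgue_measure R]_(t in [set` `[a, x]]) g t) => x /andP[ax xb].
have gi : (@lebesgue_measure R).-integrable `[a, b] (EFin \o g).
  apply: continuous_compact_integrable; first exact: segment_compact.
  by apply: continuous_subspaceT => y; exact: gc.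
have [d1 d2] := continuous_FTC1_closed xb gi ax (gc x).
apply: DeriveDef; first exact: d1.
by rewrite -derive1E; exact: d2.
Qed.

Lemma is_derive_shift (G : R -> R) (x h l : R) :
  is_derive (x + h) (1 : R) G l -> is_derive x (1 : R) (fun y => G (y + h)) l.
Proof.
move=> dG.
have ds : is_derive x (1 : R) (fun y : R => y + h) 1.
  have := @is_deriveD R R R id (cst h) x 1 1 0 (is_derive_id _ _) (is_derive_cst _ _ _).
  by rewrite addr0.
by have := @is_derive1_comp R G (fun y => y + h) x l 1 dG ds; rewrite mulr1.
Qed.

Lemma is_derive_lin (a b x f' g' : R) (f g : R -> R) :
  is_derive x (1 : R) f f' -> is_derive x (1 : R) g g' ->
  is_derive x (1 : R) (fun y => a * f y + b * g y) (a * f' + b * g').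
Proof.
move=> df dg.
exact: (@is_deriveD R R R (a \*: f) (b \*: g) x 1 _ _ (@is_deriveZ R R R f a x 1 _ df) (@is_deriveZ R R R g b x 1 _ dg)).
Qed.

(** An antiderivative G of g increases by the same amount over every interval of
    length one, so its second difference is periodic; the latter, divided by h,
    is an antiderivative of the difference of the quotients. *)
Lemma integral_bwd_quot_fwd_quot g (a h k : R) : continuous g -> periodic g 1 -> 0 < h <= 1 ->
  (\int[@mu1 R]_(x in `[a, (a + 1)%R]) (bwd_quot g h x - fwd_quot g h x + k)%:E = k%:E)%E.
Proof.
move=> gc gp /andP[h0 h1].
have [G dG] := antiderivative (a - 3) (a + 4) gc.
pose D x := (2 * G x - G (x - h) - G (x + h)) / h + k * x.
have dD x : a - 1 < x < a + 2 -> is_derive x (1 : R) D (bwd_quot g h x - fwd_quot g h x + k).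
  move=> /andP[x1 x2].
  have d0 : is_derive x (1:R) G (g x) by apply: dG; apply/andP; split; lra.
  have dm : is_derive (x - h) (1:R) G (g (x - h)) by apply: dG; apply/andP; split; lra.
  have dp : is_derive (x + h) (1:R) G (g (x + h)) by apply: dG; apply/andP; split; lra.
  have em := is_derive_shift dm; have ep := is_derive_shift dp.
  have l1 := is_derive_lin (2 / h) (- h^-1) d0 em.
  have l2 := is_derive_lin (- h^-1) k ep (@is_derive_id R R x 1).
  have l3 := is_derive_lin 1 1 l1 l2.
  have -> : D = (fun y => 1 * (2 / h * G y + - h^-1 * G (y - h)) + 1 * (- h^-1 * G (y + h) + k * id y)).
    by apply/funext => y; rewrite /D /=; ring.
  rewrite [X in is_derive _ _ _ X](_ : _ =
    1 * (2 / h * g x + - h^-1 * g (x - h)) + 1 * (- h^-1 * g (x + h) + k * 1)) //.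
  by rewrite /bwd_quot /fwd_quot; ring.
have ca y : a - 1 < y < a + 2 -> D @ y --> D y.
  by move=> /dD [dy _]; apply: differentiable_continuous; apply/derivable1_diffP.
rewrite (@continuous_FTC2 R (fun x => bwd_quot g h x - fwd_quot g h x + k) D); last first.
- move=> x; rewrite in_itv /= => /andP[x1 x2].
  by rewrite derive1E; apply: (@derive_val _ _ _ _ _ _ _ (dD x _)); apply/andP; split; lra.
- split.
  + move=> x; rewrite in_itv /= => /andP[x1 x2].
    by apply: (@ex_derive _ _ _ _ _ _ _ (dD x _)); apply/andP; split; lra.
  + by apply: cvg_at_right_filter; apply: ca; apply/andP; split; lra.
  + by apply: cvg_at_left_filter; apply: ca; apply/andP; split; lra.
- apply: continuous_subspaceT => x.
  have c1 : {for x, continuous (fun y => g (y - h))}.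
    apply: (@continuous_comp _ _ _ (fun y : R => y - h) g); last exact: gc.
    by apply: cvgB; [exact: cvg_id|exact: cvg_cst].
  have c2 : {for x, continuous (fun y => g (y + h))}.
    apply: (@continuous_comp _ _ _ (fun y : R => y + h) g); last exact: gc.
    by apply: cvgD; [exact: cvg_id|exact: cvg_cst].
  apply: cvgD; last exact: cvg_cst.
  by apply: cvgB; apply: cvgMl; apply: cvgB; [exact: gc|exact: c1|exact: c2|exact: gc].
- lra.
have cst1 x : a - 2 < x < a + 3 -> G (x + 1) - G x = G (a + 1) - G a.
  move=> /andP[x1 x2].
  have dd y : a - 3 < y < a + 3 -> is_derive y (1:R) (fun y => G (y + 1) - G y) 0.
    move=> /andP[y1 y2].
    have d0 : is_derive y (1:R) G (g y) by apply: dG; apply/andP; split; lra.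
    have dp : is_derive (y + 1) (1:R) G (g (y + 1)) by apply: dG; apply/andP; split; lra.
    have l1 := is_derive_lin 1 (-1) (is_derive_shift dp) d0.
    rewrite gp in l1; have -> : (fun y => G (y + 1) - G y) = (fun y => 1 * G (y + 1) + -1 * G y).
      by apply/funext => w; ring.
    by rewrite [X in is_derive _ _ _ X](_ : _ = 1 * g y + -1 * g y) //; ring.
  have main y z : a - 3 < y -> y < z -> z < a + 3 -> G (z + 1) - G z = G (y + 1) - G y.
    move=> y1 yz z1.
    have [||c _] := @MVT R (fun y => G (y + 1) - G y) (fun=> 0) y z yz.
    - by move=> w; rewrite in_itv /= => /andP[w1 w2]; apply: dd; apply/andP; split; lra.
    - apply: derivable_within_continuous => w; rewrite in_itv /= => /andP[w1 w2].
      by apply: (@ex_derive _ _ _ _ _ _ _ (dd w _)); apply/andP; split; lra.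
    by rewrite mul0r => /eqP; rewrite subr_eq0 => /eqP.
  have [xa|xa|->//] := ltgtP x a.
    by symmetry; apply: main => //; lra.
  by apply: main => //; lra.
rewrite -EFinB /D; congr (_%:E).
have e1 : G (a - h + 1) - G (a - h) = G (a + 1) - G a by apply: cst1; apply/andP; split; lra.
have e2 : G (a + h + 1) - G (a + h) = G (a + 1) - G a by apply: cst1; apply/andP; split; lra.
have q1 : a + 1 - h = a - h + 1 by ring.
have q2 : a + 1 + h = a + h + 1 by ring.
rewrite q1 q2; clear q1 q2 cst1 ca dD D dG gc gp.
move: (G (a - h + 1)) (G (a - h)) (G (a + 1)) (G a) (G (a + h + 1)) (G (a + h)) e1 e2 => y1 y2 y3 y4 y5 y6 e1 e2.
have -> : y1 = y2 + (y3 - y4) by rewrite -e1; ring.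
have -> : y5 = y6 + (y3 - y4) by rewrite -e2; ring.
ring.
Qed.

(** Two functions in the same gap differ by at most its width, which has
    integral 2 k although its first part need not be small pointwise. *)
Lemma L1_sandwich g (a h k : R) (w1 w2 : R -> R) : continuous g -> periodic g 1 -> 0 < h <= 1 ->
  measurable_fun [set: R] w1 -> measurable_fun [set: R] w2 ->
  (forall x, fwd_quot g h x - k <= w1 x <= bwd_quot g h x + k) ->
  (forall x, fwd_quot g h x - k <= w2 x <= bwd_quot g h x + k) ->
  (\int[@mu1 R]_(x in `[a, (a + 1)%R]) `|w1 x - w2 x|%:E <= (2 * k)%:E)%E.
Proof.
move=> gc gp h01 m1 m2 b1 b2; rewrite -(integral_bwd_quot_fwd_quot a (2 * k) gc gp h01).
have mQ : measurable_fun [set: R] (fun x => bwd_quot g h x - fwd_quot g h x + 2 * k).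
  have mg := continuous_measurable_R gc.
  have msh (b : R) : measurable_fun [set: R] (fun x => g (x + b)).
    by apply: continuous_measurable_R => x;
       apply: (@continuous_comp _ _ _ (fun y : R => y + b) g); [
       apply: cvgD; [exact: cvg_id|exact: cvg_cst]|exact: gc].
  apply: measurable_funD; last exact: measurable_cst.
  by apply: measurable_funB; apply: measurable_funM; try exact: measurable_cst;
    apply: measurable_funB => //; exact: msh.
apply: ge0_le_integral.
- exact: measurable_itv.
- by move=> x _; rewrite lee_fin.
- apply: (measurable_funS measurableT) => //; apply/measurable_EFinP.
  by apply: measurableT_comp => //; exact: measurable_funB.
- by apply: (measurable_funS measurableT) => //; apply/measurable_EFinP.
move=> x _; rewrite lee_fin ler_norml; have /andP[] := b1 x; have /andP[] := b2 x.
by move=> *; apply/andP; split; lra.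
Qed.

End PeriodicIntegral.

(** * The space derivative of a semiconcave function *)

Section OneDim.
Context {R : realType}.
Variables (g : R -> R) (E C : R).
Hypothesis E0 : 0 <= E.
Hypothesis g_lip : forall x y, `|g x - g y| <= C * `|x - y|.
Hypothesis g_sc : forall x h h', 0 < h -> 0 < h' ->
  fwd_quot g h x - E * h <= bwd_quot g h' x + E * h'.

(** For a fixed small step h both ends of the gap are close to the common
    one-sided derivative; then j is sent to infinity. *)
Lemma cvg_between (w : nat -> R) (k : R -> nat -> R) x : lderiv g E x = rderiv g E x ->
  (forall h j, 0 < h -> fwd_quot g h x - k h j <= w j <= bwd_quot g h x + k h j) ->
  (forall h, 0 < h -> k h j @[j --> \oo] --> E * h) ->
  w @ \oo --> rderiv g E x.
Proof.
move=> lr hw hk; apply/cvgrPdist_le => ep ep0.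
have ep3 : 0 < ep / 2 by rewrite divr_gt0.
have /cvgrPdist_le /(_ _ ep3)[N1 _ h1] := rderiv_cvg g_sc (x := x).
have /cvgrPdist_le /(_ _ ep3)[N2 _ h2] := lderiv_cvg g_sc (x := x).
pose n := maxn N1 N2.
have r1 := h1 n (leq_maxl _ _); have r2 := h2 n (leq_maxr _ _).
rewrite lr in r2; have s0 : 0 < n.+1%:R^-1 :> R by rewrite invr_gt0 ltr0n.
move: r1 r2; set s := n.+1%:R^-1 => r1 r2.
have /cvgrPdist_le /(_ _ ep3) := hk _ s0; apply: filterS => j.
have := hw _ j s0; rewrite -/s; move: r1 r2; rewrite !ler_norml.
move: (rderiv g E x) (fwd_quot g s x) (bwd_quot g s x) (k s j) (w j) (E * s) => a b c d e f.
by move=> /andP[? ?] /andP[? ?] /andP[? ?] /andP[? ?]; apply/andP; split; lra.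
Qed.

End OneDim.

Section Ubar.
Context {R : realType}.
Variables (v : R -> R -> R) (E C : R).
Hypothesis E0 : 0 <= E.
Hypothesis C0 : 0 <= C.
Hypothesis v_per : Z2_periodic v.
Hypothesis v_lip : forall x t y s, `|v x t - v y s| <= C * (`|x - y| + `|t - s|).
Hypothesis v_sc : forall t x h h', 0 < h -> 0 < h' ->
  fwd_quot (v ^~ t) h x - E * h <= bwd_quot (v ^~ t) h' x + E * h'.

(** The right derivative in space is a representative of v_x that is defined
    everywhere. *)
Definition ubar (x t : R) := rderiv (v ^~ t) E x.
Definition ubarl (x t : R) := lderiv (v ^~ t) E x.

Lemma vt_lip t x y : `|v x t - v y t| <= C * `|x - y|.
Proof. by have := v_lip x t y t; rewrite subrr normr0 addr0. Qed.

Lemma v_C0 : C0_2 v.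
Proof.
move=> [x t]; apply/cvgrPdist_le => ep ep0 /=.
have C1 : 0 < 2 * (C + 1) by rewrite mulr_gt0// ltr_wpDl.
have d0 : 0 < ep / (2 * (C + 1)) by rewrite divr_gt0.
exists (ball x (ep / (2 * (C + 1))), ball t (ep / (2 * (C + 1)))).
  by split => /=; exact: nbhsx_ballx.
move=> [y s] /= [xy ts]; apply: le_trans (v_lip _ _ _ _) _.
have {}xy : `|x - y| * (2 * (C + 1)) <= ep by apply: ltW; rewrite -ltr_pdivlMr.
have {}ts : `|t - s| * (2 * (C + 1)) <= ep by apply: ltW; rewrite -ltr_pdivlMr.
have := normr_ge0 (x - y); have := normr_ge0 (t - s); lra.
Qed.

Lemma ubar_per : Z2_periodic ubar.
Proof.
move=> x t; split; rewrite /ubar /rderiv; congr (limn _); apply/funext => n; rewrite /fwd_quot /=.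
  by rewrite addrAC !(v_per _ t).1.
by rewrite !(v_per _ t).2.
Qed.

Lemma ubar_bound x t : `|ubar x t| <= C.
Proof. exact: (rderiv_bound E0 (vt_lip t) (v_sc t)). Qed.

Lemma measurable_ubar d (T : measurableType d) (a b : T -> R) :
  measurable_fun [set: T] a -> measurable_fun [set: T] b ->
  measurable_fun [set: T] (fun z => ubar (a z) (b z)) /\
  measurable_fun [set: T] (fun z => ubarl (a z) (b z)).
Proof.
move=> ma mb.
have mv := fun a b => @measurable_C0_2 _ T R v a b v_C0.
have mab (h : R) : measurable_fun [set: T] (fun z => a z + h).
  by apply: measurable_funD => //; exact: measurable_cst.
split.
  apply: (measurable_fun_cvg (h := fun n z => fwd_quot (v ^~ (b z)) n.+1%:R^-1 (a z) - E * n.+1%:R^-1)); last first.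
    by move=> z _; exact: (rderiv_cvg (v_sc (b z))).
  move=> n; apply: measurable_funB; last exact: measurable_cst.
  apply: measurable_funM; last exact: measurable_cst.
  by apply: measurable_funB; apply: mv.
apply: (measurable_fun_cvg (h := fun n z => bwd_quot (v ^~ (b z)) n.+1%:R^-1 (a z) + E * n.+1%:R^-1)); last first.
  by move=> z _; exact: (lderiv_cvg (v_sc (b z))).
move=> n; apply: measurable_funD; last exact: measurable_cst.
apply: measurable_funM; last exact: measurable_cst.
by apply: measurable_funB; apply: mv.
Qed.

Lemma vt_per t : periodic (v ^~ t) 1.
Proof. by move=> x; exact: (v_per x t).1. Qed.

Lemma vt_cont t : continuous (v ^~ t).
Proof. exact: (lip_continuous (vt_lip t)). Qed.

Lemma measurable_ubar_t t : measurable_fun [set: R] (ubar ^~ t) /\ measurable_fun [set: R] (ubarl ^~ t).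
Proof. by apply: measurable_ubar; [exact: measurable_id|exact: measurable_cst]. Qed.

Lemma small_le0 (y : \bar R) : (0 <= y)%E -> (forall h : R, (0 < h <= 1)%R -> (y <= (2 * (E * h))%:E)%E) -> y = 0%E.
Proof.
move=> y0 hy; apply/eqP; rewrite eq_le y0 andbT; apply/lee_addgt0Pr => e e0.
rewrite add0e; pose h := Num.min 1 (e / (2 * E + 1)).
have E1 : 0 < 2 * E + 1 by rewrite ltr_wpDl// mulr_ge0.
have h0 : 0 < h by rewrite lt_min ltr01 divr_gt0.
have h1 : h <= 1 by rewrite ge_min lexx.
have h2 : h <= e / (2 * E + 1) by rewrite ge_min lexx orbT.
apply: (le_trans (hy h _)); first by rewrite h0.
by rewrite lee_fin; move: h2; rewrite ler_pdivlMr//; lra.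
Qed.

(** Both one-sided derivatives lie in the gap of [L1_sandwich] for every h with
    k = E h, so their L1 distance over a period vanishes. *)
Lemma ubarl_ae t : {ae mu1, forall x : R, ubarl x t = ubar x t}.
Proof.
have [m1 m2] := measurable_ubar_t t.
have zero a : (\int[@mu1 R]_(x in `[a, (a + 1)%R]) `|ubarl x t - ubar x t|%:E = 0)%E.
  apply: small_le0; first by apply: integral_ge0 => x _; rewrite lee_fin.
  move=> h h01; have /andP[h0 _] := h01.
  apply: (@L1_sandwich R (v ^~ t) _ h) => //; [exact: vt_cont|exact: vt_per| |].
    by move=> x; rewrite (fwd_quot_le_lderiv (v_sc t))// (lderiv_le_bwd_quot (v_sc t)).
  by move=> x; rewrite (fwd_quot_le_rderiv (v_sc t))// (rderiv_le_bwd_quot (v_sc t)).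
have aez (i : int) : mu1.-negligible [set x | `[i%:~R, i%:~R + 1]%classic x /\ ubarl x t != ubar x t].
  have mi : measurable (`[i%:~R, (i%:~R + 1 : R)]%classic : set (measurableTypeR R)) by exact: measurable_itv.
  have mf : measurable_fun (`[i%:~R, (i%:~R + 1 : R)]%classic : set (measurableTypeR R)) (fun x => (ubarl x t - ubar x t)%:E).
    apply: (measurable_funS measurableT) => //; apply/measurable_EFinP; exact: measurable_funB.
  have := (ae_eq_integral_abs mu1 mi mf).1 (zero i%:~R).
  apply: negligibleS => x /= [ix nx]; apply/not_implyP; split => //.
  by move=> [] /eqP; rewrite subr_eq0; exact/negP.
pose F (n : nat) : set R := if unpickle n is Some i then [set x | `[i%:~R, i%:~R + 1]%classic x /\ ubarl x t != ubar x t] else set0.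
have : mu1.-negligible (\bigcup_n F n).
  apply: negligible_bigcup => n; rewrite /F; case: unpickle => [i|]; first exact: aez.
  exact: negligible_set0.
apply: negligibleS => x /= nx; exists (pickle (Num.floor x)); first exact: I.
rewrite /F pickleK /=; split; last by apply/eqP.
have := floor_itv x; rewrite in_itv /= intrD => /andP[-> /ltW ->] //.
Qed.

Lemma ubar_derive_ae t : {ae mu1, forall x : R, is_derive x (1 : R) (v ^~ t) (ubar x t)}.
Proof.
apply: negligibleS (ubarl_ae t) => x /= nd lr; apply: nd.
exact: (semiconcave_derivable E0 (v_sc t) lr).
Qed.

Lemma ubar_sandwich t x h : 0 < h -> fwd_quot (v ^~ t) h x - E * h <= ubar x t <= bwd_quot (v ^~ t) h x + E * h.
Proof. by move=> h0; rewrite (fwd_quot_le_rderiv (v_sc t))// (rderiv_le_bwd_quot (v_sc t)). Qed.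

(** The quotients of v at the two times differ by at most 2 C |s - t| / h, so
    both derivatives lie in a gap around the quotients at time t. *)
Lemma ubar_L1_le t s h : 0 < h <= 1 ->
  (\int[@mu1 R]_(x in `[0%R, 1%R]) `|ubar x s - ubar x t|%:E <= (2 * (E * h + 2 * (C * `|s - t|) / h))%:E)%E.
Proof.
move=> h01; have /andP[h0 _] := h01.
have -> : `[0%R, 1%R]%classic = `[0%R, (0 + 1)%R]%classic :> set R by rewrite add0r.
have nn : 0 <= 2 * (C * `|s - t|) / h by rewrite divr_ge0 ?mulr_ge0// ltW.
apply: (@L1_sandwich R (v ^~ t) _ h) => //; [exact: vt_cont|exact: vt_per
  |exact: (measurable_ubar_t s).1|exact: (measurable_ubar_t t).1| |].
  move=> x; have /andP[] := ubar_sandwich s x h0.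
  have q : forall y, `|v y s - v y t| <= C * `|s - t|.
    by move=> y; have := v_lip y s y t; rewrite subrr normr0 add0r.
  have cmp y z : `|(v y s - v z s) / h - (v y t - v z t) / h| <= 2 * (C * `|s - t|) / h.
    rewrite -mulrBl normrM normfV (gtr0_norm h0) ler_pM2r ?invr_gt0//.
    have := q y; have := q z; rewrite !ler_norml => /andP[? ?] /andP[? ?].
    by apply/andP; split; lra.
  move: (cmp (x + h) x) (cmp x (x - h)); rewrite !ler_norml /fwd_quot /bwd_quot.
  by move=> /andP[? ?] /andP[? ?] ? ?; apply/andP; split; lra.
by move=> x; have /andP[] := ubar_sandwich t x h0 => ? ?; apply/andP; split; lra.
Qed.

Lemma ubar_L1_cvg t :
  (\int[@mu1 R]_(x in `[0%R, 1%R]) `|ubar x s - ubar x t|%:E)%E @[s --> nbhs t] --> 0%E.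
Proof.
apply/fine_cvgP; split.
  apply: nearW => s; rewrite ge0_fin_numE; last by apply: integral_ge0 => x _; rewrite lee_fin.
  by apply: le_lt_trans (ubar_L1_le t s (h := 1) _) _; rewrite ?ltr01 ?lexx// ltry.
apply/cvgrPdist_le => ep ep0.
pose h := Num.min 1 (ep / (4 * (E + 1))).
have E1 : 0 < 4 * (E + 1) by rewrite mulr_gt0// ltr_wpDl.
have h0 : 0 < h by rewrite lt_min ltr01 divr_gt0.
have h1 : h <= 1 by rewrite ge_min lexx.
have h2 : h * (4 * (E + 1)) <= ep by rewrite -ler_pdivlMr// ge_min lexx orbT.
have C1 : 0 < 8 * (C + 1) by rewrite mulr_gt0// ltr_wpDl.
exists (ep * h / (8 * (C + 1))); first by rewrite /= divr_gt0// mulr_gt0.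
move=> s /=; rewrite ltr_pdivlMr// => ts; rewrite sub0r normrN /=.
have i0 : (0 <= \int[@mu1 R]_(x in `[0%R, 1%R]) `|ubar x s - ubar x t|%:E)%E.
  by apply: integral_ge0 => x _; rewrite lee_fin.
have hh : 0 < h <= 1 by rewrite h0.
have ile := ubar_L1_le t s hh.
rewrite ger0_norm; last exact: fine_ge0.
rewrite -lee_fin fineK; last by rewrite ge0_fin_numE//; apply: le_lt_trans ile _; rewrite ltry.
apply: le_trans ile _; rewrite lee_fin.
have : 2 * (C * `|s - t|) / h <= ep / 4.
  rewrite ler_pdivrMr// distrC; have := normr_ge0 (t - s); lra.
have := mulr_ge0 E0 (ltW h0); lra.
Qed.

Lemma ubar_normLinf t : (normLinf (ubar ^~ t) <= C%:E)%E.
Proof.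
rewrite /normLinf unlock; case: ifPn => _; last by rewrite lee_fin.
by apply/ess_supP; apply: aeW => x /=; rewrite lee_fin; exact: ubar_bound.
Qed.

Lemma ubar_joint : measurable_fun [set: measurableTypeR R * measurableTypeR R]
  (fun z : measurableTypeR R * measurableTypeR R => ubar z.1 z.2).
Proof. by apply: (measurable_ubar _ _).1; [exact: measurable_fst|exact: measurable_snd]. Qed.

Lemma ubarl_joint_ae : {ae (@lebesgue_measure R \x @lebesgue_measure R)%E,
  forall z : measurableTypeR R * measurableTypeR R, ubarl z.1 z.2 = ubar z.1 z.2}.
Proof.
pose f (z : measurableTypeR R * measurableTypeR R) := `|ubarl z.1 z.2 - ubar z.1 z.2|%:E.
have [m1 m2] := @measurable_ubar _ _ _ _ (@measurable_fst _ _ (measurableTypeR R) (measurableTypeR R)) (@measurable_snd _ _ (measurableTypeR R) (measurableTypeR R)).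
have mf : measurable_fun [set: measurableTypeR R * measurableTypeR R] (fun z : measurableTypeR R * measurableTypeR R => (ubarl z.1 z.2 - ubar z.1 z.2)%:E).
  by apply/measurable_EFinP; exact: measurable_funB.
have := (ae_eq_integral_abs (@lebesgue_measure R \x @lebesgue_measure R)%E measurableT mf).1 _.
move=> H; apply: filterS (H _) => [z /= /(_ I) [] /eqP|]; first by rewrite subr_eq0 => /eqP.
rewrite (@fubini_tonelli2 _ _ _ _ _ lebesgue_measure lebesgue_measure); last 2 first.
- exact: measurableT_comp.
- by move=> z; rewrite lee_fin.
apply: integral0_eq => t _.
have mt : measurable_fun [set: measurableTypeR R] (fun x => (ubarl x t - ubar x t)%:E).
  by apply/measurable_EFinP; apply: measurable_funB; [exact: (measurable_ubar_t t).2|exact: (measurable_ubar_t t).1].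
rewrite /fubini_G /=.
apply/(ae_eq_integral_abs lebesgue_measure measurableT mt).2.
by apply: negligibleS (ubarl_ae t) => x /= nd lr; apply: nd => _; rewrite lr subrr.
Qed.

End Ubar.

(** * Integration over the plane *)

Section Plane.
Context {R : realType}.
Local Notation T := (measurableTypeR R).
Local Notation leb := (@lebesgue_measure R).
Local Notation leb2 := (leb \x leb)%E.

Lemma measurable_translation (a : R) : measurable_fun [set: T] (fun x : T => (x + a : T)).
Proof. by apply: measurable_funD; [exact: measurable_id|exact: measurable_cst]. Qed.

(** Lebesgue measure is determined by its values on intervals. *)
Lemma lebesgue_translation (a : R) (A : set T) : measurable A ->
  pushforward leb (fun x : T => (x + a : T)) A = leb A.
Proof.
move=> mA; apply/esym/(@lebesgue_measure_unique R (pushforward leb (fun x : T => (x + a : T)))) => //.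
  exact: measurable_translation.
move=> mf _ [[x y] _ <-] /=.
have pE : (fun x : T => (x + a : T)) @^-1` `]x, y]%classic = `]x - a, y - a]%classic.
  by apply/seteqP; split => z /=; rewrite !in_itv /= => /andP[? ?]; apply/andP; split; lra.
transitivity (leb (`]x - a, y - a]%classic : set T)); last by rewrite -pE.
rewrite !lebesgue_measure_itv /= !lte_fin ltrD2r; case: ifP => // _.
by rewrite -!EFinB; congr (_%:E); ring.
Qed.

Definition shift2 (a b : R) (z : T * T) : T * T := (z.1 + a, z.2 + b).

Lemma measurable_shift2 a b : measurable_fun [set: T * T] (shift2 a b).
Proof.
apply/measurable_fun_pairP; split.
  by apply: (@measurableT_comp _ _ _ _ _ _ (fun x : T => (x + a : T))); [exact: measurable_translation|exact: measurable_fst].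
by apply: (@measurableT_comp _ _ _ _ _ _ (fun x : T => (x + b : T))); [exact: measurable_translation|exact: measurable_snd].
Qed.

Lemma lebesgue2_translation a b (X : set (T * T)) : measurable X ->
  pushforward leb2 (shift2 a b) X = leb2 X.
Proof.
move=> mX; apply/esym.
apply: (@product_measure_unique _ _ _ _ _ leb leb (pushforward leb2 (shift2 a b))) => //.
  exact: measurable_shift2.
move=> mf A B mA mB.
have mA' : measurable ((fun x : T => (x + a : T)) @^-1` A).
  by rewrite -[X in measurable X]setTI; apply: measurable_translation.
have mB' : measurable ((fun x : T => (x + b : T)) @^-1` B).
  by rewrite -[X in measurable X]setTI; apply: measurable_translation.
transitivity (leb2 (((fun x : T => (x + a : T)) @^-1` A) `*` ((fun x : T => (x + b : T)) @^-1` B))) => //.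
rewrite product_measure1E//; congr (_ * _)%E; exact: lebesgue_translation.
Qed.

Lemma integral_pushforward_shift2 a b (f : T * T -> \bar R) :
  (\int[pushforward leb2 (shift2 a b)]_z f z = \int[leb2]_z f z)%E.
Proof.
apply: eq_measure_integral; first exact: measurable_shift2.
by move=> mf A mA _; exact: lebesgue2_translation.
Qed.

Definition box (L : R) : set (T * T) := `[- L, L]%classic `*` `[- L, L]%classic.

Lemma measurable_box L : measurable (box L).
Proof. by apply: measurableX; exact: measurable_itv. Qed.

(** Bound and support in one inequality, which is what domination by an
    integrable function uses. *)
Definition boxed (B L : R) (F : T * T -> R) := forall z, `|F z| <= B * \1_(box L) z.

Lemma boxedP B L F : 0 <= B -> (forall z, `|F z| <= B) -> (forall z, ~ box L z -> F z = 0) -> boxed B L F.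
Proof.
move=> B0 FB F0 z; rewrite indicE; have [zb|/negP zb] := boolP (z \in box L); first by rewrite mulr1.
by rewrite mulr0 F0 ?normr0//; move=> bz; apply: zb; rewrite inE.
Qed.

Lemma boxed_integrable_dom B L : leb2.-integrable [set: T * T] (EFin \o (fun z => B * \1_(box L) z)).
Proof.
rewrite (_ : EFin \o _ = (EFin \o cst B) \_ (box L)); last first.
  apply/funext => z /=; rewrite patchE indicE; case: ifPn => _ /=; by rewrite ?mulr1 ?mulr0.
apply/(integrable_mkcond _ (measurable_box L)).1/measurable_bounded_integrable.
- exact: measurable_box.
- rewrite /box /= product_measure1E; [|exact: measurable_itv|exact: measurable_itv].
  have fL : (leb (`[(- L)%R, L]%classic : set T) < +oo)%E.
    by rewrite lebesgue_measure_itv /=; case: ifP => _; rewrite ?ltry// -EFinB ltry.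
  by rewrite lte_mul_pinfty// ge0_fin_numE.
- exact: measurable_cst.
- by exists `|B|; split; [exact: num_real|move=> x Bx y _ /=; exact: ltW].
Qed.

Lemma boxed_integrable B L F : measurable_fun [set: T * T] F -> boxed B L F ->
  leb2.-integrable [set: T * T] (EFin \o F).
Proof.
move=> mF bF; apply: le_integrable (boxed_integrable_dom B L) => //.
  exact/measurable_EFinP.
move=> z _ /=; rewrite lee_fin; apply: le_trans (bF z) _; exact: ler_norm.
Qed.

Lemma integrable_shift2 a b F : measurable_fun [set: T * T] F ->
  leb2.-integrable [set: T * T] (EFin \o F) ->
  leb2.-integrable [set: T * T] (EFin \o (F \o shift2 a b)) /\
  \int[leb2]_z (F \o shift2 a b) z = \int[leb2]_z F z.
Proof.
move=> mF iF.
have mEF : measurable_fun [set: T * T] (EFin \o F) by exact/measurable_EFinP.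
have ishift : leb2.-integrable [set: T * T] (EFin \o (F \o shift2 a b)).
  apply/integrableP; split.
    by apply/measurable_EFinP; apply: measurableT_comp => //; exact: measurable_shift2.
  have /integrableP[_] := iF; apply: le_lt_trans.
  rewrite -(integral_pushforward_shift2 a b (fun z => `|(EFin \o F) z|%E)).
  by rewrite (ge0_integral_pushforward (measurable_shift2 a b))//; exact: measurableT_comp.
split=> //; congr fine.
by rewrite -[RHS](integral_pushforward_shift2 a b) (integral_pushforward (measurable_shift2 a b)).
Qed.

Lemma boxed_limit_ge0 B L (F_ : nat -> T * T -> R) (F : T * T -> R) :
  (forall n, measurable_fun [set: T * T] (F_ n)) -> measurable_fun [set: T * T] F ->
  (forall n, boxed B L (F_ n)) ->
  {ae leb2, forall z, (fun n => F_ n z) @ \oo --> (F z : R)} ->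
  (forall n, 0 <= \int[leb2]_z F_ n z) -> 0 <= \int[leb2]_z F z.
Proof.
move=> mF_ mF bF cF hF.
have mEF_ n : measurable_fun [set: T * T] (EFin \o F_ n) by exact/measurable_EFinP.
have mEF : measurable_fun [set: T * T] (EFin \o F) by exact/measurable_EFinP.
have cEF : {ae leb2, forall z, [set: T * T] z -> (fun n => (EFin \o F_ n) z) @ \oo --> (EFin \o F) z}.
  apply: negligibleS cF => z /= nz cz; apply: nz => _.
  by apply: cvg_EFin => //; exact: nearW.
have dom : {ae leb2, forall z n, [set: T * T] z -> (`|(EFin \o F_ n) z| <= (EFin \o (fun z => (B * \1_(box L) z)%R)) z)%E}.
  by apply: aeW => z n _; rewrite lee_fin; exact: bF.
have [iF _ cv] := dominated_convergence measurableT mEF_ mEF cEF (boxed_integrable_dom B L) dom.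
apply: fine_ge0.
rewrite -(cvg_lim _ cv)//; apply: lime_ge; first by apply/cvg_ex; eexists; exact: cv.
apply: nearW => n; have := hF n; rewrite /Rintegral -lee_fin fineK//.
exact: integrable_fin_num (boxed_integrable (mF_ n) (bF n)).
Qed.

Lemma boxed_mul B Bf L F G : 0 <= B -> (forall z, `|F z| <= B) -> boxed Bf L G -> boxed (Bf * B) L (fun z => G z * F z).
Proof.
move=> B0 FB Gb z; rewrite normrM mulrAC; apply: ler_pM => //.
Qed.

Lemma integrable_sum (F G : T * T -> R) : leb2.-integrable [set: T * T] (EFin \o F) -> leb2.-integrable [set: T * T] (EFin \o G) ->
  leb2.-integrable [set: T * T] (EFin \o (fun z => F z + G z)).
Proof. by move=> iF iG; exact: (integrableD measurableT iF iG). Qed.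

(** Summation by parts: the cell inequality is multiplied by f and integrated,
    and translation invariance moves the shifts from eta and q to f. *)
Lemma discrete_weak (eta q S f : T * T -> R) (dx dt C B Bf L : R) : 0 < dx -> 0 < dt -> 0 <= B ->
  measurable_fun [set: T * T] eta -> measurable_fun [set: T * T] q ->
  measurable_fun [set: T * T] S -> measurable_fun [set: T * T] f ->
  (forall z, `|eta z| <= B) -> (forall z, `|q z| <= B) -> (forall z, `|S z| <= B) ->
  boxed Bf L f -> (forall z, 0 <= f z) ->
  (forall z, eta z <= (eta (shift2 (- dx) (- dt) z) + eta (shift2 dx (- dt) z)) / 2
     - dt / (2 * dx) * (q (shift2 dx (- dt) z) - q (shift2 (- dx) (- dt) z)) - dt * S z + C * dt ^+ 2) ->
  0 <= \int[leb2]_z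
    (eta z * (((f (shift2 dx dt z) + f (shift2 (- dx) dt z)) / 2 - f z) / dt)
     + q z * ((f (shift2 dx dt z) - f (shift2 (- dx) dt z)) / (2 * dx))
     - S z * f z + C * dt * f z).
Proof.
move=> dx0 dt0 B0 me mq mS mf be bq bS bf f0 ineq.
have dx2 : 0 < 2 * dx by rewrite mulr_gt0.
pose r := dt / (2 * dx); have r0 : 0 <= r by rewrite divr_ge0 ?ltW.
pose w1 z := eta z / 2 + r * q z; pose w2 z := eta z / 2 - r * q z.
pose w3 z := - eta z - dt * S z + C * dt ^+ 2.
have mw1 : measurable_fun [set: T * T] w1.
  by apply: measurable_funD; [apply: measurable_funM => //; exact: measurable_cst|apply: measurable_funM => //; exact: measurable_cst].
have mw2 : measurable_fun [set: T * T] w2.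
  by apply: measurable_funB; [apply: measurable_funM => //; exact: measurable_cst|apply: measurable_funM => //; exact: measurable_cst].
have mw3 : measurable_fun [set: T * T] w3.
  apply: measurable_funD; last exact: measurable_cst.
  apply: measurable_funB; last by apply: measurable_funM => //; exact: measurable_cst.
  exact: measurableT_comp.
have msh a b (F : T * T -> R) : measurable_fun [set: T * T] F -> measurable_fun [set: T * T] (fun z => F (shift2 a b z)).
  by move=> mF; apply: (measurableT_comp mF); exact: measurable_shift2.
pose A1 z := f z * w1 (shift2 (- dx) (- dt) z).
pose A2 z := f z * w2 (shift2 dx (- dt) z).
pose A3 z := f z * w3 z.
have rq z : `|r * q z| <= r * B by rewrite normrM (ger0_norm r0); apply: ler_wpM2l.
have e2 z : `|eta z / 2| <= B by rewrite normrM normfV (ger0_norm (ler0n R 2)) ler_pdivrMr//; have := be z; lra.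
have bw1 z : `|w1 z| <= B + r * B by apply: le_trans (ler_normD _ _) _; exact: lerD.
have bw2 z : `|w2 z| <= B + r * B by apply: le_trans (ler_normB _ _) _; exact: lerD.
have bw3 z : `|w3 z| <= B + dt * B + `|C * dt ^+ 2|.
  apply: le_trans (ler_normD _ _) _; apply: lerD => //.
  apply: le_trans (ler_normB _ _) _; rewrite normrN normrM (gtr0_norm dt0); apply: lerD => //.
  by rewrite ler_pM2l.
have rB : 0 <= B + r * B by rewrite addr_ge0// mulr_ge0.
have rB3 : 0 <= B + dt * B + `|C * dt ^+ 2| by rewrite addr_ge0// addr_ge0// mulr_ge0// ltW.
have mA1 : measurable_fun [set: T * T] A1 by apply: measurable_funM => //; exact: msh.
have mA2 : measurable_fun [set: T * T] A2 by apply: measurable_funM => //; exact: msh.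
have mA3 : measurable_fun [set: T * T] A3 by apply: measurable_funM.
have i1 : leb2.-integrable [set: T * T] (EFin \o A1).
  apply: (boxed_integrable mA1 (B := Bf * (B + r * B)) (L := L)).
  exact: (boxed_mul rB (fun z => bw1 _) bf).
have i2 : leb2.-integrable [set: T * T] (EFin \o A2).
  apply: (boxed_integrable mA2 (B := Bf * (B + r * B)) (L := L)).
  exact: (boxed_mul rB (fun z => bw2 _) bf).
have i3 : leb2.-integrable [set: T * T] (EFin \o A3).
  apply: (boxed_integrable mA3 (B := Bf * (B + dt * B + `|C * dt ^+ 2|)) (L := L)).
  exact: (boxed_mul rB3 bw3 bf).
have [j1 I1] := integrable_shift2 dx dt mA1 i1.
have [j2 I2] := integrable_shift2 (- dx) dt mA2 i2.
have pos : 0 <= \int[leb2]_z (A1 z + A2 z + A3 z).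
  apply: Rintegral_ge0 => z _; rewrite /A1 /A2 /A3 -!mulrDr; apply: mulr_ge0 => //.
  by rewrite /w1 /w2 /w3; have := ineq z; rewrite -/r; clear; lra.
have i12 := integrable_sum i1 i2; have j12 := integrable_sum j1 j2.
rewrite (RintegralD measurableT i12 i3) (RintegralD measurableT i1 i2) -I1 -I2 in pos.
rewrite -(RintegralD measurableT j1 j2) -(RintegralD measurableT j12 i3) in pos.
have j123 := integrable_sum j12 i3.
have : 0 <= dt^-1 * \int[leb2]_z ((A1 \o shift2 dx dt) z + (A2 \o shift2 (- dx) dt) z + A3 z).
  by apply: mulr_ge0 => //; rewrite invr_ge0 ltW.
rewrite -(RintegralZl _ measurableT j123) => /le_trans; apply.
rewrite le_eqVlt; apply/orP; left; apply/eqP; apply: eq_Rintegral => z _.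
have s1 : shift2 (- dx) (- dt) (shift2 dx dt z) = z.
  by case: z => a b; rewrite /shift2 /= !addrK.
have s2 : shift2 dx (- dt) (shift2 (- dx) dt z) = z.
  by case: z {s1} => a b; rewrite /shift2 /= addrK subrK.
rewrite /A1 /A2 /A3 /= s1 s2 /w1 /w2 /w3 /r.
have dt1 := lt0r_neq0 dt0; have dx1 := lt0r_neq0 dx0.
by field; rewrite dt1 dx1.
Qed.

End Plane.

(** * The sign function and discrete derivatives of test functions *)

Section SignLimits.
Context {R : realType}.

Lemma measurable_sg d (T : measurableType d) (a : T -> R) :
  measurable_fun [set: T] a -> measurable_fun [set: T] (fun z => Num.sg (a z)).
Proof.
move=> ma.
have mlt (f g : T -> R) b : measurable_fun [set: T] f -> measurable_fun [set: T] g ->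
    measurable ((fun z => f z < g z) @^-1` [set b]).
  by move=> mf mg; rewrite -[X in measurable X]setTI; exact: (measurable_fun_ltr mf mg).
have m0 : measurable_fun [set: T] (fun _ : T => 0 : R) by exact: measurable_cst.
rewrite (_ : (fun z => _) = (fun z => (fun i : bool * bool => (i.1%:R - i.2%:R : R)) (0 < a z, a z < 0))); last first.
  by apply/funext => z /=; case: (sgrP (a z)) => h; rewrite ?ltxx ?h ?(lt_gtF h) ?subr0 ?sub0r.
apply: (@measurable_countable_comp _ _ _ _ (fun z => (0 < a z, a z < 0)) (fun i : bool * bool => (i.1%:R - i.2%:R : R))) => -[b1 b2].
rewrite (_ : _ @^-1` _ = (fun z => 0 < a z) @^-1` [set b1] `&` (fun z => a z < 0) @^-1` [set b2]).
  by apply: measurableI; exact: mlt.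
by apply/seteqP; split => z /=; [case=> -> ->|case=> <- <-].
Qed.

Lemma sg_cvg (a : nat -> R) (x : R) : x != 0 -> a @ \oo --> x ->
  \forall n \near \oo, Num.sg (a n) = Num.sg x.
Proof.
move=> x0 ax; have n0 : 0 < `|x| by rewrite normr_gt0.
have /cvgr_dist_lt /(_ _ n0) := ax; apply: filterS => n.
rewrite ltr_norml; move: x0 n0 => /[swap] _; rewrite neq_lt => /orP[xn|xp].
  by rewrite (ltr0_norm xn) => /andP[? ?]; rewrite !ltr0_sg//; lra.
by rewrite (gtr0_norm xp) => /andP[? ?]; rewrite !gtr0_sg//; lra.
Qed.

Lemma sg_mul_cvg (a w : nat -> R) (x y : R) : x != 0 -> a @ \oo --> x -> w @ \oo --> y ->
  (fun n => Num.sg (a n) * w n) @ \oo --> Num.sg x * y.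
Proof.
move=> x0 ax wy.
have : (fun n => Num.sg x * w n) @ \oo --> Num.sg x * y by apply: cvgMr.
apply: cvg_trans; apply: near_eq_cvg.
by have := sg_cvg x0 ax; apply: filterS => n ->.
Qed.

(** Kruzhkov's entropy flux; it is continuous, since the factor of the sign
    vanishes where the sign jumps. *)
Definition kflux (g : R -> R -> R -> R) (k x t u : R) : R := Num.sg (u - k) * (g x t u - g x t k).

Lemma kflux_cvg g (k x t u : nat -> R) (k0 x0 t0 u0 : R) : C0_3 g ->
  k @ \oo --> k0 -> x @ \oo --> x0 -> t @ \oo --> t0 -> u @ \oo --> u0 ->
  (fun n => kflux g (k n) (x n) (t n) (u n)) @ \oo --> kflux g k0 x0 t0 u0.
Proof.
move=> gC kk xx tt uu.
have cd : (fun n => g (x n) (t n) (u n) - g (x n) (t n) (k n)) @ \oo --> g x0 t0 u0 - g x0 t0 k0.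
  by apply: cvgB; apply: C0_3_cvg.
have [e|ne] := eqVneq u0 k0; last first.
  by apply: sg_mul_cvg => //; [rewrite subr_eq0|apply: cvgB].
rewrite /kflux e subrr sgr0 mul0r.
rewrite e subrr in cd.
apply/cvgrPdist_le => ep ep0; have /cvgrPdist_le /(_ _ ep0) := cd.
apply: filterS => n; rewrite !sub0r !normrN normrM => h; apply: le_trans h.
rewrite -[leRHS]mul1r ler_wpM2r// normr_sg; by case: (_ != 0).
Qed.

Lemma inv_cvg0 : (fun n : nat => n.+1%:R^-1 : R) @ \oo --> (0 : R).
Proof.
apply/cvgrPdist_le => ep ep0; have := inv_small ep0; apply: filterS => n.
by rewrite sub0r normrN ger0_norm ?invr_ge0 ?ler0n.
Qed.

Lemma C0_3_shift (g : R -> R -> R -> R) (c : R) : C0_3 g -> C0_3 (fun x t p => g x t (c + p)).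
Proof.
move=> gC z; apply: (cvg_comp (fun z : R * R * R => (z.1, c + z.2)) (fun z : R * R * R => g z.1.1 z.1.2 z.2)); last exact: (gC (z.1, c + z.2)).
apply: (cvg_pair (G := nbhs z.1) (H := nbhs (c + z.2))); first exact: cvg_fst.
by apply: cvgD; [exact: cvg_cst|exact: cvg_snd].
Qed.

Lemma sg_perturb (y s : R) : s != 0 ->
  \forall n \near \oo, Num.sg (y - s * n.+1%:R^-1) ^+ 2 = 1.
Proof.
move=> s0.
have [->|y0] := eqVneq y 0.
  apply: nearW => n; rewrite sub0r sgrN sqrrN sqr_sg.
  by rewrite mulf_neq0// lt0r_neq0// invr_gt0 ltr0n.
have cy : (fun n : nat => y - s * n.+1%:R^-1) @ \oo --> y.
  by rewrite -[X in _ --> X]subr0 -[X in _ - X](mulr0 s); apply: cvgB; [exact: cvg_cst|apply: cvgMr; exact: inv_cvg0].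
by have := sg_cvg y0 cy; apply: filterS => n ->; rewrite sqr_sg y0.
Qed.

(** For y = 0 the two signs are opposite and cancel in the limit; otherwise both
    are eventually the sign of y. *)
Lemma sg_sum_perturb (y : R) (a b : nat -> R) (l : R) : a @ \oo --> l -> b @ \oo --> l ->
  (fun n => Num.sg (y - n.+1%:R^-1) * a n + Num.sg (y + n.+1%:R^-1) * b n) @ \oo
    --> 2 * (Num.sg y * l).
Proof.
move=> al bl.
have [->|y0] := eqVneq y 0.
  rewrite sgr0 mul0r mulr0.
  rewrite (_ : (fun n => _) = (fun n => b n - a n)); last first.
    apply/funext => n; have n0 : 0 < n.+1%:R^-1 :> R by rewrite invr_gt0 ltr0n.
    by rewrite sub0r sgrN add0r gtr0_sg// mulN1r mul1r addrC.
  by rewrite -(subrr l); apply: cvgB.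
rewrite mulr_natl mulr2n; apply: cvgD; apply: sg_mul_cvg => //.
  by rewrite -[X in _ --> X]subr0; apply: cvgB; [exact: cvg_cst|exact: inv_cvg0].
by rewrite -[X in _ --> X]addr0; apply: cvgD; [exact: cvg_cst|exact: inv_cvg0].
Qed.

End SignLimits.

Section TestFunctions.
Context {R : realType}.
Local Notation T := (measurableTypeR R).
Variable f : R -> R -> R.
Hypothesis f_C1 : C1_2 f.
Hypothesis f_ge0 : forall x t, 0 <= f x t.

Lemma C0_2_bounded_box (g : R -> R -> R) (L : R) : C0_2 g ->
  exists2 B : R, 0 <= B & forall z, box L z -> `|g z.1 z.2| <= B.
Proof.
move=> gC; have [L0|L0] := ltP L 0.
  by exists 0 => // -[x t] [/= h _]; move: h; rewrite in_itv /= => /andP[]; lra.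
have ne : (`[-L, L] `*` `[-L, L] : set (R * R)) !=set0.
  by exists (0, 0); split; rewrite /= in_itv/=; apply/andP; split; lra.
have nC : {within (`[-L, L] `*` `[-L, L] : set (R * R)), continuous (fun z : R * R => `|g z.1 z.2|)}.
  apply: continuous_subspaceT => z.
  by apply: continuous_comp; [exact: gC|exact: norm_continuous].
have kc : compact (`[-L, L] `*` `[-L, L] : set (R * R)) by apply: compact_setX; exact: segment_compact.
have [z _ zmax] := compact_EVT_max ne kc nC.
by exists `|g z.1 z.2| => // w bw; apply: zmax; rewrite inE.
Qed.

(** Zeros of a nonnegative function are minima. *)
Lemma test_zero_dx x t : f x t = 0 -> dx2 f x t = 0.
Proof.
move=> fx; have [df _ _ _] := f_C1.
have [_ h] : is_derive x (1 : R) (f ^~ t) 0.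
  apply: (@derive1_at_min _ (f ^~ t) (x - 1) (x + 1)).
  - lra.
  - by move=> y _; exact: (df y t).1.
  - by rewrite in_itv /=; apply/andP; split; lra.
  - by move=> y _; rewrite fx.
by rewrite /dx2 derive1E.
Qed.

Lemma test_zero_dt x t : f x t = 0 -> dt2 f x t = 0.
Proof.
move=> fx; have [df _ _ _] := f_C1.
have [_ h] : is_derive t (1 : R) (f x) 0.
  apply: (@derive1_at_min _ (f x) (t - 1) (t + 1)).
  - lra.
  - by move=> y _; exact: (df x y).2.
  - by rewrite in_itv /=; apply/andP; split; lra.
  - by move=> y _; rewrite fx.
by rewrite /dt2 derive1E.
Qed.

Lemma test_bounds (K : set (R * R)) : compact K -> (forall z, ~ K z -> f z.1 z.2 = 0) ->
  exists L B : R, [/\ 0 <= L, 0 <= B, forall z, ~ box L z -> f z.1 z.2 = 0 &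
    [/\ forall x t, `|f x t| <= B, forall x t, `|dx2 f x t| <= B & forall x t, `|dt2 f x t| <= B]].
Proof.
move=> Kc fK.
have [L0 [_ hL]] := @compact_bounded R (R * R)%type K Kc.
pose L := `|L0| + 1.
have L0L : L0 < L by rewrite /L; have := ler_norm L0; lra.
have fz z : ~ box L z -> f z.1 z.2 = 0.
  move=> nz; apply: fK => Kz; apply: nz.
  have := hL _ L0L _ Kz; case: z Kz => x t _ /=; rewrite /Num.norm /= ge_max => /andP[h1 h2].
  by split; rewrite /= in_itv /= -ler_norml.
have [_ c1 c2 c3] := f_C1.
have [B1 B10 h1] := C0_2_bounded_box L c1.
have [B2 B20 h2] := C0_2_bounded_box L c2.
have [B3 B30 h3] := C0_2_bounded_box L c3.
exists L, (B1 + B2 + B3); split => //; [by rewrite /L addr_ge0|by rewrite !addr_ge0|].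
split=> x t; have [bz|nz] := pselect (box L (x, t)).
- by apply: le_trans (h1 _ bz) _; lra.
- by rewrite (fz _ nz) normr0 !addr_ge0.
- by apply: le_trans (h2 _ bz) _; lra.
- by rewrite (test_zero_dx (fz _ nz)) normr0 !addr_ge0.
- by apply: le_trans (h3 _ bz) _; lra.
- by rewrite (test_zero_dt (fz _ nz)) normr0 !addr_ge0.
Qed.

Lemma test_lip (B : R) : (forall x t, `|dx2 f x t| <= B) -> (forall x t, `|dt2 f x t| <= B) ->
  (forall x y t, `|f x t - f y t| <= B * `|x - y|) /\ (forall x t s, `|f x t - f x s| <= B * `|t - s|).
Proof.
move=> bx bt; have [df _ _ _] := f_C1; split.
  move=> x y t; have [xi _ ->] := mvt_between y x (fun z => (df z t).1).
  by rewrite normrM ler_wpM2r//; exact: bx.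
move=> x t s; have [xi _ ->] := mvt_between s t (fun z => (df x z).2).
by rewrite normrM ler_wpM2r//; exact: bt.
Qed.

(** The discrete derivatives that summation by parts of the Lax-Friedrichs
    scheme produces on a test function. *)
Definition lf_dt (dx dt x t : R) := ((f (x + dx) (t + dt) + f (x - dx) (t + dt)) / 2 - f x t) / dt.
Definition lf_dx (dx dt x t : R) := (f (x + dx) (t + dt) - f (x - dx) (t + dt)) / (2 * dx).

Lemma lf_dt_bound (B l dx dt x t : R) : 0 < dx -> 0 < dt -> 0 < l -> l * dx <= dt ->
  (forall x t, `|dx2 f x t| <= B) -> (forall x t, `|dt2 f x t| <= B) ->
  `|lf_dt dx dt x t| <= B / l + B.
Proof.
move=> dx0 dt0 l0 lx bx bt; have [fx ft] := test_lip bx bt.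
have B0 : 0 <= B := le_trans (normr_ge0 _) (bx 0 0).
rewrite /lf_dt normrM normfV (gtr0_norm dt0) ler_pdivrMr//.
have h1 := fx (x + dx) x (t + dt); have h2 := fx (x - dx) x (t + dt); have h3 := ft x (t + dt) t.
have e1 : x + dx - x = dx by ring.
have e2 : x - dx - x = - dx by ring.
have e3 : t + dt - t = dt by ring.
rewrite e1 (gtr0_norm dx0) in h1; rewrite e2 normrN (gtr0_norm dx0) in h2; rewrite e3 (gtr0_norm dt0) in h3.
have : B * dx <= B / l * dt.
  by rewrite mulrAC ler_pdivlMr// -mulrA; apply: ler_wpM2l => //; rewrite mulrC.
move: h1 h2 h3; rewrite !ler_norml; move: (f (x + dx) _) (f (x - dx) _) (f x (t + dt)) (f x t) => a1 a2 a3 a4.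
by move=> /andP[? ?] /andP[? ?] /andP[? ?] ?; apply/andP; split; lra.
Qed.

Lemma lf_dx_bound (B dx dt x t : R) : 0 < dx ->
  (forall x t, `|dx2 f x t| <= B) -> (forall x t, `|dt2 f x t| <= B) ->
  `|lf_dx dx dt x t| <= B.
Proof.
move=> dx0 bx bt; have [fx _] := test_lip bx bt.
have dx2 : 0 < 2 * dx by rewrite mulr_gt0.
rewrite /lf_dx normrM normfV (gtr0_norm dx2) ler_pdivrMr//.
have := fx (x + dx) (x - dx) (t + dt).
by rewrite (_ : x + dx - (x - dx) = 2 * dx) ?(gtr0_norm dx2)//; ring.
Qed.

Lemma lf_dx_cvg (dx dt : nat -> R) (x t : R) : (forall n, 0 < dx n) ->
  dx @ \oo --> (0 : R) -> dt @ \oo --> (0 : R) ->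
  (fun n => lf_dx (dx n) (dt n) x t) @ \oo --> dx2 f x t.
Proof.
move=> dx0 cx ct.
have c1 : (fun n => x + dx n) @ \oo --> x.
  by rewrite -[X in _ --> X]addr0; apply: cvgD; [exact: cvg_cst|].
have c2 : (fun n => x - dx n) @ \oo --> x.
  by rewrite -[X in _ --> X]subr0; apply: cvgB; [exact: cvg_cst|].
have c3 : (fun n => t + dt n) @ \oo --> t.
  by rewrite -[X in _ --> X]addr0; apply: cvgD; [exact: cvg_cst|].
have [Q cQ hQ] := diffquot_x f_C1 c2 c1 c3.
rewrite (_ : (fun n => _) = Q)//; apply/funext => n; rewrite /lf_dx hQ.
have /lt0r_neq0 := dx0 n => d; by field.
Qed.

(** The average over the two neighbours adds dx / dt times the difference of two
    quotients in x with the same limit, and dx / dt is bounded. *)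
Lemma lf_dt_cvg (l : R) (dx dt : nat -> R) (x t : R) : 0 < l -> (forall n, 0 < dx n) -> (forall n, 0 < dt n) ->
  (forall n, l * dx n <= dt n) ->
  dx @ \oo --> (0 : R) -> dt @ \oo --> (0 : R) ->
  (fun n => lf_dt (dx n) (dt n) x t) @ \oo --> dt2 f x t.
Proof.
move=> l0 dx0 dt0 lx cx ct.
have c1 : (fun n => x + dx n) @ \oo --> x.
  by rewrite -[X in _ --> X]addr0; apply: cvgD; [exact: cvg_cst|].
have c2 : (fun n => x - dx n) @ \oo --> x.
  by rewrite -[X in _ --> X]subr0; apply: cvgB; [exact: cvg_cst|].
have c3 : (fun n => t + dt n) @ \oo --> t.
  by rewrite -[X in _ --> X]addr0; apply: cvgD; [exact: cvg_cst|].
have cc (y : R) : (fun=> y) @ \oo --> y by exact: cvg_cst.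
have [Q1 cQ1 hQ1] := diffquot_x f_C1 (cc x) c1 c3.
have [Q2 cQ2 hQ2] := diffquot_x f_C1 c2 (cc x) c3.
have [Q3 cQ3 hQ3] := diffquot_t f_C1 (cc t) c3 (cc x).
rewrite (_ : (fun n => _) = (fun n => Q3 n + (Q1 n - Q2 n) * (dx n / dt n / 2))); last first.
  apply/funext => n; rewrite /lf_dt.
  have /= e1 := hQ1 n; have /= e2 := hQ2 n; have /= e3 := hQ3 n.
  have {}e1 : f (x + dx n) (t + dt n) = f x (t + dt n) + Q1 n * dx n.
    have -> : Q1 n * dx n = f (x + dx n) (t + dt n) - f x (t + dt n) by rewrite e1; ring.
    by ring.
  have {}e2 : f (x - dx n) (t + dt n) = f x (t + dt n) - Q2 n * dx n.
    have -> : Q2 n * dx n = f x (t + dt n) - f (x - dx n) (t + dt n) by rewrite e2; ring.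
    by ring.
  have {}e3 : f x (t + dt n) = f x t + Q3 n * dt n.
    have -> : Q3 n * dt n = f x (t + dt n) - f x t by rewrite e3; ring.
    by ring.
  by rewrite e1 e2 e3; have /lt0r_neq0 := dt0 n => d; field.
rewrite -[X in _ --> X]addr0; apply: cvgD => //.
have c12 : (fun n => Q1 n - Q2 n) @ \oo --> (0 : R) by have := cvgB cQ1 cQ2; rewrite subrr; exact.
apply/cvgrPdist_le => ep ep0.
have ep1 : 0 < ep * l by rewrite mulr_gt0.
have /cvgrPdist_le /(_ _ ep1) := c12; apply: filterS => n; rewrite !sub0r !normrN normrM => h.
have r0 : 0 <= dx n / dt n / 2 by rewrite divr_ge0// divr_ge0// ltW.
have r1 : dx n / dt n / 2 <= l^-1.
  have h1 : dx n <= l^-1 * dt n by rewrite ler_pdivlMl.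
  rewrite ler_pdivrMr// ler_pdivrMr//.
  have : 0 <= l^-1 * dt n by apply: mulr_ge0; [rewrite invr_ge0|]; exact: ltW.
  lra.
rewrite (ger0_norm r0); apply: le_trans (ler_pM _ r0 h r1) _ => //.
by rewrite mulfK// lt0r_neq0.
Qed.

End TestFunctions.

(** * The discrete entropy inequality in the limit *)

Lemma box_enlarge {R : realType} (L a b : R) (z : R * R) : `|a| <= 1 -> `|b| <= 1 ->
  box L (z.1 + a, z.2 + b) -> box (L + 1) z.
Proof.
move=> a1 b1 [/= h1 h2]; move: h1 h2 a1 b1.
rewrite !in_itv /= !ler_norml => /andP[? ?] /andP[? ?] /andP[? ?] /andP[? ?].
by split; rewrite /= in_itv /=; apply/andP; split; lra.
Qed.

Section CellFunctions.
Context {R : realType}.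
Local Notation T := (measurableTypeR R).
Variable M : mesh.
Local Notation dx := (space_step M : R).
Local Notation dt := (time_step M : R).

Definition cellz2 (z : T * T) : int * int := (layer M z.2, cellz M (layer M z.2) z.1).

Lemma measurable_cellz2 (phi : int * int -> R) : measurable_fun [set: T * T] (fun z => phi (cellz2 z)).
Proof.
apply: measurable_countable_comp => -[k m].
have mk : measurable ((fun z : T * T => Num.floor (z.2 / dt)) @^-1` [set k]).
  apply: measurable_floor; apply: measurable_funM; last exact: measurable_cst.
  exact: measurable_snd.
have mm : measurable ((fun z : T * T => Num.floor ((z.1 / dx - k%:~R + 1) / 2)) @^-1` [set ((m - k) %/ 2)%Z]).
  apply: measurable_floor; apply: measurable_funM; last exact: measurable_cst.
  apply: measurable_funD; last exact: measurable_cst.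
  apply: measurable_funB; last exact: measurable_cst.
  by apply: measurable_funM; [exact: measurable_fst|exact: measurable_cst].
have [ev|od] := boolP (evn k m); last first.
  rewrite (_ : _ @^-1` _ = set0); first exact: measurable0.
  apply/seteqP; split => // z /= [e1 e2]; have := cellz_evn M (layer M z.2) z.1.
  by rewrite e2 e1 (negbTE od).
rewrite (_ : _ @^-1` _ = (fun z : T * T => Num.floor (z.2 / dt)) @^-1` [set k] `&`
   (fun z : T * T => Num.floor ((z.1 / dx - k%:~R + 1) / 2)) @^-1` [set ((m - k) %/ 2)%Z]).
  exact: measurableI.
apply/seteqP; split => z /=; rewrite /cellz2 /layer /cellz.
  by case=> -> <-; split => //; rewrite addrK mulKz.
case=> -> ->; congr (_, _); have /dvdzP[q] := ev; move: (q) => q0 e.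
have -> : m = 2 * (q0 - k) + k by rewrite mulrBr [2 * q0]mulrC -e; ring.
by rewrite addrK mulKz.
Qed.

Lemma cellz2_shift (s : bool) (z : T * T) :
  cellz2 (shift2 (if s then dx else - dx) (- dt) z) = ((cellz2 z).1 - 1, (cellz2 z).2 + (if s then 1 else -1)).
Proof.
have dx0 : 0 < dx := space_step_gt0 M; have dt0 : 0 < dt := time_step_gt0 M.
have kE : layer M (z.2 - dt) = layer M z.2 - 1.
  rewrite /layer mulrBl divff ?lt0r_neq0//; apply: floor_def.
  by have /andP[] := floor_itv (z.2 / dt); rewrite subrK intrB intrD; set f := _%:~R => *; apply/andP; split; lra.
rewrite /cellz2 /shift2 /= kE; congr (_, _).
have ev := cellz_evn M (layer M z.2) z.1; have /andP[h1 h2] := cellz_itv M (layer M z.2) z.1.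
set m := cellz _ _ _ in ev h1 h2 *.
apply: cellz_unique; first by case: s; rewrite !evnE ev.
rewrite xgB1 in h1; rewrite xgD1 in h2.
by case: s; rewrite !(xgD1, xgB1); apply/andP; split; lra.
Qed.

Lemma cellz2_near (z : T * T) :
  `|(xgrid M (cellz2 z).2 : R) - z.1| <= dx /\ `|(tz M (cellz2 z).1 : R) - z.2| <= dt.
Proof.
have := cellz_itv M (layer M z.2) z.1; have := layer_itv M z.2.
rewrite /= xgD1 xgB1 {2}/tz intrD mulrDl mul1r -/(tz M (layer M z.2)).
by move=> /andP[? ?] /andP[? ?]; split; rewrite ler_norml; apply/andP; split; lra.
Qed.

End CellFunctions.

Section EntropyLimit.
Context {R : realType}.
Local Notation T := (measurableTypeR R).
Local Notation leb2 := (@lebesgue_measure R \x @lebesgue_measure R)%E.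
Variable H : R -> R -> R -> R.
Hypothesis H_per : per3 H.
Hypothesis H_C2 : C2_3 H.
Hypothesis H_pp : forall x t p, 0 < dp3 (dp3 H) x t p.
Variables (c l0 l1 P : R).
Hypothesis l0_gt0 : 0 < l0.
Hypothesis l1_gt0 : 0 < l1.
Hypothesis P_ge0 : 0 <= P.
Hypothesis Pcoer : forall x t p, `|dp3 H x t p| <= l1^-1 -> `|p| <= P.
Variables (M : nat -> mesh) (h : nat -> R) (V : nat -> int -> int -> R).
Hypothesis psV : forall n, pscheme H c l0 l1 (M n) (h n) (V n).
Hypothesis dx0 : (fun n => space_step (M n) : R) @ \oo --> (0 : R).
Hypothesis dt0 : (fun n => time_step (M n) : R) @ \oo --> (0 : R).
Variable ub : R -> R -> R.
Hypothesis ub_meas : measurable_fun [set: T * T] (fun z : T * T => ub z.1 z.2).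
Hypothesis u_cvg : {ae leb2, forall z : T * T,
  (fun n => uinterp (M n) (V n) z.1 z.2) @ \oo --> (ub z.1 z.2 : R)}.

Let Hc x t p := H x t (c + p).

Let Hc_C0 : C0_3 Hc.
Proof. by have [[_ hC _ _ _] _ _ _] := H_C2; exact: C0_3_shift. Qed.

Lemma C1_2_level (p : R) : C1_2 (fun x t => H x t p).
Proof.
have [[hd _ hx ht _] _ _ _] := H_C2.
have restr (g : R -> R -> R -> R) : C0_3 g -> C0_2 (fun x t => g x t p).
  move=> gC z; apply: (cvg_comp (fun z : R * R => (z, p)) (fun z : R * R * R => g z.1.1 z.1.2 z.2)); last exact: (gC (z, p)).
  by apply: (cvg_pair (G := nbhs z) (H := nbhs p)); [exact: cvg_id|exact: cvg_cst].
split; [|apply: restr|exact: (restr _ hx)|exact: (restr _ ht)].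
  by move=> x t; have [h1 h2 _] := hd x t p; exact: (conj h1 h2).
by have [[_ hC _ _ _] _ _ _] := H_C2.
Qed.

Section Level.
Variables (kap Cs : R).
Hypothesis Cs_ge0 : 0 <= Cs.
Hypothesis Hx_le : forall x t, `|dx3 H x t (c + kap)| <= Cs.
Variables (f : R -> R -> R) (L B : R).
Hypothesis f_C1 : C1_2 f.
Hypothesis f_ge0 : forall x t, 0 <= f x t.
Hypothesis B_ge0 : 0 <= B.
Hypothesis L_ge0 : 0 <= L.
Hypothesis f_box : forall z : T * T, ~ box L z -> f z.1 z.2 = 0.
Hypothesis fB : forall x t, `|f x t| <= B.
Hypothesis fxB : forall x t, `|dx2 f x t| <= B.
Hypothesis ftB : forall x t, `|dt2 f x t| <= B.

(** The integrand of Kruzhkov's inequality, plus a nonnegative defect where u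
    equals the level: there the signs of the discrete slopes need not converge,
    and the source term is bounded by Cs instead. *)
Definition kruzhkov (x t : R) : R :=
  `|ub x t - kap| * dt2 f x t + kflux Hc kap x t (ub x t) * dx2 f x t
  - Num.sg (ub x t - kap) * dx3 H x t (c + kap) * f x t
  + Cs * (1 - Num.sg (ub x t - kap) ^+ 2) * f x t.

Lemma measurable_kruzhkov : measurable_fun [set: T * T] (fun z : T * T => kruzhkov z.1 z.2).
Proof.
have [df cf cfx cft] := f_C1.
have [[_ hC hx _ _] _ _ _] := H_C2.
have m2 (g : R -> R -> R) : C0_2 g -> measurable_fun [set: T * T] (fun z : T * T => g z.1 z.2).
  by move=> gC; apply: (measurable_C0_2 gC); [exact: measurable_fst|exact: measurable_snd].
have mk (y : R) : measurable_fun [set: T * T] (fun=> y) by exact: measurable_cst.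
have mu : measurable_fun [set: T * T] (fun z : T * T => ub z.1 z.2 - kap) by exact: measurable_funB.
have ms := measurable_sg mu.
have mH (p : T * T -> R) : measurable_fun [set: T * T] p -> measurable_fun [set: T * T] (fun z => Hc z.1 z.2 (p z)).
  by move=> mp; apply: (measurable_C0_3 Hc_C0).
apply: measurable_funD; [apply: measurable_funB; [apply: measurable_funD|]|].
- by apply: measurable_funM; [exact: measurableT_comp|exact: m2].
- apply: measurable_funM; last exact: m2.
  by apply: measurable_funM => //; apply: measurable_funB; exact: mH.
- apply: measurable_funM; last exact: m2.
  by apply: measurable_funM => //; apply: (measurable_C0_3 hx).
- apply: measurable_funM; last exact: m2.
  apply: measurable_funM => //; apply: measurable_funB => //.
  by rewrite (_ : (fun z => _) = (fun z : T * T => Num.sg (ub z.1 z.2 - kap) * Num.sg (ub z.1 z.2 - kap))) //; exact: measurable_funM.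
Qed.

Let P' := P + `|c + kap|.
Let P'coer x t p : `|dp3 H x t p| <= l1^-1 -> `|p| <= P'.
Proof. by move=> /Pcoer hp; apply: le_trans hp _; rewrite lerDl. Qed.
Let kapP' : `|c + kap| <= P'. Proof. by rewrite lerDr. Qed.

Let U n (i : int * int) := slope (M n) (V n i.1) i.2.
Let q n (i : int * int) := kflux Hc kap (xgrid (M n) i.2) (tz (M n) i.1) (U n i).
Let D n (i : int * int) :=
  (Hc (xgrid (M n) (i.2 + 1)) (tz (M n) (i.1 - 1)) kap - Hc (xgrid (M n) (i.2 - 1)) (tz (M n) (i.1 - 1)) kap)
   / (2 * space_step (M n)).
Let S n (i : int * int) := Num.sg (U n i - kap) * D n i.

Let uiE n z : uinterp (M n) (V n) z.1 z.2 = U n (cellz2 (M n) z). Proof. by []. Qed.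

(* [cell_entropy] as an inequality between functions on the plane; after division
   by the time step the error is still O(dt) *)
Let cell_ineq : exists2 C : R, 0 <= C & forall n (z : T * T),
  `|U n (cellz2 (M n) z) - kap| <=
    (`|U n (cellz2 (M n) (shift2 (- space_step (M n)) (- time_step (M n)) z)) - kap|
      + `|U n (cellz2 (M n) (shift2 (space_step (M n)) (- time_step (M n)) z)) - kap|) / 2
    - time_step (M n) / (2 * space_step (M n))
        * (q n (cellz2 (M n) (shift2 (space_step (M n)) (- time_step (M n)) z))
           - q n (cellz2 (M n) (shift2 (- space_step (M n)) (- time_step (M n)) z)))
    - time_step (M n) * S n (cellz2 (M n) z) + C * time_step (M n) ^+ 2.
Proof.
have [a a0 ha] := H_strongly_convex H_per H_C2 H_pp P'.
have [Cp0 hCp0] := Hp_lip H_per H_C2 P'.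
pose Cp := `|Cp0|.
have hCp : strip_lip (dp3 H) P' Cp.
  move=> x t p y s p' hp hp'; apply: le_trans (hCp0 _ _ _ _ _ _ hp hp') _.
  by apply: ler_wpM2r; [rewrite !addr_ge0|exact: ler_norm].
pose C := l1 * (Cp * (l0^-1 + 1)) ^+ 2 / a.
have C0 : 0 <= C by apply: divr_ge0; [apply: mulr_ge0; [exact: ltW|exact: sqr_ge0]|exact: ltW].
exists C => // n z.
have /= e1 := cellz2_shift (M n) true z; have /= e2 := cellz2_shift (M n) false z.
rewrite e1 e2; clear e1 e2; set i := cellz2 _ z.
have ev : evn (i.1 - 1 + 1) i.2 by rewrite subrK; exact: cellz_evn.
have := cell_entropy H_C2 H_pp l1_gt0 (psV n) P'coer kapP' a0 (normr_ge0 Cp0) ha hCp ev.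
rewrite /= subrK -/(U n i) -/(U n (i.1 - 1, i.2 - 1)) -/(U n (i.1 - 1, i.2 + 1)).
have dxp : 0 < space_step (M n) :> R := space_step_gt0 (M n).
have dtp : 0 < time_step (M n) :> R := time_step_gt0 (M n).
rewrite /S /D /q /kflux /Hc /=.
have h1 := dx_dt (psV n); have h2 := dt_dx (psV n).
set dx := (space_step (M n) : R) in dxp h1 h2 *; set dt := (time_step (M n) : R) in dtp h1 h2 *.
have err : dt / dx * (Cp * (dx + dt)) ^+ 2 / a <= C * dt ^+ 2.
  have -> : C * dt ^+ 2 = l1 * (Cp * ((l0^-1 + 1) * dt)) ^+ 2 / a by rewrite /C !exprMn; ring.
  rewrite ler_pM2r ?invr_gt0//.
  apply: ler_pM; [by apply: divr_ge0; exact: ltW|exact: sqr_ge0|by rewrite ler_pdivrMr|].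
  have h3 : dx <= l0^-1 * dt by rewrite ler_pdivlMl.
  have n1 : 0 <= Cp * (dx + dt) by apply: mulr_ge0; [exact: normr_ge0|apply: addr_ge0; exact: ltW].
  have n3 : Cp * (dx + dt) <= Cp * ((l0^-1 + 1) * dt) by apply: ler_wpM2l; [exact: normr_ge0|rewrite mulrDl mul1r lerD2r].
  by apply: lerXn2r => //; rewrite nnegrE; exact: le_trans n3.
have -> : dt / (2 * dx) = dt / dx / 2 by rewrite invfM mulrA; ring.
move: err; set er := dt / dx * _ / a => err.
set al := H _ _ (c + U n _); set bl := H _ _ (c + U n _); set ak := H _ _ (c + kap); set bk := H _ _ (c + kap).
have -> : dt * (Num.sg (U n i - kap) * ((ak - bk) / (2 * dx))) = Num.sg (U n i - kap) * (dt / dx / 2 * (ak - bk)).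
  by have /lt0r_neq0 d := dxp; field.
lra.
Qed.

Let Ubound n (z : T * T) : `|U n (cellz2 (M n) z)| <= P + `|c|.
Proof. exact: (slope_bound (psV n) Pcoer (cellz_evn _ _ _)). Qed.

Let D_bound n i : `|D n i| <= Cs.
Proof.
have dxp : 0 < space_step (M n) :> R := space_step_gt0 (M n).
have dx2 : 0 < 2 * space_step (M n) :> R by rewrite mulr_gt0.
have [df _ _ _] := C1_2_level (c + kap).
rewrite /D normrM normfV (gtr0_norm dx2) ler_pdivrMr// /Hc.
have [xi _ ->] := mvt_between (xgrid (M n) (i.2 - 1)) (xgrid (M n) (i.2 + 1)) (fun y => (df y (tz (M n) (i.1 - 1))).1).
rewrite normrM; apply: ler_pM => //; first exact: Hx_le.
by rewrite xgD1 xgB1 (_ : _ - _ = 2 * space_step (M n)) ?gtr0_norm//; ring.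
Qed.

Let S_bound n i : `|S n i| <= Cs.
Proof.
rewrite /S normrM; apply: le_trans (D_bound n i).
by rewrite -[leRHS]mul1r ler_wpM2r// normr_sg; case: (_ != 0).
Qed.

Let dxp n : 0 < space_step (M n) :> R. Proof. exact: space_step_gt0. Qed.
Let dtp n : 0 < time_step (M n) :> R. Proof. exact: time_step_gt0. Qed.

Let dx1 n : space_step (M n) <= 1 :> R.
Proof.
have k0 : (0 < mesh_N (M n))%N := mesh_N_gt0 (M n).
rewrite /space_step invf_le1; last by rewrite mulr_gt0// ltr0n.
by move: k0; rewrite -(ler1n R) => ?; lra.
Qed.
Let dt1 n : time_step (M n) <= 1 :> R.
Proof.
have k0 : (0 < mesh_K (M n))%N := leq_trans (mesh_N_gt0 (M n)) (mesh_NK (M n)).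
rewrite /time_step invf_le1; last by rewrite mulr_gt0// ltr0n.
by move: k0; rewrite -(ler1n R) => ?; lra.
Qed.

Let grid_cvg (z : T * T) :
  [/\ (fun n => xgrid (M n) (cellz2 (M n) z).2 : R) @ \oo --> (z.1 : R),
      (fun n => xgrid (M n) ((cellz2 (M n) z).2 + 1) : R) @ \oo --> (z.1 : R),
      (fun n => xgrid (M n) ((cellz2 (M n) z).2 - 1) : R) @ \oo --> (z.1 : R),
      (fun n => tz (M n) (cellz2 (M n) z).1 : R) @ \oo --> (z.2 : R) &
      (fun n => tz (M n) ((cellz2 (M n) z).1 - 1) : R) @ \oo --> (z.2 : R)].
Proof.
have sq (a e : nat -> R) (x : R) : e @ \oo --> (0 : R) -> (forall n, `|a n - x| <= e n) -> a @ \oo --> x.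
  move=> e0 ae; apply/cvgrPdist_le => ep ep0; have /cvgrPdist_le /(_ _ ep0) := e0.
  apply: filterS => n; rewrite sub0r normrN distrC => hn; apply: le_trans (ae n) _.
  exact: le_trans (ler_norm _) hn.
have c1 : (fun n => xgrid (M n) (cellz2 (M n) z).2 : R) @ \oo --> (z.1 : R).
  by apply: (sq _ _ _ dx0) => n; exact: (cellz2_near (M n) z).1.
have c2 : (fun n => tz (M n) (cellz2 (M n) z).1 : R) @ \oo --> (z.2 : R).
  by apply: (sq _ _ _ dt0) => n; exact: (cellz2_near (M n) z).2.
split => //.
- rewrite (_ : (fun n => _) = (fun n => (xgrid (M n) (cellz2 (M n) z).2 : R) + space_step (M n))).
    by rewrite -[X in _ --> X]addr0; apply: cvgD.
  by apply/funext => n; rewrite xgD1.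
- rewrite (_ : (fun n => _) = (fun n => (xgrid (M n) (cellz2 (M n) z).2 : R) - space_step (M n))).
    by rewrite -[X in _ --> X]subr0; apply: cvgB.
  by apply/funext => n; rewrite xgB1.
- rewrite (_ : (fun n => _) = (fun n => (tz (M n) (cellz2 (M n) z).1 : R) - time_step (M n))).
    by rewrite -[X in _ --> X]subr0; apply: cvgB.
  by apply/funext => n; rewrite [in LHS]/tz intrB mulrBl mul1r.
Qed.

Let D_cvg (z : T * T) : (fun n => D n (cellz2 (M n) z)) @ \oo --> (dx3 H z.1 z.2 (c + kap) : R).
Proof.
have [_ cp cm _ ct] := grid_cvg z.
have [Q cQ hQ] := diffquot_x (C1_2_level (c + kap)) cm cp ct.
rewrite (_ : (fun n => _) = Q)//; apply/funext => n.
rewrite /D /Hc; have /= -> := hQ n; rewrite xgD1 xgB1.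
have /lt0r_neq0 := dxp n; set d := (space_step (M n) : R) => d0.
by rewrite (_ : _ + d - (_ - d) = 2 * d) ?mulfK ?mulf_neq0//; ring.
Qed.

(* the last term replaces the source term by Cs f where ub = kap *)
Let G n (z : T * T) : R :=
  `|U n (cellz2 (M n) z) - kap| * lf_dt f (space_step (M n)) (time_step (M n)) z.1 z.2
  + q n (cellz2 (M n) z) * lf_dx f (space_step (M n)) (time_step (M n)) z.1 z.2
  - S n (cellz2 (M n) z) * f z.1 z.2 + (S n (cellz2 (M n) z) + Cs) * (1 - Num.sg (ub z.1 z.2 - kap) ^+ 2) * f z.1 z.2.

Let G_cvg (C : R) (z : T * T) : (fun n => uinterp (M n) (V n) z.1 z.2) @ \oo --> (ub z.1 z.2 : R) ->
  (fun n => G n z + C * time_step (M n) * f z.1 z.2) @ \oo --> (kruzhkov z.1 z.2 : R).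
Proof.
move=> cu.
have cu' : (fun n => U n (cellz2 (M n) z)) @ \oo --> (ub z.1 z.2 : R) by exact: cu.
have ce : (fun n => `|U n (cellz2 (M n) z) - kap|) @ \oo --> (`|ub z.1 z.2 - kap| : R).
  by apply: cvg_norm; apply: cvgB => //; exact: cvg_cst.
have [c1 _ _ c2 _] := grid_cvg z.
have ck : (fun=> kap) @ \oo --> kap by exact: cvg_cst.
have cq := kflux_cvg Hc_C0 ck c1 c2 cu'.
have cdt := @lf_dt_cvg R f f_C1 l0 _ _ z.1 z.2 l0_gt0 dxp dtp (fun n => dx_dt (psV n)) dx0 dt0.
have cdx := @lf_dx_cvg R f f_C1 _ _ z.1 z.2 dxp dx0 dt0.
have cC : (fun n => C * time_step (M n) * f z.1 z.2) @ \oo --> (0 : R).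
  by rewrite -(mul0r (f z.1 z.2)) -(mulr0 C); apply: cvgMl; apply: cvgMr.
rewrite -[X in _ --> X]addr0; apply: cvgD => //.
pose A n := `|U n (cellz2 (M n) z) - kap| * lf_dt f (space_step (M n)) (time_step (M n)) z.1 z.2
  + q n (cellz2 (M n) z) * lf_dx f (space_step (M n)) (time_step (M n)) z.1 z.2.
have c12 : A @ \oo --> `|ub z.1 z.2 - kap| * dt2 f z.1 z.2 + kflux Hc kap z.1 z.2 (ub z.1 z.2) * dx2 f z.1 z.2.
  exact: (cvgD (cvgM ce cdt) (cvgM cq cdx)).
have [e|ne] := eqVneq (ub z.1 z.2) kap.
  rewrite /kruzhkov e subrr sgr0 expr0n subr0 mulr1 mul0r mul0r subr0.
  rewrite e subrr in c12.
  rewrite (_ : G^~ z = (fun n => A n + Cs * f z.1 z.2)); first by apply: cvgD => //; exact: cvg_cst.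
  by apply/funext => n; rewrite /G e subrr sgr0 expr0n subr0 mulr1 /A; ring.
have ne' : ub z.1 z.2 - kap != 0 by rewrite subr_eq0.
rewrite /kruzhkov sqr_sg ne' subrr mulr0 mul0r addr0.
have cS : (fun n => S n (cellz2 (M n) z)) @ \oo --> Num.sg (ub z.1 z.2 - kap) * dx3 H z.1 z.2 (c + kap).
  apply: sg_mul_cvg; [exact: ne'|by apply: cvgB; [exact: cu'|exact: cvg_cst]|exact: D_cvg].
rewrite (_ : G^~ z = (fun n => A n - S n (cellz2 (M n) z) * f z.1 z.2)).
  by apply: cvgB => //; apply: cvgMl.
by apply/funext => n; rewrite /G sqr_sg ne' subrr mulr0 mul0r addr0.
Qed.

(** Dominated convergence in the integrated cell inequality; the discrete slopes
    converge almost everywhere. *)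
Lemma entropy_level : 0 <= \int[leb2]_z kruzhkov z.1 z.2.
Proof.
have [C C_ge0 hC] := cell_ineq.
have [BH hBH] := H_bounded H_per H_C2 (P' + `|c| + `|c|).
pose B1 : R := P + `|c| + `|kap| + `|BH| + `|BH| + Cs.
have PB : 0 <= P + `|c| by rewrite addr_ge0.
have B10 : 0 <= B1 by rewrite /B1 !addr_ge0.
have be n (z : T * T) : `|U n (cellz2 (M n) z) - kap| <= B1.
  apply: le_trans (ler_normB _ _) _; have := Ubound n z.
  by rewrite /B1; have := normr_ge0 BH; have := Cs_ge0; lra.
have bq n (z : T * T) : `|q n (cellz2 (M n) z)| <= B1.
  rewrite /q /kflux normrM.
  have sg1 (y : R) : `|Num.sg y| <= 1 by rewrite normr_sg; case: (_ != 0).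
  apply: le_trans (ler_wpM2r (normr_ge0 _) (sg1 _)) _; rewrite mul1r /Hc.
  apply: le_trans (ler_normB _ _) _.
  have hp : `|c + U n (cellz2 (M n) z)| <= P' + `|c| + `|c|.
    apply: le_trans (ler_normD _ _) _; have := Ubound n z; rewrite /P'.
    by have := normr_ge0 (c + kap); lra.
  have hk : `|c + kap| <= P' + `|c| + `|c|.
    by apply: le_trans kapP' _; rewrite -addrA lerDl addr_ge0.
  have a1 := hBH (xgrid (M n) (cellz2 (M n) z).2) (tz (M n) (cellz2 (M n) z).1) _ hp.
  have a2 := hBH (xgrid (M n) (cellz2 (M n) z).2) (tz (M n) (cellz2 (M n) z).1) _ hk.
  have := ler_norm BH; have := normr_ge0 kap; have := Cs_ge0; rewrite /B1; lra.
have bS n (z : T * T) : `|S n (cellz2 (M n) z)| <= B1.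
  apply: le_trans (S_bound n _) _; rewrite /B1 lerDr !addr_ge0//.
have be1 n (z : T * T) : `| `|U n (cellz2 (M n) z) - kap| | <= B1 by rewrite normr_id.
pose f2 (z : T * T) : R := f z.1 z.2.
have mf2 : measurable_fun [set: T * T] f2.
  by have [_ cf _ _] := f_C1; apply: (measurable_C0_2 cf); [exact: measurable_fst|exact: measurable_snd].
have bf2 : boxed B L f2 by apply: boxedP => // z; exact: fB.
have bS2 n (z : T * T) : 0 <= (S n (cellz2 (M n) z) + Cs) * (1 - Num.sg (ub z.1 z.2 - kap) ^+ 2) * f z.1 z.2.
  apply: mulr_ge0 => //; apply: mulr_ge0.
    by have := S_bound n (cellz2 (M n) z); rewrite ler_norml => /andP[]; lra.
  by rewrite sqr_sg; case: (_ != 0); rewrite ?subrr// subr0.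
pose G0 n (z : T * T) : R :=
  `|U n (cellz2 (M n) z) - kap| * lf_dt f (space_step (M n)) (time_step (M n)) z.1 z.2
  + q n (cellz2 (M n) z) * lf_dx f (space_step (M n)) (time_step (M n)) z.1 z.2
  - S n (cellz2 (M n) z) * f2 z + C * time_step (M n) * f2 z.
pose G1 n (z : T * T) : R := (S n (cellz2 (M n) z) + Cs) * (1 - Num.sg (ub z.1 z.2 - kap) ^+ 2) * f2 z.
pose B2 : R := B1 * (B / l0 + B) + B1 * B + B1 * B + C * B.
pose B3 : R := B2 + (B1 + Cs) * B.
have Bl : 0 <= B / l0 + B by apply: addr_ge0 => //; apply: divr_ge0 => //; exact: ltW.
have B20 : 0 <= B2 by rewrite /B2; apply: addr_ge0; [apply: addr_ge0; [apply: addr_ge0|]|]; exact: mulr_ge0.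
have B30 : 0 <= B3 by rewrite /B3; apply: addr_ge0 => //; apply: mulr_ge0 => //; exact: addr_ge0.
have b0 n z : `|G0 n z| <= B2.
  apply: le_trans (ler_normD _ _) _; apply: lerD.
    apply: le_trans (ler_normB _ _) _; apply: lerD.
      apply: le_trans (ler_normD _ _) _; apply: lerD; rewrite normrM ?normr_id; apply: ler_pM => //.
        exact: (lf_dt_bound f_C1 _ _ (dxp n) (dtp n) l0_gt0 (dx_dt (psV n)) fxB ftB).
      exact: (lf_dx_bound f_C1 _ _ _ (dxp n) fxB ftB).
    by rewrite normrM; apply: ler_pM => //; exact: fB.
  rewrite normrM; apply: ler_pM => //; last exact: fB.
  by rewrite normrM (ger0_norm C_ge0) (gtr0_norm (dtp n)) -[leRHS]mulr1; apply: ler_wpM2l.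
have b1 n z : `|G1 n z| <= (B1 + Cs) * B.
  rewrite normrM; apply: ler_pM => //; last exact: fB.
  rewrite normrM -[leRHS]mulr1; apply: ler_pM => //.
    by apply: le_trans (ler_normD _ _) _; apply: lerD => //; rewrite ger0_norm.
  by rewrite sqr_sg; case: (_ != 0); rewrite ?subrr ?subr0 ?normr0 ?normr1.
have mlf n : measurable_fun [set: T * T] (fun z : T * T => lf_dt f (space_step (M n)) (time_step (M n)) z.1 z.2)
   /\ measurable_fun [set: T * T] (fun z : T * T => lf_dx f (space_step (M n)) (time_step (M n)) z.1 z.2).
  have mp : measurable_fun [set: T * T] (fun z : T * T => f2 (shift2 (space_step (M n)) (time_step (M n)) z)).
    by apply: (measurableT_comp mf2); exact: measurable_shift2.
  have mm : measurable_fun [set: T * T] (fun z : T * T => f2 (shift2 (- space_step (M n)) (time_step (M n)) z)).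
    by apply: (measurableT_comp mf2); exact: measurable_shift2.
  have mk (y : R) : measurable_fun [set: T * T] (fun=> y) by exact: measurable_cst.
  split; apply: measurable_funM; rewrite ?mk//.
    by apply: measurable_funB => //; apply: measurable_funM; rewrite ?mk//; exact: measurable_funD.
  exact: measurable_funB.
have mG0 n : measurable_fun [set: T * T] (G0 n).
  have [m1 m2] := mlf n; have mk (y : R) : measurable_fun [set: T * T] (fun=> y) by exact: measurable_cst.
  apply: measurable_funD; last by apply: measurable_funM.
  apply: measurable_funB; last by apply: measurable_funM => //; exact: (measurable_cellz2 (M n) (S n)).
  apply: measurable_funD; apply: measurable_funM => //.
    exact: (measurable_cellz2 (M n) (fun i => `|U n i - kap|)).
  exact: (measurable_cellz2 (M n) (q n)).
have mG1 n : measurable_fun [set: T * T] (G1 n).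
  have mk (y : R) : measurable_fun [set: T * T] (fun=> y) by exact: measurable_cst.
  have ms : measurable_fun [set: T * T] (fun z : T * T => Num.sg (ub z.1 z.2 - kap)).
    by apply: measurable_sg; exact: measurable_funB.
  apply: measurable_funM => //; apply: measurable_funM.
    by apply: measurable_funD => //; exact: (measurable_cellz2 (M n) (S n)).
  apply: measurable_funB => //.
  by rewrite (_ : (fun z => _) = (fun z : T * T => Num.sg (ub z.1 z.2 - kap) * Num.sg (ub z.1 z.2 - kap))) //; exact: measurable_funM.
have GE n (z : T * T) : G n z + C * time_step (M n) * f2 z = G0 n z + G1 n z.
  by rewrite /G /G0 /G1 /f2; ring.
have mG n : measurable_fun [set: T * T] (fun z => G n z + C * time_step (M n) * f2 z).
  by rewrite (_ : (fun z => _) = (fun z => G0 n z + G1 n z)); [exact: measurable_funD|apply/funext => z; exact: GE].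
have out n (z : T * T) : ~ box (L + 1) z ->
    [/\ f2 z = 0, lf_dt f (space_step (M n)) (time_step (M n)) z.1 z.2 = 0
     & lf_dx f (space_step (M n)) (time_step (M n)) z.1 z.2 = 0].
  move=> nz.
  have far (a b : R) : `|a| <= 1 -> `|b| <= 1 -> f (z.1 + a) (z.2 + b) = 0.
    move=> a1 b1'; apply: (f_box (z := (z.1 + a, z.2 + b))) => bz; apply: nz.
    exact: box_enlarge a1 b1' bz.
  have nx (d : R) : 0 < d -> d <= 1 -> `|d| <= 1 /\ `|- d| <= 1 by move=> d0 d1; rewrite normrN gtr0_norm.
  have [x1 x2] := nx _ (dxp n) (dx1 n); have [t1 _] := nx _ (dtp n) (dt1 n).
  have f0 : f z.1 z.2 = 0 by have := far 0 0; rewrite normr0 !addr0; apply.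
  by rewrite /lf_dt /lf_dx /f2 !far// f0 addr0 mul0r subrr !mul0r.
have bG0 n : boxed B2 (L + 1) (G0 n).
  apply: boxedP => // z nz; have [e1 e2 e3] := out n z nz.
  by rewrite /G0 e1 e2 e3 !mulr0 !addr0 subr0.
have bG n : boxed B3 (L + 1) (fun z => G n z + C * time_step (M n) * f2 z).
  apply: boxedP => // z; first by rewrite GE; apply: le_trans (ler_normD _ _) _; apply: lerD.
  by move=> nz; have [e1 e2 e3] := out n z nz; rewrite GE /G0 /G1 e1 e2 e3 !mulr0 !addr0 subr0.
have pos n : 0 <= \int[leb2]_z (G n z + C * time_step (M n) * f2 z).
  have key := @discrete_weak R (fun z => `|U n (cellz2 (M n) z) - kap|) (fun z => q n (cellz2 (M n) z))
    (fun z => S n (cellz2 (M n) z)) f2 (space_step (M n)) (time_step (M n)) C B1 B L (dxp n) (dtp n) B10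
    (measurable_cellz2 (M n) (fun i => `|U n i - kap|)) (measurable_cellz2 (M n) (q n))
    (measurable_cellz2 (M n) (S n)) mf2 (be1 n) (bq n) (bS n) bf2 (fun z => f_ge0 _ _) (hC n).
  apply: le_trans key _; apply: le_Rintegral => //.
  - exact: (boxed_integrable (mG0 n) (bG0 n)).
  - exact: (boxed_integrable (mG n) (bG n)).
  move=> z _; rewrite /G /lf_dt /lf_dx.
  have := bS2 n z; rewrite /f2 /shift2 /=; lra.
apply: (boxed_limit_ge0 mG measurable_kruzhkov bG) => //.
apply: negligibleS u_cvg => z /= nz cz; apply: nz; exact: G_cvg.
Qed.

End Level.
End EntropyLimit.

(** * The entropy inequality *)

Section Entropy.
Context {R : realType}.
Local Notation T := (measurableTypeR R).
Local Notation leb2 := (@lebesgue_measure R \x @lebesgue_measure R)%E.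
Variable H : R -> R -> R -> R.
Hypothesis H_per : per3 H.
Hypothesis H_C2 : C2_3 H.
Hypothesis H_pp : forall x t p, 0 < dp3 (dp3 H) x t p.
Variables (c l0 l1 P : R).
Hypothesis l0_gt0 : 0 < l0.
Hypothesis l1_gt0 : 0 < l1.
Hypothesis P_ge0 : 0 <= P.
Hypothesis Pcoer : forall x t p, `|dp3 H x t p| <= l1^-1 -> `|p| <= P.
Variables (M : nat -> mesh) (h : nat -> R) (V : nat -> int -> int -> R).
Hypothesis psV : forall n, pscheme H c l0 l1 (M n) (h n) (V n).
Hypothesis dx0 : (fun n => space_step (M n) : R) @ \oo --> (0 : R).
Hypothesis dt0 : (fun n => time_step (M n) : R) @ \oo --> (0 : R).
Variables (ub : R -> R -> R) (C : R).
Hypothesis ub_bound : forall x t, `|ub x t| <= C.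
Hypothesis ub_meas : measurable_fun [set: T * T] (fun z : T * T => ub z.1 z.2).
Hypothesis u_cvg : {ae leb2, forall z : T * T,
  (fun n => uinterp (M n) (V n) z.1 z.2) @ \oo --> (ub z.1 z.2 : R)}.

Let Hc x t p := H x t (c + p).

Let Hc_C0 : C0_3 Hc.
Proof. by have [[_ hC _ _ _] _ _ _] := H_C2; exact: C0_3_shift. Qed.

Lemma kruzhkov_bound (kap Cs BH B : R) (f : R -> R -> R) x t : 0 <= Cs ->
  (forall x t, `|dx3 H x t (c + kap)| <= Cs) ->
  (forall x t p, `|p| <= C + `|c| + `|kap| -> `|H x t p| <= BH) -> 0 <= B ->
  `|f x t| <= B -> `|dx2 f x t| <= B -> `|dt2 f x t| <= B ->
  `|kruzhkov H c ub kap Cs f x t| <= (C + `|kap|) * B + (BH + BH) * B + Cs * B + Cs * B.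
Proof.
move=> Cs0 hx hBH B0 fB fxB ftB; rewrite /kruzhkov.
have sg1 (y : R) : `|Num.sg y| <= 1 by rewrite normr_sg; case: (_ != 0).
have ubx := ub_bound x t; have C0 : 0 <= C := le_trans (normr_ge0 _) ubx.
apply: le_trans (ler_normD _ _) _; apply: lerD.
  apply: le_trans (ler_normB _ _) _; apply: lerD.
    apply: le_trans (ler_normD _ _) _; apply: lerD; rewrite normrM; apply: ler_pM => //.
      by rewrite normr_id; apply: le_trans (ler_normB _ _) _; rewrite lerD2r.
    rewrite /kflux normrM; apply: le_trans (ler_wpM2r (normr_ge0 _) (sg1 _)) _; rewrite mul1r.
    apply: le_trans (ler_normB _ _) _; apply: lerD; apply: hBH.
      apply: le_trans (ler_normD _ _) _; have := normr_ge0 kap; lra.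
    apply: le_trans (ler_normD _ _) _; lra.
  rewrite normrM; apply: ler_pM => //; rewrite normrM -[leRHS]mul1r.
  by apply: ler_pM.
rewrite normrM; apply: ler_pM => //; rewrite normrM (ger0_norm Cs0) -[leRHS]mulr1.
apply: ler_wpM2l => //; rewrite sqr_sg.
by case: (_ != 0); rewrite ?subrr ?subr0 ?normr0 ?normr1.
Qed.

(** The inequalities for the levels kap + e n and kap - e n are averaged. At
    each point u differs from both levels for large n, so the defect disappears,
    and where u = kap the two signs cancel. *)
Lemma entropy_limit : entropy_inequality H c [set: R] ub.
Proof.
move=> kap f f_C1 f_ge0 [K [Kc _ fK]].
rewrite setXTT.
have [L [B [L0 B0 fbox [fB fxB ftB]]]] := test_bounds f_C1 f_ge0 Kc fK.
have [Cs0 hCs0] := Hx_bounded H_per H_C2 (`|c| + `|kap| + 1).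
have [BH0 hBH0] := H_bounded H_per H_C2 (C + `|c| + (`|kap| + 1)).
pose Cs := `|Cs0|; pose BH := `|BH0|.
pose e (n : nat) : R := n.+1%:R^-1.
have e0 n : 0 < e n by rewrite invr_gt0 ltr0n.
have e1 n : e n <= 1 by rewrite invf_le1 ?ltr0n// ler1n.
have near_k k : `|k - kap| <= 1 -> `|k| <= `|kap| + 1.
  by move=> hk; have := ler_normD (k - kap) kap; rewrite subrK; lra.
have kp n : `|kap + e n| <= `|kap| + 1 by apply: near_k; rewrite addrAC subrr add0r gtr0_norm.
have km n : `|kap - e n| <= `|kap| + 1 by apply: near_k; rewrite addrAC subrr add0r normrN gtr0_norm.
have hCs k x t : `|k| <= `|kap| + 1 -> `|dx3 H x t (c + k)| <= Cs.
  move=> hk; apply: le_trans (ler_norm _); apply: hCs0.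
  by apply: le_trans (ler_normD _ _) _; lra.
have hBH x t p : `|p| <= C + `|c| + (`|kap| + 1) -> `|H x t p| <= BH.
  by move=> hp; apply: le_trans (ler_norm _); exact: hBH0.
have Csp : 0 <= Cs by exact: normr_ge0.
have BHp : 0 <= BH by exact: normr_ge0.
have C0 : 0 <= C := le_trans (normr_ge0 _) (ub_bound 0 0).
pose F k (z : T * T) := kruzhkov H c ub k Cs f z.1 z.2.
have mF k : measurable_fun [set: T * T] (F k) by exact: measurable_kruzhkov.
have f0 (z : T * T) : ~ box L z -> [/\ f z.1 z.2 = 0, dx2 f z.1 z.2 = 0 & dt2 f z.1 z.2 = 0].
  move=> nz; have fz := fbox z nz.
  by split => //; [exact: test_zero_dx|exact: test_zero_dt].
pose D := (C + (`|kap| + 1)) * B + (BH + BH) * B + Cs * B + Cs * B.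
have D0 : 0 <= D.
  by rewrite /D; do 3 (apply: addr_ge0; last by apply: mulr_ge0 => //; exact: addr_ge0); apply: mulr_ge0 => //; rewrite !addr_ge0.
have bF k : `|k| <= `|kap| + 1 -> boxed D L (F k).
  move=> hk; apply: boxedP => // z; last first.
    by move=> /f0[z1 z2 z3]; rewrite /F /kruzhkov z1 z2 z3 !mulr0 subr0 !addr0.
  apply: le_trans (kruzhkov_bound Csp _ _ B0 (fB _ _) (fxB _ _) (ftB _ _)) _.
  - by move=> x t; exact: hCs.
  - by move=> x t p hp; apply: hBH; apply: le_trans hp _; rewrite lerD2l.
  by rewrite /D !lerD2r; apply: ler_wpM2r => //; rewrite lerD2l.
have posF k : `|k| <= `|kap| + 1 -> 0 <= \int[leb2]_z F k z.
  move=> hk; apply: (entropy_level H_per H_C2 H_pp l0_gt0 l1_gt0 P_ge0 Pcoer psV dx0 dt0 ub_meas u_cvg Csp _ f_C1 f_ge0 B0 fbox fB fxB ftB).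
  by move=> x t; exact: hCs.
pose A (z : T * T) : R := `|ub z.1 z.2 - kap| * dt2 f z.1 z.2 + Num.sg (ub z.1 z.2 - kap) * (H z.1 z.2 (c + ub z.1 z.2) - H z.1 z.2 (c + kap)) * dx2 f z.1 z.2
  - Num.sg (ub z.1 z.2 - kap) * dx3 H z.1 z.2 (c + kap) * f z.1 z.2.
have mA : measurable_fun [set: T * T] A.
  have := measurable_kruzhkov H_C2 c ub_meas kap 0 f_C1.
  rewrite (_ : (fun z => _) = A)//; apply/funext => z.
  by rewrite /kruzhkov /A /kflux mul0r mul0r addr0.
pose S n (z : T * T) := 1 / 2 * (F (kap + e n) z + F (kap - e n) z).
have mS n : measurable_fun [set: T * T] (S n).
  by apply: measurable_funM; [exact: measurable_cst|exact: measurable_funD].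
have bS n : boxed D L (S n).
  move=> z; have b1 := bF _ (kp n) z; have b2 := bF _ (km n) z.
  rewrite /S normrM (ger0_norm (_ : 0 <= 1 / 2)); last lra.
  have := ler_normD (F (kap + e n) z) (F (kap - e n) z); lra.
have posS n : 0 <= \int[leb2]_z S n z.
  have i1 := boxed_integrable (mF _) (bF _ (kp n)); have i2 := boxed_integrable (mF _) (bF _ (km n)).
  rewrite RintegralZl//; last exact: integrable_sum.
  by rewrite RintegralD//; apply: mulr_ge0; [lra|apply: addr_ge0; exact: posF].
apply: (boxed_limit_ge0 mS mA bS _ posS).
apply: aeW => z.
set x := z.1; set t := z.2; set u := ub x t.
have cE : e @ \oo --> (0 : R) by exact: inv_cvg0.
have ckp : (fun n => kap + e n) @ \oo --> kap.
  by rewrite -[X in _ --> X]addr0; apply: cvgD => //; exact: cvg_cst.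
have ckm : (fun n => kap - e n) @ \oo --> kap.
  by rewrite -[X in _ --> X]subr0; apply: cvgB => //; exact: cvg_cst.
have cx (y : R) : (fun _ : nat => y) @ \oo --> y by exact: cvg_cst.
have ca (k : nat -> R) : k @ \oo --> kap -> (fun n => `|u - k n|) @ \oo --> `|u - kap|.
  by move=> kk; apply: cvg_norm; apply: cvgB.
have cf (k : nat -> R) : k @ \oo --> kap -> (fun n => kflux Hc (k n) x t u) @ \oo --> kflux Hc kap x t u.
  by move=> kk; exact: (kflux_cvg Hc_C0 kk (cx x) (cx t) (cx u)).
have [_ hxC _ _] := H_C2; have [_ hx0 _ _ _] := hxC.
have ch (k : nat -> R) : k @ \oo --> kap -> (fun n => dx3 H x t (c + k n)) @ \oo --> dx3 H x t (c + kap).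
  by move=> kk; apply: (C0_3_cvg hx0 (cx x) (cx t)); apply: cvgD.
have cs := @sg_sum_perturb R (u - kap) _ _ _ (ch _ ckp) (ch _ ckm).
pose T1 n := 1 / 2 * (`|u - (kap + e n)| + `|u - (kap - e n)|) * dt2 f x t.
pose T2 n := 1 / 2 * (kflux Hc (kap + e n) x t u + kflux Hc (kap - e n) x t u) * dx2 f x t.
pose T3 n := 1 / 2 * (Num.sg (u - kap - e n) * dx3 H x t (c + (kap + e n)) + Num.sg (u - kap + e n) * dx3 H x t (c + (kap - e n))) * f x t.
pose d n := (1 - Num.sg (u - kap - 1 * e n) ^+ 2) + (1 - Num.sg (u - kap - (- 1) * e n) ^+ 2).
have SE : S^~ z = (fun n => T1 n + T2 n - T3 n + 1 / 2 * Cs * d n * f x t).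
  apply/funext => n; rewrite /S /F /kruzhkov /T1 /T2 /T3 /d -/x -/t -/u.
  have -> : u - kap - e n = u - (kap + e n) by ring.
  have -> : u - kap + e n = u - (kap - e n) by ring.
  have -> : u - kap - 1 * e n = u - (kap + e n) by ring.
  have -> : u - kap - -1 * e n = u - (kap - e n) by ring.
  by ring.
have half (a b : nat -> R) (l y : R) : a @ \oo --> l -> b @ \oo --> l ->
    (fun n => 1 / 2 * (a n + b n) * y) @ \oo --> l * y.
  move=> al bl; apply: cvgMl.
  have -> : l = 1 / 2 * (l + l) by field.
  by apply: cvgMr; apply: cvgD.
have c1 : T1 @ \oo --> `|u - kap| * dt2 f x t by apply: half; exact: ca.
have c2 : T2 @ \oo --> kflux Hc kap x t u * dx2 f x t by apply: half; exact: cf.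
have c3 : T3 @ \oo --> Num.sg (u - kap) * dx3 H x t (c + kap) * f x t.
  apply: cvgMl.
  have -> : Num.sg (u - kap) * dx3 H x t (c + kap) = 1 / 2 * (2 * (Num.sg (u - kap) * dx3 H x t (c + kap))) by field.
  by apply: cvgMr.
have c4 : (fun n => 1 / 2 * Cs * d n * f x t) @ \oo --> (0 : R).
  have p1 : \forall n \near \oo, Num.sg (u - kap - 1 * e n) ^+ 2 = 1 by apply: sg_perturb; exact: oner_neq0.
  have p2 : \forall n \near \oo, Num.sg (u - kap - (- 1) * e n) ^+ 2 = 1.
    by apply: sg_perturb; rewrite oppr_eq0; exact: oner_neq0.
  apply: cvg_near_cst; near=> n.
  have q1 : Num.sg (u - kap - 1 * e n) ^+ 2 = 1 by near: n.
  have q2 : Num.sg (u - kap - (- 1) * e n) ^+ 2 = 1 by near: n.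
  by rewrite /d q1 q2 subrr addr0 mulr0 mul0r.
rewrite SE -[X in _ --> X]addr0; apply: cvgD => //.
exact: (cvgB (cvgD c1 c2) c3).
Unshelve. all: by end_near.
Qed.

End Entropy.

(** * Averages over cells and step functions *)

Section EssentiallyBounded.
Context {R : realType}.
Local Notation T := (measurableTypeR R).
Local Notation leb := (@lebesgue_measure R).
Implicit Types (u : R -> R) (a b B d : R).

Lemma leb_itv a b : a <= b -> leb (`[a, b]%classic : set T) = (b - a)%:E.
Proof.
rewrite le_eqVlt => /orP[/eqP ->|ab]; rewrite lebesgue_measure_itv /=.
  by rewrite ltxx subrr.
by rewrite lte_fin ab EFinB.
Qed.

Lemma normLinf_le u B : (normLinf u <= B%:E)%E -> {ae leb, forall x, `|u x| <= B}.
Proof.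
rewrite /normLinf unlock ifT => [/ess_supP|].
  by apply: negligibleS => x /= nx hx; apply: nx; move: hx; rewrite lee_fin.
apply: (@lt_le_trans _ _ (leb (`[0, 1]%classic : set T))).
  by rewrite leb_itv// subr0 lte_fin.
by apply: le_measure; rewrite ?inE//; exact: measurable_itv.
Qed.

Lemma normLinf_ge u B : 0 <= B -> {ae leb, forall x, `|u x| <= B} -> (normLinf u <= B%:E)%E.
Proof.
move=> B0 h; rewrite /normLinf unlock; case: ifPn => _; last by rewrite lee_fin.
apply/ess_supP; apply: negligibleS h => x /= nx hx; apply: nx.
by rewrite lee_fin.
Qed.

Section Bounded.
Variables (u : R -> R) (B : R).
Hypothesis u_meas : measurable_fun [set: R] u.
Hypothesis u_bnd : {ae leb, forall x, `|u x| <= B}.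

Let mi a b : measurable (`[a, b]%classic : set T). Proof. exact: measurable_itv. Qed.

Let int_le a b : a <= b -> (\int[leb]_(x in `[a, b]) `|u x|%:E <= (`|B| * (b - a))%:E)%E.
Proof.
move=> ab.
have -> : (`|B| * (b - a))%:E = (\int[leb]_(x in `[a, b]) (cst `|B|%:E) x)%E.
  by rewrite integral_cst//= leb_itv// EFinM.
apply: ae_ge0_le_integral => //.
- apply: (measurable_funS measurableT) => //; apply/measurable_EFinP.
  exact: measurableT_comp.
- by move=> x _; rewrite lee_fin.
- by apply: negligibleS u_bnd => x /= nx hx; apply: nx => _; rewrite lee_fin (le_trans hx)// ler_norm.
Qed.

Lemma ebnd_integrable a b : leb.-integrable `[a, b] (EFin \o u).
Proof.
have [ab|ba] := leP a b; last first.
  by rewrite set_itv_ge ?bnd_simp -?ltNge//; exact: integrable_set0.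
apply/integrableP; split.
  by apply: (measurable_funS measurableT) => //; exact/measurable_EFinP.
by apply: le_lt_trans (int_le ab) _; rewrite ltry.
Qed.

Lemma Rint_le a b : 0 <= B -> a <= b -> `|\int[leb]_(x in `[a, b]) u x| <= B * (b - a).
Proof.
move=> B0 ab; apply: le_trans (le_normr_Rintegral (mi a b) (ebnd_integrable a b)) _.
have := int_le ab; rewrite (ger0_norm B0) /Rintegral => h.
have i0 : (0 <= \int[leb]_(x in `[a, b]) `|u x|%:E)%E by apply: integral_ge0 => x _; rewrite lee_fin.
rewrite -lee_fin fineK//.
by rewrite ge0_fin_numE//; apply: le_lt_trans h _; rewrite ltry.
Qed.

Lemma Rint_split a b d : a <= b -> b <= d ->
  \int[leb]_(x in `[a, d]) u x = \int[leb]_(x in `[a, b]) u x + \int[leb]_(x in `[b, d]) u x.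
Proof.
move=> ab bd; have ad := ebnd_integrable a d.
have := @Rintegral_itvB R u (BLeft a) (BRight d) b ad; rewrite !bnd_simp => /(_ ab bd).
rewrite Rintegral_itv_obnd_cbnd; first by move=> <-; ring.
apply: integrableS ad => //.
by move=> x /=; rewrite !in_itv /= => /andP[h1 h2]; rewrite h2 (le_trans ab (ltW h1)).
Qed.

End Bounded.

Lemma ae_translate u B d : {ae leb, forall x, `|u x| <= B} -> {ae leb, forall x : R, `|u (x + d)| <= B}.
Proof.
move=> [A [mA A0 uA]]; exists ((fun x : T => (x + d : T)) @^-1` A); split.
- by rewrite -[X in measurable X]setTI; exact: measurable_translation.
- by have := lebesgue_translation d mA; rewrite A0.
- by move=> x /= hx; apply: uA.
Qed.

Lemma integral_translation d (D : set T) (f : T -> \bar R) :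
  (\int[pushforward leb (fun x : T => ((x + d)%R : T))]_(x in D) f x = \int[leb]_(x in D) f x)%E.
Proof.
apply: eq_measure_integral; first exact: measurable_translation.
by move=> mf A mA _; exact: lebesgue_translation.
Qed.

Lemma Rint_translate u B a b d : measurable_fun [set: R] u -> {ae leb, forall x, `|u x| <= B} ->
  \int[leb]_(x in `[a + d, b + d]) u x = \int[leb]_(x in `[a, b]) u (x + d).
Proof.
move=> u_meas u_bnd; rewrite /Rintegral; congr fine.
have pE : (fun x : T => (x + d : T)) @^-1` `[a + d, b + d]%classic = `[a, b]%classic.
  by apply/seteqP; split => z /=; rewrite !in_itv /= !lerD2r.
rewrite -(integral_translation d) (integral_pushforward (measurable_translation d)) ?pE//.
  exact/measurable_EFinP.
apply: (ebnd_integrable (u := fun x => u (x + d)) _ (ae_translate d u_bnd)).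
by apply: measurableT_comp => //; exact: measurable_translation.
Qed.

Lemma Rint_periodic u B a b : measurable_fun [set: R] u -> {ae leb, forall x, `|u x| <= B} ->
  periodic u 1 -> \int[leb]_(x in `[a + 1, b + 1]) u x = \int[leb]_(x in `[a, b]) u x.
Proof. by move=> um ub up; rewrite (Rint_translate a b 1 um ub); apply: eq_Rintegral => x _; exact: up. Qed.

Lemma Rint_ae_cst u k a b : measurable_fun [set: R] u -> a <= b ->
  {ae leb, forall x, a <= x < b -> u x = k} -> \int[leb]_(x in `[a, b]) u x = k * (b - a).
Proof.
move=> um ab h.
have mi0 : measurable (`[a, b]%classic : set T) by exact: measurable_itv.
transitivity (\int[leb]_(x in `[a, b]) (cst k x)); last first.
  transitivity (k * fine (leb (`[a, b]%classic : set T))); last by rewrite leb_itv.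
  exact: (Rintegral_cst leb mi0 k).
have mi : measurable (`[a, b]%classic : set T) by exact: measurable_itv.
rewrite /Rintegral; congr fine; apply: ae_eq_integral => //.
- by apply: (measurable_funS measurableT) => //; exact/measurable_EFinP.
- by apply/measurable_EFinP; exact: measurable_cst.
- have nb : leb.-negligible [set b].
    by exists [set b]; split => //; exact: lebesgue_measure_set1.
  have := negligibleU h nb; apply: negligibleS => x /= /not_implyP[xab ux].
  have [->|xb] := eqVneq x b; first by right.
  left => hx; apply: ux; congr EFin; apply: hx.
  by move: xab; rewrite in_itv /= lt_neqAle xb => /andP[-> ->].
Qed.

(** Turns an identity that holds almost everywhere into one for grid values,
    because step functions are constant on cells. *)
Lemma ae_itv_meet (Q : R -> Prop) a b : a < b -> {ae leb, forall x, Q x} -> exists2 x, a <= x < b & Q x.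
Proof.
move=> ab [A [mA A0 QA]]; apply: contrapT => nx.
have sub : `[a, b[%classic `<=` A.
  move=> x /=; rewrite in_itv /= => xab; apply: QA => /= qx; apply: nx; by exists x.
have : (leb (`[a, b[%classic : set T) <= leb A)%E.
  by apply: le_measure => //; rewrite inE//; exact: measurable_itv.
rewrite [X in (_ <= X)%E]A0 lebesgue_measure_itv /= lte_fin ab -EFinB lee_fin; lra.
Qed.

End EssentiallyBounded.

Section StepFunctions.
Context {R : realType}.
Local Notation leb := (@lebesgue_measure R).
Variable (H : R -> R -> R -> R) (M : mesh) (c : R).
Local Notation dx := (space_step M : R).
Local Notation N := (mesh_N M).
Local Notation xg := (@xgrid R M).
Let dx_gt0 : 0 < dx. Proof. exact: space_step_gt0. Qed.
Let dx2_gt0 : 0 < 2 * dx. Proof. by rewrite mulr_gt0. Qed.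

Lemma cell_cellz (k : nat) (x : R) : cell M k x = cellz M k%:Z x.
Proof. by []. Qed.

Lemma LF0 (u0 : R -> R) m : LF H M c u0 0 m * (2 * dx) = \int[leb]_(x in `[xg m - dx, xg m + dx]) u0 x.
Proof. by rewrite /= mulrC mulrA divff ?mul1r// lt0r_neq0. Qed.

Section Averages.
Variables (u0 : R -> R) (B : R).
Hypothesis u_meas : measurable_fun [set: R] u0.
Hypothesis u_bnd : {ae leb, forall x, `|u0 x| <= B}.
Hypothesis B0 : 0 <= B.
Hypothesis u_per : periodic u0 1.

Lemma LF0_bound m : `|LF H M c u0 0 m| <= B.
Proof.
have le : xg m - dx <= xg m + dx by have := dx_gt0; lra.
have := Rint_le u_meas u_bnd B0 le; rewrite -LF0 normrM (gtr0_norm dx2_gt0).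
by rewrite (_ : xg m + dx - (xg m - dx) = 2 * dx) ?ler_pM2r//; ring.
Qed.

Lemma LF0_per m : LF H M c u0 0 (m + (2 * N)%N%:Z) = LF H M c u0 0 m.
Proof.
apply: (mulIf (lt0r_neq0 dx2_gt0)); rewrite !LF0 xgrid_period.
have q1 : xg m + 1 - dx = xg m - dx + 1 by ring.
have q2 : xg m + 1 + dx = xg m + dx + 1 by ring.
rewrite q1 q2; exact: Rint_periodic u_meas u_bnd u_per.
Qed.

(** The cells around the even nodes tile the period from - dx to 1 - dx. *)
Lemma LF0_sum : (2 * dx) * \sum_(i < N) LF H M c u0 0 ((2 * i)%N%:Z) = \int[leb]_(x in `[0, 1]) u0 x.
Proof.
have S (n : nat) : (2 * dx) * \sum_(i < n) LF H M c u0 0 ((2 * i)%N%:Z) =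
    \int[leb]_(x in `[- dx, xg ((2 * n)%N%:Z) - dx]) u0 x.
  elim: n => [|n IH].
    rewrite big_ord0 mulr0 muln0 /xgrid mul0r sub0r.
    by rewrite (@Rint_ae_cst _ _ 0)// ?mul0r//; apply: aeW => x /andP[] /le_lt_trans h /h; rewrite ltxx.
  have nn : 0 <= xg ((2 * n)%N%:Z) by rewrite /xgrid mulr_ge0// ?ler0z// ltW.
  have e : xg ((2 * n.+1)%N%:Z) = xg ((2 * n)%N%:Z) + 2 * dx.
    by rewrite /xgrid mulnS addnC PoszD intrD mulrDl.
  rewrite big_ord_recr mulrDr IH [in RHS]e.
  rewrite [RHS](Rint_split u_meas u_bnd (b := xg ((2 * n)%N%:Z) - dx)); [|have := dx_gt0; lra|have := dx_gt0; lra].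
  congr (_ + _); rewrite -[LHS]mulrC -[X in X * _]/(LF H M c u0 0 (2 * n)%N%:Z) LF0.
  by have -> : xg ((2 * n)%N%:Z) + 2 * dx - dx = xg ((2 * n)%N%:Z) + dx by ring.
have e1 : xg ((2 * N)%N%:Z) = 1 by rewrite /xgrid space_period.
have dx1 : dx <= 1.
  have k0 : (0 < N)%N := mesh_N_gt0 M.
  rewrite /space_step invf_le1; last by rewrite mulr_gt0// ltr0n.
  by move: k0; rewrite -(ler1n R) => ?; lra.
rewrite S e1 (Rint_split u_meas u_bnd (b := 0)); [|have := dx_gt0; lra|lra].
rewrite [RHS](Rint_split u_meas u_bnd (b := 1 - dx)); [|lra|have := dx_gt0; lra].
rewrite addrC; congr (_ + _); rewrite -(Rint_periodic _ _ u_meas u_bnd u_per).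
by rewrite [- dx + 1]addrC add0r.
Qed.

End Averages.

Lemma measurable_cellz (s : int -> R) (k : int) : measurable_fun [set: R] (fun x => s (cellz M k x)).
Proof.
pose q (x : measurableTypeR R) : int := Num.floor ((x / dx - k%:~R + 1) / 2).
apply: (@measurable_countable_comp _ (measurableTypeR R) R int q (fun i => s (2 * i + k))) => i.
apply: measurable_floor; apply: measurable_funM; last exact: measurable_cst.
apply: measurable_funD; last exact: measurable_cst.
apply: measurable_funB; last exact: measurable_cst.
by apply: measurable_funM; [exact: measurable_id|exact: measurable_cst].
Qed.

Definition step_fun (s : int -> R) (x : R) : R := s (cellz M 0 x).

Lemma step_fun_meas s : measurable_fun [set: R] (step_fun s).
Proof. exact: measurable_cellz. Qed.

Lemma step_fun_per s : (forall m, s (m + (2 * N)%N%:Z) = s m) -> periodic (step_fun s) 1.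
Proof. by move=> sp x; rewrite /step_fun cellz_add1 sp. Qed.

Lemma step_fun_avg s m : grid_even 0 m -> LF H M c (step_fun s) 0 m = s m.
Proof.
move=> em; apply: (mulIf (lt0r_neq0 dx2_gt0)); rewrite LF0.
rewrite (Rint_ae_cst (k := s m) (step_fun_meas s)); [|have := dx_gt0; lra|].
  by congr (_ * _); ring.
apply: aeW => x; rewrite -xgB1 -xgD1 => hx; rewrite /step_fun (cellz_unique _ hx)//.
Qed.

End StepFunctions.

(** * Periodic difference solutions *)

Section PeriodicSchemes.
Context {R : realType}.
Local Notation leb := (@lebesgue_measure R).
Variable H : R -> R -> R -> R.
Hypothesis H_per : per3 H.
Hypothesis H_C2 : C2_3 H.
Hypothesis H_pp : forall x t p, 0 < dp3 (dp3 H) x t p.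
Variables (M : mesh) (c r l0 l1 : R).
Hypothesis r_ge0 : 0 <= r.
Hypothesis l0_gt0 : 0 < l0.
Hypothesis l1_gt0 : 0 < l1.
Hypothesis ratioM : l0 <= mesh_ratio M < l1.
Hypothesis CFL : forall u0, Linf_r0 r u0 ->
  (forall k m, grid_even k m -> `|dp3 H (xgrid M m) (tgrid M k) (c + LF H M c u0 k m)| <= l1^-1) /\
  (normLinf (phi_Delta H M c 1%R u0) <= r%:E)%E.

Local Notation dx := (space_step M : R).
Local Notation dt := (time_step M : R).
Local Notation N := (mesh_N M).
Local Notation K := (mesh_K M).
Local Notation xg := (@xgrid R M).
Local Notation GHJ := (GHJ H M c).

Let lam_l1 : (mesh_ratio M : R) < l1. Proof. by case/andP: ratioM. Qed.
Let dx_gt0 : 0 < dx. Proof. exact: space_step_gt0. Qed.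
Let dt_gt0 : 0 < dt. Proof. exact: time_step_gt0. Qed.

Lemma time_index1 : time_index M (1 : R) = (2 * K)%N.
Proof.
rewrite /time_index -(@time_period R M) mulfK ?lt0r_neq0//.
exact: natrK.
Qed.

Lemma slope_telescope (w : int -> R) : (forall m, w (m + (2 * N)%N%:Z) = w m) ->
  \sum_(i < N) slope M w (2 * i)%N%:Z = 0.
Proof.
move=> wP.
have S (n : nat) : \sum_(i < n) slope M w (2 * i)%N%:Z = (w ((2 * n)%N%:Z - 1) - w (0 - 1)) / (2 * dx).
  elim: n => [|n IH]; first by rewrite big_ord0 muln0 subrr mul0r.
  rewrite big_ord_recr /= IH /slope -mulrDl; congr (_ / _).
  have -> : (2 * n.+1)%N%:Z - 1 = (2 * n)%N%:Z + 1 by lia.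
  by ring.
have -> : \sum_(i < N) slope M w (2 * i)%N%:Z = (w ((2 * N)%N%:Z - 1) - w (0 - 1)) / (2 * dx) := S N.
have -> : (2 * N)%N%:Z - 1 = 0 - 1 + (2 * N)%N%:Z by ring.
by rewrite wP subrr mul0r.
Qed.

Lemma slope_per (w : int -> R) : (forall m, w (m + (2 * N)%N%:Z) = w m) ->
  forall m, slope M w (m + (2 * N)%N%:Z) = slope M w m.
Proof.
move=> wP m; rewrite /slope.
have -> : m + (2 * N)%N%:Z + 1 = m + 1 + (2 * N)%N%:Z by ring.
have -> : m + (2 * N)%N%:Z - 1 = m - 1 + (2 * N)%N%:Z by ring.
by rewrite !wP.
Qed.

(** Slopes of grid functions, as step functions, are admissible initial data; so
    the assumptions on all initial data apply to grid functions. *)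
Lemma slope_step_Linf (w : int -> R) : w_ok M r w -> Linf_r0 r (step_fun M (slope M w)).
Proof.
move=> [wP wr].
have sP := slope_per wP.
have sb x : `|step_fun M (slope M w) x| <= r by apply: wr; exact: cellz_evn.
have sae : {ae leb, forall x, `|step_fun M (slope M w) x| <= r} by exact: aeW.
have nle : (normLinf (step_fun M (slope M w)) <= r%:E)%E by exact: normLinf_ge.
have spe := step_fun_per sP; have sm := @step_fun_meas R M (slope M w).
split=> //; split=> //; first exact: le_lt_trans nle (ltry _).
have := LF0_sum H M c sm sae spe.
rewrite (eq_bigr (fun i : 'I_N => slope M w (2 * i)%N%:Z)); last first.
  by move=> i _; apply: step_fun_avg; rewrite /grid_even; lia.
by rewrite slope_telescope// mulr0 => <-.
Qed.

Lemma LF_slope (u0 : R -> R) (w : int -> R) h : (forall m, grid_even 0 m -> LF H M c u0 0 m = slope M w m) ->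
  forall k m, grid_even k m -> LF H M c u0 k m = slope M (GHJ h w k) m.
Proof. by move=> e k m em; rewrite LF_grid; exact: (@GHJ_slope R H M c h w _ e k m em). Qed.

Lemma phi_cell (u0 : R -> R) (k : nat) m x t : time_index M t = k -> grid_even k m -> xg (m - 1) <= x < xg (m + 1) ->
  phi_Delta H M c t u0 x = LF H M c u0 k m.
Proof.
by move=> tk em hx; rewrite /phi_Delta tk cell_cellz (cellz_unique _ hx)//; move: em; rewrite /grid_even /evn.
Qed.

Lemma xg_lt m : xg (m - 1) < xg (m + 1).
Proof. by rewrite xgB1 xgD1; have := dx_gt0; lra. Qed.

Lemma CFLw (w : int -> R) : w_ok M r w ->
  (forall k m, grid_even k m -> cfl_at H M c l1 k (GHJ 0 w k) m) /\
  (forall m, grid_even 0 m -> `|slope M (GHJ 0 w (2 * K)) m| <= r).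
Proof.
move=> wok; have [h1 h2] := CFL (slope_step_Linf wok).
have e0 m : grid_even 0 m -> LF H M c (step_fun M (slope M w)) 0 m = slope M w m by exact: step_fun_avg.
have e := LF_slope 0 e0.
split=> [k m em|m em]; first by rewrite /cfl_at -e//; exact: h1.
have em' : grid_even (2 * K) m by move: em; rewrite /grid_even; clear; lia.
have [x hx] := ae_itv_meet (xg_lt m) (normLinf_le h2).
by rewrite (phi_cell _ time_index1 em' hx) e.
Qed.

Let fixed_exists' := fixed_exists H_per H_C2 H_pp l1_gt0 lam_l1 r_ge0 CFLw.

Lemma psi_interp (h t x : R) (v0 : R -> R) : psi_Delta H M c h t v0 x =
  interp M (time_index M t)%:Z (GHJ h (fun m => v0 (xg m)) (time_index M t)) x.
Proof.
rewrite /psi_Delta /interp /slope cell_cellz; set k := time_index M t.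
have e m : HJ H M c h v0 k m = GHJ h (fun m => v0 (xg m)) k m by exact: HJ_grid.
by rewrite !e.
Qed.

Lemma psi_fixed_grid h v0 : Lip_r r v0 -> psi_Delta H M c h 1 v0 =1 v0 ->
  w_fixed H M c r h (fun m => v0 (xg m)).
Proof.
move=> [vP vL] vf; split; [split|].
- by move=> m; rewrite xgrid_period vP.
- move=> m em; rewrite /slope normrM normfV (gtr0_norm (_ : 0 < 2 * dx)) ?mulr_gt0//.
  rewrite ler_pdivrMr ?mulr_gt0//.
  have := vL (xg (m + 1), xg (m - 1)) (conj I I) => /=; rewrite xgD1 xgB1 => /le_trans; apply.
  rewrite (_ : xg m + dx - (xg m - dx) = 2 * dx); last by ring.
  by rewrite gtr0_norm ?mulr_gt0.
move=> m om; rewrite -[RHS]vf psi_interp time_index1 interp_node//.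
by move: om; rewrite /grid_odd /grid_even /evn; lia.
Qed.

Lemma interp_parity (k j : int) (v v' : int -> R) x : evn 0 (k - j) -> (forall m, ~~ evn j m -> v m = v' m) ->
  interp M k v x = interp M j v' x.
Proof.
move=> e vv; have ce : cellz M k x = cellz M j x by exact: cellz_evn_eq.
rewrite /interp ce /slope.
by rewrite !vv// evnE cellz_evn.
Qed.

Lemma interp_Lip_r (w : int -> R) : w_ok M r w -> Lip_r r (interp M 0 w).
Proof.
move=> [wP wr]; split.
  move=> x; rewrite /interp cellz_add1 (slope_per wP).
  set m := cellz M 0 x.
  have -> : m + (2 * N)%N%:Z - 1 = m - 1 + (2 * N)%N%:Z by ring.
  by rewrite wP xgrid_period; congr (_ + _ * _); ring.
by move=> [x y] _ /=; apply: interp_lip => m em; exact: wr.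
Qed.

Lemma interp_psi_fixed h w : w_fixed H M c r h w -> psi_Delta H M c h 1 (interp M 0 w) =1 interp M 0 w.
Proof.
move=> [wok wf] x; rewrite psi_interp time_index1.
apply: interp_parity; first by rewrite /evn; lia.
move=> m om; have om' : grid_odd 0 m by [].
rewrite -[RHS](wf m om').
have e := @GHJ_eq R H M c h (fun m => interp M 0 w (xg m)) w.
apply: e; first by move=> j oj; apply: interp_node.
by move: om'; rewrite /grid_odd /grid_even; lia.
Qed.

(** There is something for [get] to choose. *)
Lemma hbar_vbar0 : Lip_r r (vbar0_Delta H r c M) /\
  psi_Delta H M c (hbar_Delta H r c M) 1 (vbar0_Delta H r c M) =1 vbar0_Delta H r c M.
Proof.
have [h0 [w0 wf]] := fixed_exists'.
have ex : exists h, exists v0, Lip_r r v0 /\ psi_Delta H M c h 1 v0 =1 v0.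
  by exists h0, (interp M 0 w0); split; [exact: interp_Lip_r wf.1|exact: interp_psi_fixed].
have ex2 := getPex ex.
exact: (getPex (ex2 : exists v0 : R -> R, _)).
Qed.

Let hb := hbar_Delta H r c M.
Let w (m : int) : R := vbar0_Delta H r c M (xg m).
Let wfix : w_fixed H M c r hb w.
Proof. by have [h1 h2] := hbar_vbar0; exact: psi_fixed_grid. Qed.

Lemma ubar0_spec : Linf_r0 r (ubar0_Delta H r c M) /\
  {ae @mu1 R, forall x, phi_Delta H M c 1 (ubar0_Delta H r c M) x = ubar0_Delta H r c M x}.
Proof.
apply: (@getPex (R -> R) [set u0 : R -> R | Linf_r0 r u0 /\ {ae @mu1 R, forall x, phi_Delta H M c 1 u0 x = u0 x}]).
exists (step_fun M (slope M w)); split; first exact: slope_step_Linf wfix.1.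
apply: aeW => x.
have e0 m : grid_even 0 m -> LF H M c (step_fun M (slope M w)) 0 m = slope M w m by exact: step_fun_avg.
have em : grid_even (2 * K) (cellz M 0 x).
  by have := cellz_evn M 0 x; rewrite /grid_even /evn; lia.
rewrite (phi_cell _ time_index1 em (cellz_itv M 0 x)) (LF_slope hb e0 em) /step_fun /slope.
have [_ wf] := wfix.
by rewrite !wf//; move: em; rewrite /grid_odd /grid_even; clear; lia.
Qed.

Let s (m : int) : R := LF H M c (ubar0_Delta H r c M) 0 m.

(* the fixed point chosen by get has the right cell averages by uniqueness *)
Let s_slope m : grid_even 0 m -> s m = slope M w m.
Proof.
have [[[up um ufin u0] ur] uf] := ubar0_spec.
have uae := normLinf_le ur.
apply: (LF_fixed_slope H_per H_C2 H_pp l1_gt0 lam_l1 r_ge0 CFLw wfix).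
- exact: (LF0_per H M c um uae up).
- by move=> j _; exact: LF0_bound.
- have := LF0_sum H M c um uae up; rewrite u0 => /eqP.
  by rewrite mulf_eq0 gt_eqF ?mulr_gt0//= => /eqP.
move=> j ej; have ej' : grid_even (2 * K) j by move: ej; rewrite /grid_even; clear; lia.
rewrite /s -(LF_grid H M c _ (2 * K) j).
have dx2 : 0 < 2 * dx by rewrite mulr_gt0.
apply: (mulIf (lt0r_neq0 dx2)); rewrite [RHS]LF0.
have le : xg j - dx <= xg j + dx by have := dx_gt0; lra.
rewrite (Rint_ae_cst (k := LF H M c (ubar0_Delta H r c M) (2 * K) j) um le); first by congr (_ * _); ring.
apply: negligibleS uf => x /= nx hx; apply: nx; rewrite -xgB1 -xgD1 => hxj.
by rewrite -hx (phi_cell _ time_index1 ej' hxj).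
Qed.

Lemma periodic_scheme : exists V,
  pscheme H c l0 l1 M hb V /\
  forall x t, 0 <= t < 1 -> vbar_Delta H r c M x t = vinterp M V x t /\ ubar_Delta H r c M x t = uinterp M V x t.
Proof.
pose V k := GHJ hb w `|(k %% (2 * K)%N%:Z)%Z|%N; exists V.
have [wok wf] := wfix.
split.
  apply: (@pscheme_of_fixed R H H_per c l0 l1 l0_gt0 l1_gt0 M hb w ratioM wok.1 wf).
  move=> k m em; have [h1 _] := CFLw wok.
  rewrite /cfl_at.
  have -> : slope M (GHJ hb w k) m = slope M (GHJ 0 w k) m.
    by rewrite /slope (GHJ_shift_h H M c hb w k (m + 1)) (GHJ_shift_h H M c hb w k (m - 1)); congr (_ / _); ring.
  exact: h1.
move=> x t /andP[t0 t1].
have K0 : (0 < K)%N by exact: mesh_K_gt0.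
have fl0 : 0 <= Num.floor (t / dt) by rewrite floor_ge0 divr_ge0// ltW.
have tk : (time_index M t)%:Z = layer M t.
  by rewrite /time_index /layer truncn_floor divr_ge0 ?(ltW dt_gt0)// gez0_abs.
have kT : (time_index M t < 2 * K)%N.
  rewrite -ltz_nat tk /layer -(ltr_int R); apply: le_lt_trans (floor_le _) _.
  by rewrite ltr_pdivrMr// -pmulrn time_period.
have VE : V (layer M t) = GHJ hb w (time_index M t).
  by rewrite /V -tk modz_small// ltz_nat kT.
split.
  by rewrite /vbar_Delta psi_interp /vinterp VE -tk.
rewrite /ubar_Delta /phi_Delta cell_cellz /uinterp /interp_slope VE -tk.
by apply: (LF_slope hb s_slope); have := cellz_evn M (time_index M t)%:Z x; rewrite /grid_even /evn.
Qed.

End PeriodicSchemes.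

(** * Passage to the limit along a sequence of meshes *)

Section Assembly.
Context {R : realType}.

Lemma uinterp_measurable (M : mesh) (V : int -> int -> R) t : measurable_fun [set: R] (fun x => uinterp M V x t).
Proof. exact: (measurable_cellz M (slope M (V (layer M t))) (layer M t)). Qed.

Lemma pscheme_addc (H : R -> R -> R -> R) c l0 l1 M h (V : int -> int -> R) a :
  pscheme H c l0 l1 M h V -> pscheme H c l0 l1 M h (fun k m => V k m + a).
Proof.
move=> [rt xp tp rc cf].
have sl k m : slope M (fun m => V k m + a) m = slope M (V k) m.
  by rewrite /slope; congr (_ / _); ring.
split => //.
- by move=> k m; rewrite xp.
- by move=> k m om; rewrite tp.
- by move=> k m em; rewrite sl rc//; field.
- by move=> k m em; rewrite sl cf.
Qed.

Lemma ereal_cvg0 (f : nat -> \bar R) : (forall n, (0 <= f n)%E) ->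
  (forall ep : R, 0 < ep -> \forall n \near \oo, (f n <= ep%:E)%E) -> f @ \oo --> 0%E.
Proof.
move=> f0 fe; apply/fine_cvgP; split.
  have := fe 1 ltr01; apply: filterS => n h.
  by rewrite ge0_fin_numE//; apply: le_lt_trans h (ltry _).
apply/cvgrPdist_le => ep ep0; have := fe _ ep0; apply: filterS => n h.
rewrite sub0r normrN ger0_norm ?fine_ge0// -lee_fin fineK//.
by rewrite ge0_fin_numE//; apply: le_lt_trans h (ltry _).
Qed.

Lemma squeeze0 (a : nat -> R) : (forall n, 0 <= a n) -> (forall n, a n <= n.+1%:R^-1) -> a @ \oo --> (0 : R).
Proof.
move=> a0 ha; apply/cvgrPdist_le => ep ep0; have := inv_small ep0; apply: filterS => n h.
by rewrite sub0r normrN ger0_norm//; apply: le_trans (ha n) h.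
Qed.

(** The error of the one-sided bound for steps of size h, plus the error in
    difference quotients of size h made by replacing a function by one at
    distance e. *)
Definition defect (E dx e h : R) : R := E * (h + 2 * dx) + 2 * e / h.

(** The one-sided bounds place the slope between the difference quotients of the
    interpolant, which differ from those of v by at most 2 e / h. *)
Lemma slope_sandwich (M : mesh) (V : int -> int -> R) (v : R -> R -> R) (E e : R) : 0 <= E ->
  (forall k m, ~~ evn k m -> slope M (V k) (m + 1) - slope M (V k) (m - 1) <= 2 * space_step M * E) ->
  (forall x t, `|vinterp M V x t - v x t| <= e) ->
  forall h x t, 0 < h -> fwd_quot (v ^~ t) h x - defect E (space_step M) e h <= uinterp M V x t
    <= bwd_quot (v ^~ t) h x + defect E (space_step M) e h.
Proof.
move=> E0 os cl h x t h0; set k := defect _ _ _ _.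
have r1 := one_sided_right E0 (os (layer M t)) x h0.
have r2 := one_sided_left E0 (os (layer M t)) x h0.
rewrite -/(vinterp M V (x + h) t) -/(vinterp M V x t) -/(vinterp M V (x - h) t) -/(uinterp M V x t) in r1 r2.
move: (cl (x + h) t) (cl x t) (cl (x - h) t); rewrite !ler_norml => /andP[? ?] /andP[? ?] /andP[? ?].
have hk : h * k = E * (h * (h + 2 * space_step M)) + 2 * e.
  by rewrite /k /defect mulrDr [X in _ + X]mulrC divfK ?lt0r_neq0//; ring.
apply/andP; split.
  by rewrite lerBlDr /fwd_quot ler_pdivrMr//; lra.
by rewrite -lerBlDr /bwd_quot ler_pdivlMr//; lra.
Qed.

Lemma sandwich_cvg (E h : R) (dx e : nat -> R) : dx @ \oo --> (0 : R) -> e @ \oo --> (0 : R) ->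
  (fun n => defect E (dx n) (e n) h) @ \oo --> E * h.
Proof.
move=> cd ce.
have -> : E * h = E * (h + 2 * 0) + 2 * 0 / h by ring.
apply: cvgD; last by apply: cvgMl; apply: cvgMr.
by apply: cvgMr; apply: cvgD; [exact: cvg_cst|apply: cvgMr].
Qed.


Section Convergence.
Variable H : R -> R -> R -> R.
Hypothesis H_per : per3 H.
Hypothesis H_C2 : C2_3 H.
Hypothesis H_pp : forall x t p, 0 < dp3 (dp3 H) x t p.
Variables (c l0 l1 P B E C : R).
Hypothesis l0_gt0 : 0 < l0.
Hypothesis l1_gt0 : 0 < l1.
Hypothesis P_ge0 : 0 <= P.
Hypothesis B_ge0 : 0 <= B.
Hypothesis E_ge0 : 0 <= E.
Hypothesis C_ge0 : 0 <= C.
Hypothesis Pcoer : forall x t p, `|dp3 H x t p| <= l1^-1 -> `|p| <= P.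
Variables (M : nat -> mesh) (h : nat -> R) (V : nat -> int -> int -> R) (v : R -> R -> R) (hl : R).
Hypothesis psV : forall n, pscheme H c l0 l1 (M n) (h n) (V n).
Hypothesis VB : forall n k m, evn k m -> `|slope (M n) (V n k) m| <= B.
Hypothesis VE : forall n k m, ~~ evn k m ->
  slope (M n) (V n k) (m + 1) - slope (M n) (V n k) (m - 1) <= 2 * space_step (M n) * E.
Hypothesis dx_cvg : (fun n => space_step (M n) : R) @ \oo --> (0 : R).
Hypothesis dt_cvg : (fun n => time_step (M n) : R) @ \oo --> (0 : R).
Hypothesis h_cvg : h @ \oo --> hl.
Let e (n : nat) : R := n.+1%:R^-1.
Hypothesis Vv : forall n x t, `|vinterp (M n) (V n) x t - v x t| <= e n.
Hypothesis v_per : Z2_periodic v.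
Hypothesis v_lip : lip2 C v.

Let u n := uinterp (M n) (V n).
Let ub := ubar v E.
Let e_cvg : e @ \oo --> (0 : R). Proof. exact: inv_cvg0. Qed.
Let def n k := defect E (space_step (M n)) (e n) k.
Let sand n k x t : 0 < k -> fwd_quot (v ^~ t) k x - def n k <= u n x t <= bwd_quot (v ^~ t) k x + def n k.
Proof. by move=> k0; apply: slope_sandwich; [exact: E_ge0|exact: VE|exact: Vv|exact: k0]. Qed.
Let def_cvg k : def ^~ k @ \oo --> E * k.
Proof. exact: sandwich_cvg. Qed.

Let v_sc t x k k' : 0 < k -> 0 < k' -> fwd_quot (v ^~ t) k x - E * k <= bwd_quot (v ^~ t) k' x + E * k'.
Proof.
move=> k0 k0'; rewrite -subr_ge0.
have cv : (fun n => bwd_quot (v ^~ t) k' x + def n k' - (fwd_quot (v ^~ t) k x - def n k)) @ \oo -->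
    bwd_quot (v ^~ t) k' x + E * k' - (fwd_quot (v ^~ t) k x - E * k).
  apply: cvgB; first by apply: cvgD; [exact: cvg_cst|exact: def_cvg].
  by apply: cvgB; [exact: cvg_cst|exact: def_cvg].
apply: (cvgr_to_ge cv); apply: nearW => n.
by have /andP[a1 _] := sand n x t k0; have /andP[_ a2] := sand n x t k0'; lra.
Qed.

Lemma limit_viscosity : viscosity_solution H c (effective_hamiltonian H c) v.
Proof.
have vs : viscosity_solution H c hl v.
  apply: (viscosity_limit H_C2 H_pp l0_gt0 l1_gt0 psV dx_cvg dt_cvg e_cvg h_cvg VB Vv).
  exact: v_C0 C_ge0 v_lip.
by rewrite (effective_hamiltonian_unique H_per H_C2 C_ge0 v_per vs v_lip).
Qed.

Let u_cvg : {ae (@lebesgue_measure R \x @lebesgue_measure R)%E, forall z : measurableTypeR R * measurableTypeR R,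
  (fun n => uinterp (M n) (V n) z.1 z.2) @ \oo --> (ub z.1 z.2 : R)}.
Proof.
have := ubarl_joint_ae E_ge0 C_ge0 v_per v_lip v_sc.
apply: negligibleS => z /= nz lr; apply: nz.
apply: (cvg_between (v_sc z.2) (k := fun k n => def n k) lr).
  by move=> k n k0; exact: sand.
by move=> k _; exact: def_cvg.
Qed.

Lemma limit_entropy : entropy_solution H c [set: R] ub.
Proof.
split.
- by move=> t _ x; exact: (ubar_per E v_per x t).1.
- by rewrite setXTT; exact: (ubar_joint C_ge0 v_lip v_sc).
- by move=> J _ _; exists C => t _; exact: (ubar_normLinf E_ge0 C_ge0 v_lip v_sc).
- move=> t _; apply: cvg_within_filter; exact: (ubar_L1_cvg E_ge0 C_ge0 v_per v_lip v_sc).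
apply: (entropy_limit H_per H_C2 H_pp l0_gt0 l1_gt0 P_ge0 Pcoer psV dx_cvg dt_cvg (ub := ub) (C := C)).
- exact: (ubar_bound E_ge0 v_lip v_sc).
- exact: (ubar_joint C_ge0 v_lip v_sc).
- exact: u_cvg.
Qed.

Lemma limit_derive t : {ae mu1, forall x : R, is_derive x (1 : R) (v ^~ t) (ub x t)}.
Proof. exact: (ubar_derive_ae E_ge0 C_ge0 v_per v_lip v_sc). Qed.

(** The slopes of the scheme and v_x lie in the same gap of [L1_sandwich], whose
    width does not depend on t. *)
Lemma limit_L1 n t k : 0 < k <= 1 ->
  (\int[@mu1 R]_(x in `[0%R, 1%R]) `|u n x t - ub x t|%:E <= (2 * (def n k + E * k))%:E)%E.
Proof.
move=> k01; have /andP[k0 _] := k01.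
have -> : `[0%R, 1%R]%classic = `[0%R, (0 + 1)%R]%classic :> set R by rewrite add0r.
have d0 : 0 <= def n k.
  rewrite /def /defect; apply: addr_ge0; first apply: mulr_ge0 => //.
    by apply: addr_ge0; [exact: ltW|rewrite mulr_ge0// ltW// space_step_gt0].
  by rewrite divr_ge0 ?(ltW k0)// mulr_ge0// invr_ge0.
have Ek : 0 <= E * k by rewrite mulr_ge0// ltW.
apply: (@L1_sandwich R (v ^~ t) _ k) => //.
- exact: (vt_cont v_lip).
- exact: (vt_per v_per).
- exact: uinterp_measurable.
- exact: (measurable_ubar_t C_ge0 v_lip v_sc t).1.
- by move=> x; have /andP[a1 a2] := sand n x t k0; apply/andP; split; lra.
- by move=> x; have /andP[a1 a2] := ubar_sandwich v_sc t x k0; rewrite /ub; apply/andP; split; lra.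
Qed.

End Convergence.

End Assembly.

(** * Extraction of the sequence *)

Unset Implicit Arguments.

Theorem theorem3p8 (R : realType) (H : R -> R -> R -> R)
    (H_per : forall x t p, H (x + 1) t p = H x t p /\ H x (t + 1) p = H x t p)
    (H_C2 : C2_3 H)
    (H_pp : forall x t p, 0 < dp3 (dp3 H) x t p)
    (H_superlinear : forall x t,
       H x t p / `|p| @[p --> +oo] --> +oo /\
       H x t p / `|p| @[p --> -oo] --> +oo)
    (H_legendre : exists2 alpha : R, 0 < alpha &
       forall x t xi,
         `|dx3 (legendre H) x t xi| <= alpha * (`|legendre H x t xi| + 1))
    (r c0 c1 : R) (r_gt0 : 0 < r) (c0_le_c1 : c0 <= c1)
    (beta : R) (beta_gt0 : 0 < beta)
    (beta_bound : forall c u0 u, c0 <= c <= c1 -> zero_mean_Linf u0 ->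
       entropy_solution_from H c u0 u -> (normLinf (u ^~ 1%R) <= beta%:E)%E)
    (l0 l1 delta : R) (l0_gt0 : 0 < l0) (l0_lt_l1 : l0 < l1)
    (delta_gt0 : 0 < delta)
    (CFL : forall M c u0, admissible_mesh l0 l1 delta M -> c0 <= c <= c1 ->
       Linf_r0 r u0 ->
       (forall k m, grid_even k m ->
          `|dp3 H (xgrid M m) (tgrid M k) (c + LF H M c u0 k m)| <= l1^-1
            /\ l1^-1 < (mesh_ratio M)^-1) /\
       (normLinf (phi_Delta H M c 1%R u0) <= (beta + 1)%:E)%E)
    (fine_meshes : forall e : R, 0 < e ->
       exists2 M, admissible_mesh l0 l1 delta M &
         space_step M < e /\ time_step M < e)
    (r_ge : beta + 1 <= r)
    (c : R) (c_in : c0 <= c <= c1) :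
  exists (M : nat -> mesh) (a : nat -> R) (vbar ubar : R -> R -> R),
    [/\ forall j, admissible_mesh l0 l1 delta (M j),
        (space_step (M j) : R) @[j --> \oo] --> (0 : R),
        (time_step (M j) : R) @[j --> \oo] --> (0 : R) &
    [/\ Z2_periodic vbar,
        viscosity_solution H c (effective_hamiltonian H c) vbar,
        Z2_periodic ubar,
        entropy_solution H c [set: R] ubar &
    [/\ forall t, {ae mu1, forall x : R,
          is_derive x (1 : R) (vbar ^~ t) (ubar x t)},
        ereal_sup [set ereal_sup
            [set `|vbar_Delta H r c (M j) x t + a j - vbar x t|%:E
               | x in `[0%R, 1%R[]
          | t in `[0%R, 1%R[] @[j --> \oo] --> 0%E
      & ereal_sup [set (\int[mu1]_(x in `[0%R, 1%R])
            `|ubar_Delta H r c (M j) x t - ubar x t|%:E)%E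
          | t in `[0%R, 1%R[] @[j --> \oo] --> 0%E]]].
Proof.
have l1_gt0 : 0 < l1 := lt_trans l0_gt0 l0_lt_l1.
have Hp : per3 H by move=> x t p; exact: H_per.
have r_ge0 : 0 <= r := ltW r_gt0.
have [M0 hM0] : exists M0 : nat -> mesh, forall j, admissible_mesh l0 l1 delta (M0 j) /\
    (space_step (M0 j) < j.+1%:R^-1 :> R /\ time_step (M0 j) < j.+1%:R^-1 :> R).
  have fm (j : nat) : exists M, admissible_mesh l0 l1 delta M /\
      (space_step M < j.+1%:R^-1 :> R /\ time_step M < j.+1%:R^-1 :> R).
    by have [|M h1 h2] := fine_meshes (j.+1%:R^-1); [rewrite invr_gt0 ltr0n|exists M].
  by have [M0 hM0] := choice fm; exists M0.
have ps0 (j : nat) : exists V, pscheme H c l0 l1 (M0 j) (hbar_Delta H r c (M0 j)) V /\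
    forall x t, 0 <= t < 1 -> vbar_Delta H r c (M0 j) x t = vinterp (M0 j) V x t
       /\ ubar_Delta H r c (M0 j) x t = uinterp (M0 j) V x t.
  have [adm _] := hM0 j; have [rt _] := adm.
  apply: (periodic_scheme Hp H_C2 H_pp r_ge0 l0_gt0 l1_gt0 rt) => u0 hu0.
  have [h1 h2] := CFL _ _ _ adm c_in hu0.
  split=> [k m em|]; first by have [] := h1 k m em.
  by apply: le_trans h2 _; rewrite lee_fin.
have [V0 hV0] := choice ps0.
have Pc := Hp_coercive Hp H_C2 H_pp H_superlinear l1^-1.
have [P [B [E [C [[P0 B0 E0 C0] Pcoer est]]]]] := scheme_estimates Hp H_C2 H_pp c l0_gt0 l1_gt0 Pc.
(* the additive constants are chosen such that all functions vanish at the origin *)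
pose a0 j := - vinterp (M0 j) (V0 j) 0 0.
pose f j x t := vinterp (M0 j) (V0 j) x t + a0 j.
have BC : 0 <= B + C by exact: addr_ge0.
have dtp j : 0 < time_step (M0 j) :> R by exact: time_step_gt0.
have dtj j : time_step (M0 j) <= j.+1%:R^-1 :> R by apply: ltW; have [_ []] := hM0 j.
have dxj j : space_step (M0 j) <= j.+1%:R^-1 :> R by apply: ltW; have [_ []] := hM0 j.
have dt_cvg0 : (fun j => time_step (M0 j) : R) @ \oo --> (0 : R).
  by apply: squeeze0 dtj => j; exact: ltW.
have inv1 (j : nat) : j.+1%:R^-1 <= 1 :> R by rewrite invf_le1 ?ltr0n// ler1n.
have [||||||||phi [hl [v [phin hphi fv v_per v_lip]]]] :=
    @uniform_subsequence R f (fun j => hbar_Delta H r c (M0 j)) (fun j => time_step (M0 j)) (B + C).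
- exact: BC.
- by move=> j x t; rewrite /f (vinterp_x1 (hV0 j).1).
- by move=> j x t; rewrite /f (vinterp_t1 (hV0 j).1).
- by move=> j; rewrite /f /a0 subrr.
- move=> j x t y s; rewrite /f opprD addrACA subrr addr0.
  have [_ _ _ lip] := est _ _ _ (hV0 j).1.
  apply: le_trans (lip x t y s) _.
  have := mulr_ge0 C0 (normr_ge0 (x - y)).
  have : 0 <= B * (`|t - s| + time_step (M0 j)) by apply: mulr_ge0 => //; apply: addr_ge0 => //; exact: ltW.
  lra.
- exact: dt_cvg0.
- by move=> j; exact: le_trans (dtj j) (inv1 j).
- by move=> j; have [hC _ _ _] := est _ _ _ (hV0 j).1; lra.
pose M n := M0 (phi n); pose a n := a0 (phi n); pose V n k m := V0 (phi n) k m + a n.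
have inv_phi n : (phi n).+1%:R^-1 <= n.+1%:R^-1 :> R.
  by rewrite lef_pV2 ?posrE ?ltr0n// ler_nat ltnS.
have dx_cvg : (fun n => space_step (M n) : R) @ \oo --> (0 : R).
  apply: squeeze0 => n; first by apply: ltW; exact: space_step_gt0.
  exact: le_trans (dxj _) (inv_phi n).
have dt_cvg : (fun n => time_step (M n) : R) @ \oo --> (0 : R).
  apply: squeeze0 => n; first by apply: ltW; exact: time_step_gt0.
  exact: le_trans (dtj _) (inv_phi n).
have psV n : pscheme H c l0 l1 (M n) (hbar_Delta H r c (M n)) (V n).
  exact: pscheme_addc (hV0 (phi n)).1.
have h_cvg : (fun n => hbar_Delta H r c (M n)) @ \oo --> hl.
  apply/cvgrPdist_le => ep ep0; have := inv_small ep0; apply: filterS => n h.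
  by rewrite distrC; exact: le_trans (hphi n) h.
have viE n x t : vinterp (M n) (V n) x t = vinterp (M n) (V0 (phi n)) x t + a n.
  exact: interp_addc.
have uiE n x t : uinterp (M n) (V n) x t = uinterp (M n) (V0 (phi n)) x t.
  by rewrite /uinterp /interp_slope /slope /V; congr (_ / _); ring.
have VB n k m : evn k m -> `|slope (M n) (V n k) m| <= B.
  by have [_ b _ _] := est _ _ _ (psV n); exact: b.
have VE n k m : ~~ evn k m -> slope (M n) (V n k) (m + 1) - slope (M n) (V n k) (m - 1) <= 2 * space_step (M n) * E.
  by have [_ _ b _] := est _ _ _ (psV n); exact: b.
have Vv n x t : `|vinterp (M n) (V n) x t - v x t| <= n.+1%:R^-1 by rewrite viE; exact: fv.
exists M, a, v, (ubar v E); split.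
- by move=> j; exact: (hM0 _).1.
- exact: dx_cvg.
- exact: dt_cvg.
split.
- exact: v_per.
- exact: (limit_viscosity Hp H_C2 H_pp l0_gt0 l1_gt0 BC psV VB dx_cvg dt_cvg h_cvg Vv v_per v_lip).
- exact: ubar_per.
- exact: (limit_entropy Hp H_C2 H_pp l0_gt0 l1_gt0 P0 E0 BC Pcoer psV VE dx_cvg dt_cvg Vv v_per v_lip).
split.
- exact: (limit_derive E0 BC VE dx_cvg Vv v_per v_lip).
- apply: ereal_cvg0 => [n|ep ep0].
    apply: le_trans (ereal_sup_ubound (_ : _ (ereal_sup [set `|vbar_Delta H r c (M n) x 0 + a n - v x 0|%:E | x in `[0%R, 1%R[]))).
      apply: le_trans (ereal_sup_ubound (_ : _ (`|vbar_Delta H r c (M n) 0 0 + a n - v 0 0|%:E))).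
        by rewrite lee_fin.
      by exists 0 => //; rewrite /= in_itv /= lexx ltr01.
    by exists 0 => //; rewrite /= in_itv /= lexx ltr01.
  have := inv_small ep0; apply: filterS => n hn.
  apply: ge_ereal_sup => _ [t /= t01 <-]; apply: ge_ereal_sup => _ [x _ <-].
  rewrite lee_fin; apply: le_trans hn; move: t01; rewrite in_itv /= => t01.
  by have [-> _] := (hV0 (phi n)).2 x t t01; rewrite -/(M n) -viE; exact: Vv.
apply: ereal_cvg0 => [n|ep ep0].
  apply: le_trans (ereal_sup_ubound (_ : _ (\int[mu1]_(x in `[0%R, 1%R]) `|ubar_Delta H r c (M n) x 0 - ubar v E x 0|%:E)%E)).
    by apply: integral_ge0 => x _; rewrite lee_fin.
  by exists 0 => //; rewrite /= in_itv /= lexx ltr01.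
(* the step k of the difference quotients is fixed before the mesh is refined *)
pose k := Num.min 1 (ep / (8 * (E + 1))).
have E1 : 0 < 8 * (E + 1) by rewrite mulr_gt0// ltr_wpDl.
have k0 : 0 < k by rewrite lt_min ltr01 divr_gt0.
have k1 : k <= 1 by rewrite ge_min lexx.
have Ek : E * k <= ep / 8.
  have : k * (8 * (E + 1)) <= ep by rewrite -ler_pdivlMr// ge_min lexx orbT.
  by have := mulr_ge0 E0 (ltW k0); lra.
have dc : (fun n => defect E (space_step (M n)) (n.+1%:R^-1) k) @ \oo --> E * k.
  by apply: sandwich_cvg => //; exact: inv_cvg0.
have ep8 : 0 < ep / 8 by rewrite divr_gt0.
have /cvgrPdist_le /(_ _ ep8) := dc; apply: filterS => n.
rewrite ler_norml => /andP[h1 _].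
apply: ge_ereal_sup => _ [t /= t01 <-]; move: t01; rewrite in_itv /= => t01.
have k01 : 0 < k <= 1 by rewrite k0.
have key := limit_L1 E0 BC VE dx_cvg Vv v_per v_lip n t k01.
apply: le_trans (le_trans _ key) _; last by rewrite lee_fin; lra.
rewrite le_eqVlt; apply/orP; left; apply/eqP; apply: eq_integral => x _.
by have [_ ->] := (hV0 (phi n)).2 x t t01; rewrite uiE.
Qed.
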